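(* Let $\mathcal F$ be a class of graphs. Assume that $\mathcal F$ is stable by taking complements and by taking connected components (i.e. $G\in\mathcal F$ implies $G^c\in\mathcal F$ and every connected component of $G$ is in $\mathcal F$). Then: (1) if $\mathcal F$ satisfies (QI), so does $\mathrm{co}(\mathcal F)$; (2) if $\mathcal F$ satisfies (QI) and (QA), so does $\mathrm{co}(\mathcal F)$; (3) if $\mathcal F$ satisfies (QI), (QA) and (SA), so does $\mathrm{co}(\mathcal F)$.
   Context: Graphs are finite, simple and undirected, with at least one vertex, considered up to isomorphism (so $G=H$ means isomorphic); a class of graphs is a set of isomorphism classes of graphs. $\mathrm{co}(\mathcal F)$, the class of $\mathcal F$-cographs, is the smallest class of graphs containing $\mathcal F$ and stable under finite disjoint unions (sums) and complement $G\mapsto G^c$. Axioms for a class $\mathcal F$: (QA) for all $G\in\mathcal F$, $\mathrm{Qu}(G)$ is trivial if and only if $\mathrm{Aut}(G)$ is trivial; (QI) for all $G,H\in\mathcal F$, $G$ and $H$ are quantum isomorphic if and only if $G=H$; (SA) for all $G\in\mathcal F$, $G$ has quantum symmetry if and only if $G$ satisfies Schmidt's criterion. Definitions. A magic unitary with coefficients in a nonzero unital $C^*$-algebra $X$ is a square matrix whose entries are self-adjoint projections of $X$ with every row and column summing to $1_X$. $G$ and $H$ (with equally many vertices) are quantum isomorphic if there is a magic unitary $U$, with coefficients in some nonzero unital $C^*$-algebra, rows indexed by $V(H)$ and columns by $V(G)$, with $U\,\mathrm{Adj}(G)=\mathrm{Adj}(H)\,U$ ($\mathrm{Adj}$ =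 adjacency matrix). $\mathcal O(\mathrm{Qu}(G))$ is the universal unital complex $*$-algebra generated by $u_{xy}$ ($x,y\in V(G)$) with relations $u_{xy}^*=u_{xy}=u_{xy}^2$, $\sum_y u_{xy}=1=\sum_y u_{yx}$, $u_{xy}u_{xz}=0=u_{yx}u_{zx}$ for $y\ne z$, and $u\,\mathrm{Adj}(G)=\mathrm{Adj}(G)\,u$; $C(\mathrm{Qu}(G))$ is its universal enveloping $C^*$-algebra. $\mathrm{Qu}(G)$ is trivial if $\mathcal O(\mathrm{Qu}(G))=\mathbb C$. $G$ has quantum symmetry if $C(\mathrm{Qu}(G))$ is not commutative. $G$ satisfies Schmidt's criterion if it has two nontrivial automorphisms with disjoint supports, where $\mathrm{Supp}(f)=\{x\in V(G)\mid f(x)\neq x\}$. *)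

(* Defs.v *)
From HB Require Import structures.
From mathcomp Require Import all_boot all_order all_algebra all_fingroup.
From mathcomp Require Import generic_quotient.
From mathcomp Require Import complex.
From mathcomp Require Import boolp reals.

Set Implicit Arguments.
Unset Strict Implicit.
Unset Printing Implicit Defensive.

Import Order.TTheory GRing.Theory Num.Theory.

Local Open Scope ring_scope.
Local Open Scope quotient_scope.
Local Open Scope complex_scope.

Record sgraph : Type := SGraph {
  vert :> finType;
  adj : rel vert;
  adj_sym : symmetric adj;
  adj_irrefl : irreflexive adj;
  vert_gt0 : (0 < #|vert|)%N
}.

Definition graph_iso (G H : sgraph) : Prop :=
  exists2 f : G -> H, bijective f & forall x y, adj (f x) (f y) = adj x y.

Section Complement.
Variable G : sgraph.

Definition compl_adj : rel G := [rel x y | (x != y) && ~~ adj x y].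

Lemma compl_adj_sym : symmetric compl_adj.
Proof. by move=> x y; rewrite /compl_adj /= eq_sym adj_sym. Qed.

Lemma compl_adj_irrefl : irreflexive compl_adj.
Proof. by move=> x; rewrite /compl_adj /= eqxx. Qed.

Definition gcompl : sgraph :=
  SGraph compl_adj_sym compl_adj_irrefl (vert_gt0 G).

End Complement.

Section DisjointUnion.
Variables (I : finType) (G : I -> sgraph) (I_gt0 : (0 < #|I|)%N).

Definition dunion_adj : rel {i : I & G i} :=
  [rel u v | (tag u == tag v) && adj (tagged u) (tagged_as u v)].

Lemma dunion_adj_sym : symmetric dunion_adj.
Proof.
move=> [i x] [j y]; rewrite /dunion_adj /= eq_sym.
case: (j =P i) => [eji|//]; case: i / eji x => x /=.
by rewrite !tagged_asE adj_sym.
Qed.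

Lemma dunion_adj_irrefl : irreflexive dunion_adj.
Proof. by move=> [i x]; rewrite /dunion_adj /= eqxx tagged_asE adj_irrefl. Qed.

Lemma dunion_gt0 : (0 < #|{: {i : I & G i}}|)%N.
Proof.
case/card_gt0P: I_gt0 => i _; case/card_gt0P: (vert_gt0 (G i)) => x _.
by apply/card_gt0P; exists (Tagged (fun i => G i) x).
Qed.

Definition dunion : sgraph :=
  SGraph dunion_adj_sym dunion_adj_irrefl dunion_gt0.

End DisjointUnion.

Section Component.
Variables (G : sgraph) (x : G).

Definition comp_vert : finType := {y : G | connect (@adj G) x y}.

Definition comp_adj : rel comp_vert := [rel u v | adj (val u) (val v)].

Lemma comp_adj_sym : symmetric comp_adj.
Proof. by move=> u v; rewrite /comp_adj /= adj_sym. Qed.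

Lemma comp_adj_irrefl : irreflexive comp_adj.
Proof. by move=> u; rewrite /comp_adj /= adj_irrefl. Qed.

Lemma comp_gt0 : (0 < #|comp_vert|)%N.
Proof. by apply/card_gt0P; exists (exist _ x (connect0 _ x)). Qed.

(* The connected component of x, as an induced subgraph. *)
Definition component : sgraph :=
  SGraph comp_adj_sym comp_adj_irrefl comp_gt0.

End Component.

(* Classes of graphs are sets of isomorphism classes. *)
Record graph_class : Type := GraphClass {
  in_class :> sgraph -> Prop;
  in_class_iso : forall G H, graph_iso G H -> in_class G -> in_class H
}.

Inductive in_co (F : graph_class) : sgraph -> Prop :=
| co_base G : F G -> in_co F G
| co_dunion (I : finType) (G : I -> sgraph) (I_gt0 : (0 < #|I|)%N) :
    (forall i, in_co F (G i)) -> in_co F (dunion G I_gt0)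
| co_compl G : in_co F G -> in_co F (gcompl G)
| co_iso G H : graph_iso G H -> in_co F G -> in_co F H.

Definition co (F : graph_class) : graph_class := GraphClass (@co_iso F).

Definition graph_aut (G : sgraph) : {set {perm G}} :=
  [set f : {perm G} | [forall x, forall y, adj (f x) (f y) == adj x y]].

Definition graph_supp (G : sgraph) (f : {perm G}) : {set G} :=
  [set x | f x != x].

Definition schmidt (G : sgraph) : Prop :=
  exists f g : {perm G},
    [/\ f \in graph_aut G, g \in graph_aut G, f != 1%g, g != 1%g
      & [disjoint graph_supp f & graph_supp g]].

(* Algebras in the library are unital and satisfy 1 != 0. *)
HB.mixin Record isStarAlgebra (C : numClosedFieldType) A
    of GRing.Algebra C A := {
  star : A -> A;
  starK : involutive star;
  starD : {morph star : x y / x + y};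
  starM : forall x y, star (x * y) = star y * star x;
  starZ : forall (a : C) x, star (a *: x) = a^* *: star x
}.

#[short(type="starAlgType")]
HB.structure Definition StarAlgebra (C : numClosedFieldType) :=
  {A of isStarAlgebra C A & GRing.Algebra C A}.

(* The norm is a field of the mixin because the hierarchy admits no common
   substructure of rings and of modules normed over another ring. *)
HB.mixin Record isCStarAlgebra (R : realType) A of StarAlgebra R[i] A := {
  cnorm : A -> R;
  cnormD : forall x y, cnorm (x + y) <= cnorm x + cnorm y;
  cnormZ : forall (a : R[i]) x, cnorm (a *: x) = ComplexField.Normc.normc a * cnorm x;
  cnorm0_eq0 : forall x, cnorm x = 0 -> x = 0;
  cnormM : forall x y, cnorm (x * y) <= cnorm x * cnorm y;
  cnorm_starM : forall x, cnorm (star x * x) = cnorm x ^+ 2;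
  cnorm_complete : forall u : nat -> A,
    (forall e : R, 0 < e -> exists N, forall m n, (N <= m)%N -> (N <= n)%N ->
       cnorm (u m - u n) < e) ->
    exists l : A, forall e : R, 0 < e -> exists N, forall n, (N <= n)%N ->
       cnorm (u n - l) < e
}.

#[short(type="cstarAlgType")]
HB.structure Definition CStarAlgebra (R : realType) :=
  {A of isCStarAlgebra R A & StarAlgebra R[i] A}.

Definition star_preserving (C : numClosedFieldType) (A B : starAlgType C)
  (f : A -> B) : Prop := {morph f : x / star x}.

Definition is_projection (C : numClosedFieldType) (A : starAlgType C) (p : A)
  : Prop := star p = p /\ p * p = p.

Definition adjm (A : nzRingType) (G : sgraph) (x y : G) : A := (adj x y)%:R.

Definition magic_unitary (R : realType) (A : cstarAlgType R)
    (I J : finType) (U : I -> J -> A) : Prop :=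
  [/\ #|I| = #|J|,
      forall i j, is_projection (U i j),
      forall i, \sum_j U i j = 1
    & forall j, \sum_i U i j = 1].

Definition quantum_iso (R : realType) (G H : sgraph) : Prop :=
  exists (A : cstarAlgType R) (U : H -> G -> A),
    magic_unitary U /\
    forall (x : H) (y : G),
      \sum_(z : G) U x z * adjm A z y = \sum_(z : H) adjm A x z * U z y.

Section QuantumAutomorphismGroup.
Variables (C : numClosedFieldType) (G : sgraph).

Inductive qu_term : Type :=
| QGen of G & G
| QCst of C
| QAdd of qu_term & qu_term
| QMul of qu_term & qu_term
| QStar of qu_term.

Let qsum (f : G -> qu_term) : qu_term := \big[QAdd/QCst 0]_(x : G) f x.
Let qadj (x y : G) : qu_term := QCst (adj x y)%:R.

Inductive qu_rel : qu_term -> qu_term -> Prop :=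
| qu_star x y : qu_rel (QStar (QGen x y)) (QGen x y)
| qu_idem x y : qu_rel (QMul (QGen x y) (QGen x y)) (QGen x y)
| qu_row x : qu_rel (qsum (fun y => QGen x y)) (QCst 1)
| qu_col x : qu_rel (qsum (fun y => QGen y x)) (QCst 1)
| qu_row_orth x y z : y != z ->
    qu_rel (QMul (QGen x y) (QGen x z)) (QCst 0)
| qu_col_orth x y z : y != z ->
    qu_rel (QMul (QGen y x) (QGen z x)) (QCst 0)
| qu_adj x y :
    qu_rel (qsum (fun z => QMul (QGen x z) (qadj z y)))
           (qsum (fun z => QMul (qadj x z) (QGen z y))).

(* The least congruence containing qu_rel and the axioms of unital
   *-algebras over C; QCst c stands for c times the unit. *)
Inductive qu_cong : qu_term -> qu_term -> Prop :=
| qc_rel s t : qu_rel s t -> qu_cong s t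
| qc_refl t : qu_cong t t
| qc_sym s t : qu_cong s t -> qu_cong t s
| qc_trans s t u : qu_cong s t -> qu_cong t u -> qu_cong s u
| qc_add s s' t t' :
    qu_cong s s' -> qu_cong t t' -> qu_cong (QAdd s t) (QAdd s' t')
| qc_mul s s' t t' :
    qu_cong s s' -> qu_cong t t' -> qu_cong (QMul s t) (QMul s' t')
| qc_star s s' : qu_cong s s' -> qu_cong (QStar s) (QStar s')
| qc_addA s t u : qu_cong (QAdd s (QAdd t u)) (QAdd (QAdd s t) u)
| qc_addC s t : qu_cong (QAdd s t) (QAdd t s)
| qc_add0 t : qu_cong (QAdd (QCst 0) t) t
| qc_addN t : qu_cong (QAdd (QMul (QCst (-1)) t) t) (QCst 0)
| qc_mulA s t u : qu_cong (QMul s (QMul t u)) (QMul (QMul s t) u)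
| qc_mul1 t : qu_cong (QMul (QCst 1) t) t
| qc_mulDl s t u :
    qu_cong (QMul (QAdd s t) u) (QAdd (QMul s u) (QMul t u))
| qc_mulDr s t u :
    qu_cong (QMul s (QAdd t u)) (QAdd (QMul s t) (QMul s u))
| qc_cstD a b : qu_cong (QCst (a + b)) (QAdd (QCst a) (QCst b))
| qc_cstM a b : qu_cong (QCst (a * b)) (QMul (QCst a) (QCst b))
| qc_cstC a t : qu_cong (QMul (QCst a) t) (QMul t (QCst a))
| qc_starK t : qu_cong (QStar (QStar t)) t
| qc_starD s t : qu_cong (QStar (QAdd s t)) (QAdd (QStar s) (QStar t))
| qc_starM s t : qu_cong (QStar (QMul s t)) (QMul (QStar t) (QStar s))
| qc_starC a : qu_cong (QStar (QCst a)) (QCst a^*).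

(* The counit u_xy |-> delta_xy, which shows 1 != 0 in the quotient. *)
Fixpoint qu_counit (t : qu_term) : C :=
  match t with
  | QGen x y => (x == y)%:R
  | QCst a => a
  | QAdd s t => qu_counit s + qu_counit t
  | QMul s t => qu_counit s * qu_counit t
  | QStar t => (qu_counit t)^*
  end.

Lemma qu_counit_sum f : qu_counit (qsum f) = \sum_x qu_counit (f x).
Proof. exact: (big_morph qu_counit (id1 := 0)). Qed.

Lemma qu_counit_rel s t : qu_rel s t -> qu_counit s = qu_counit t.
Proof.
have sum1 (x : G) (f : G -> C) : \sum_z (x == z)%:R * f z = f x.
  rewrite (bigD1 x) //= eqxx mul1r big1 ?addr0 // => z.
  by rewrite eq_sym => /negPf->; rewrite mul0r.
case=> /=.
- by move=> x y; rewrite conjC_nat.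
- by move=> x y; case: eqP; rewrite ?mulr1 ?mulr0.
- move=> x; rewrite qu_counit_sum /= -[RHS](sum1 x (fun=> 1)).
  by apply: eq_bigr => z _; rewrite mulr1.
- move=> x; rewrite qu_counit_sum /= -[RHS](sum1 x (fun=> 1)).
  by apply: eq_bigr => z _; rewrite mulr1 eq_sym.
- move=> x y z; case: (x =P y) => [->|_ _]; last by rewrite mul0r.
  by move/negPf->; rewrite mulr0.
- move=> x y z; case: (y =P x) => [->|_ _]; last by rewrite mul0r.
  by rewrite eq_sym => /negPf->; rewrite mulr0.
- move=> x y; rewrite !qu_counit_sum /= sum1.
  rewrite -[LHS](sum1 y (fun z => (adj x z)%:R)).
  by apply: eq_bigr => z _; rewrite mulrC eq_sym.
Qed.

Lemma qu_counit_cong s t : qu_cong s t -> qu_counit s = qu_counit t.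
Proof.
elim=> //=.
- exact: qu_counit_rel.
- by move=> s1 t1 u _ -> _ ->.
- by move=> s1 s2 t1 t2 _ -> _ ->.
- by move=> s1 s2 t1 t2 _ -> _ ->.
- by move=> s1 s2 _ ->.
- by move=> s1 t1 u; rewrite addrA.
- by move=> s1 t1; rewrite addrC.
- by move=> t1; rewrite add0r.
- by move=> t1; rewrite mulN1r addNr.
- by move=> s1 t1 u; rewrite mulrA.
- by move=> t1; rewrite mul1r.
- by move=> s1 t1 u; rewrite mulrDl.
- by move=> s1 t1 u; rewrite mulrDr.
- by move=> a t1; rewrite mulrC.
- by move=> t1; rewrite conjCK.
- by move=> s1 t1; rewrite rmorphD.
- by move=> s1 t1; rewrite rmorphM mulrC.
Qed.

HB.instance Definition _ := gen_eqMixin qu_term.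
HB.instance Definition _ := gen_choiceMixin qu_term.

Definition qu_congb : rel qu_term := [rel s t | `[< qu_cong s t >]].

Lemma qu_congb_refl : reflexive qu_congb.
Proof. by move=> t; apply/asboolP; apply: qc_refl. Qed.

Lemma qu_congb_sym : symmetric qu_congb.
Proof. by move=> s t; apply/asboolP/asboolP; apply: qc_sym. Qed.

Lemma qu_congb_trans : transitive qu_congb.
Proof. by move=> t s u /asboolP st /asboolP tu; apply/asboolP/(qc_trans st). Qed.

Canonical qu_cong_equiv :=
  EquivRel qu_congb qu_congb_refl qu_congb_sym qu_congb_trans.

Definition OQu : Type := {eq_quot qu_congb}.

HB.instance Definition _ := Choice.on OQu.
HB.instance Definition _ := EqQuotient.on OQu.

Lemma OQuP (s t : qu_term) : \pi_OQu s = \pi_OQu t <-> qu_cong s t.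
Proof.
split; first by move/eqmodP/asboolP.
by move=> st; apply/eqmodP/asboolP.
Qed.

Definition oqu_cst (a : C) : OQu := \pi_OQu (QCst a).
Definition oqu_add (a b : OQu) : OQu := \pi_OQu (QAdd (repr a) (repr b)).
Definition oqu_mul (a b : OQu) : OQu := \pi_OQu (QMul (repr a) (repr b)).
Definition oqu_star (a : OQu) : OQu := \pi_OQu (QStar (repr a)).
Definition oqu_opp (a : OQu) : OQu := oqu_mul (oqu_cst (-1)) a.
Definition oqu_scale (c : C) (a : OQu) : OQu := oqu_mul (oqu_cst c) a.
Definition oqu_gen (x y : G) : OQu := \pi_OQu (QGen x y).

Lemma cong_repr t : qu_cong (repr (\pi_OQu t)) t.
Proof. by apply/OQuP; rewrite reprK. Qed.

Lemma pi_add s t : \pi_OQu (QAdd s t) = oqu_add (\pi s) (\pi t).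
Proof. by apply/esym/OQuP/qc_add; apply: cong_repr. Qed.

Lemma pi_mul s t : \pi_OQu (QMul s t) = oqu_mul (\pi s) (\pi t).
Proof. by apply/esym/OQuP/qc_mul; apply: cong_repr. Qed.

Lemma pi_star t : \pi_OQu (QStar t) = oqu_star (\pi t).
Proof. by apply/esym/OQuP/qc_star/cong_repr. Qed.

Lemma oqu_addA : associative oqu_add.
Proof.
by elim/quotW=> s; elim/quotW=> t; elim/quotW=> u; rewrite -!pi_add;
  apply/OQuP/qc_addA.
Qed.

Lemma oqu_addC : commutative oqu_add.
Proof.
by elim/quotW=> s; elim/quotW=> t; rewrite -!pi_add; apply/OQuP/qc_addC.
Qed.

Lemma oqu_add0 : left_id (oqu_cst 0) oqu_add.
Proof. by elim/quotW=> t; rewrite -pi_add; apply/OQuP/qc_add0. Qed.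

Lemma oqu_addN : left_inverse (oqu_cst 0) oqu_opp oqu_add.
Proof. by elim/quotW=> t; rewrite /oqu_opp -pi_mul -pi_add; apply/OQuP/qc_addN. Qed.

HB.instance Definition _ :=
  GRing.isZmodule.Build OQu oqu_addA oqu_addC oqu_add0 oqu_addN.

Lemma pi_addr s t : \pi_OQu (QAdd s t) = \pi_OQu s + \pi_OQu t.
Proof. exact: pi_add. Qed.

Lemma oqu_mulA : associative oqu_mul.
Proof.
by elim/quotW=> s; elim/quotW=> t; elim/quotW=> u; rewrite -!pi_mul;
  apply/OQuP/qc_mulA.
Qed.

Lemma oqu_mul1l : left_id (oqu_cst 1) oqu_mul.
Proof. by elim/quotW=> t; rewrite -pi_mul; apply/OQuP/qc_mul1. Qed.

Lemma oqu_cst_comm a t : oqu_mul (oqu_cst a) t = oqu_mul t (oqu_cst a).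
Proof. by elim/quotW: t => t; rewrite -!pi_mul; apply/OQuP/qc_cstC. Qed.

Lemma oqu_mul1r : right_id (oqu_cst 1) oqu_mul.
Proof. by move=> t; rewrite -oqu_cst_comm oqu_mul1l. Qed.

Lemma oqu_mulDl : left_distributive oqu_mul +%R.
Proof.
elim/quotW=> s; elim/quotW=> t; elim/quotW=> u.
by rewrite -(pi_addr s t) -!pi_mul -pi_addr; apply/OQuP/qc_mulDl.
Qed.

Lemma oqu_mulDr : right_distributive oqu_mul +%R.
Proof.
elim/quotW=> s; elim/quotW=> t; elim/quotW=> u.
by rewrite -(pi_addr t u) -!pi_mul -pi_addr; apply/OQuP/qc_mulDr.
Qed.

Lemma oqu_1_neq_0 : oqu_cst 1 != 0.
Proof.
by apply/eqP => /OQuP/qu_counit_cong /eqP; rewrite /= oner_eq0.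
Qed.

HB.instance Definition _ := GRing.Zmodule_isNzRing.Build OQu
  oqu_mulA oqu_mul1l oqu_mul1r oqu_mulDl oqu_mulDr oqu_1_neq_0.

Lemma pi_mulr s t : \pi_OQu (QMul s t) = \pi_OQu s * \pi_OQu t.
Proof. exact: pi_mul. Qed.

Lemma oqu_cstM a b : oqu_cst (a * b) = oqu_mul (oqu_cst a) (oqu_cst b).
Proof. by rewrite -pi_mul; apply/OQuP/qc_cstM. Qed.

Lemma oqu_cstD a b : oqu_cst (a + b) = oqu_cst a + oqu_cst b.
Proof. by rewrite -[RHS]pi_add; apply/OQuP/qc_cstD. Qed.

Lemma oqu_scaleA a b v : oqu_scale a (oqu_scale b v) = oqu_scale (a * b) v.
Proof. by rewrite /oqu_scale oqu_mulA oqu_cstM. Qed.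

Lemma oqu_scale1 : left_id 1 oqu_scale.
Proof. exact: oqu_mul1l. Qed.

Lemma oqu_scaleDr : right_distributive oqu_scale +%R.
Proof. by move=> a u v; apply: oqu_mulDr. Qed.

Lemma oqu_scaleDl v : {morph oqu_scale^~ v : a b / a + b}.
Proof. by move=> a b; rewrite /oqu_scale oqu_cstD oqu_mulDl. Qed.

HB.instance Definition _ := GRing.Zmodule_isLmodule.Build C OQu
  oqu_scaleA oqu_scale1 oqu_scaleDr oqu_scaleDl.

Lemma oqu_scaleAl (a : C) (u v : OQu) : a *: (u * v) = a *: u * v.
Proof. exact: oqu_mulA. Qed.

HB.instance Definition _ := GRing.Lmodule_isLalgebra.Build C OQu oqu_scaleAl.

Lemma oqu_scaleAr (a : C) (u v : OQu) : a *: (u * v) = u * (a *: v).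
Proof.
rewrite -[LHS]/(oqu_mul _ (oqu_mul _ _)) -[RHS]/(oqu_mul _ (oqu_mul _ _)).
by rewrite !oqu_mulA oqu_cst_comm.
Qed.

HB.instance Definition _ := GRing.Lalgebra_isAlgebra.Build C OQu oqu_scaleAr.

Lemma oqu_starK : involutive oqu_star.
Proof. by elim/quotW=> t; rewrite -!pi_star; apply/OQuP/qc_starK. Qed.

Lemma oqu_starD : {morph oqu_star : x y / x + y}.
Proof.
elim/quotW=> s; elim/quotW=> t.
by rewrite -(pi_addr s t) -!pi_star -pi_addr; apply/OQuP/qc_starD.
Qed.

Lemma oqu_starM (x y : OQu) : oqu_star (x * y) = oqu_star y * oqu_star x.
Proof.
elim/quotW: x => s; elim/quotW: y => t.
by rewrite -(pi_mulr s t) -!pi_star -pi_mulr; apply/OQuP/qc_starM.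
Qed.

Lemma oqu_starZ (a : C) (x : OQu) : oqu_star (a *: x) = a^* *: oqu_star x.
Proof.
rewrite -[a *: x]/(oqu_cst a * x) oqu_starM.
have -> : oqu_star (oqu_cst a) = oqu_cst a^*.
  by rewrite -pi_star; apply/OQuP/qc_starC.
by rewrite -[LHS]/(oqu_mul _ _) -oqu_cst_comm.
Qed.

HB.instance Definition _ := isStarAlgebra.Build C OQu
  oqu_starK oqu_starD oqu_starM oqu_starZ.

End QuantumAutomorphismGroup.

(* O(Qu(G)) = C, i.e. the unit map C -> O(Qu(G)) is an isomorphism. *)
Definition qu_trivial (R : realType) (G : sgraph) : Prop :=
  bijective (fun c : R[i] => c%:A : OQu R[i] G).

Definition is_cstar_envelope (R : realType) (A : starAlgType R[i])
    (B : cstarAlgType R) (iota : {lrmorphism A -> B}) : Prop :=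
  star_preserving iota /\
  forall (D : cstarAlgType R) (phi : {lrmorphism A -> D}),
    star_preserving phi ->
    exists psi : {lrmorphism B -> D},
      [/\ star_preserving psi, psi \o iota =1 phi
        & forall psi' : {lrmorphism B -> D},
            star_preserving psi' -> psi' \o iota =1 phi -> psi' =1 psi].

(* C(Qu(G)) is only determined up to isomorphism, and so is represented by an
   arbitrary enveloping C*-algebra of O(Qu(G)); one exists because O(Qu(G)) is
   generated by projections. *)
Definition quantum_symmetry (R : realType) (G : sgraph) : Prop :=
  forall (B : cstarAlgType R) (iota : {lrmorphism OQu R[i] G -> B}),
    is_cstar_envelope iota -> ~ commutative (fun a b : B => a * b).

Definition axiom_QA (R : realType) (F : graph_class) : Prop :=
  forall G, F G -> (qu_trivial R G <-> graph_aut G = [set 1%g]).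

Definition axiom_QI (R : realType) (F : graph_class) : Prop :=
  forall G H, F G -> F H -> (quantum_iso R G H <-> graph_iso G H).

Definition axiom_SA (R : realType) (F : graph_class) : Prop :=
  forall G, F G -> (quantum_symmetry R G <-> schmidt G).

(* Main.v *)
(* A magic unitary [u] intertwining [G] and [H] satisfies [u x y * u x' y' = 0]
   as soon as [x ~ x'] and [y ~ y'] have different truth values. Hence the sum
   of [u x y] over [y] in a component [C] of [G] depends only on [C] and on the
   component [D] of [x]; these projections [P D C] again form a magic unitary,
   and a nonzero [P D C] makes [C] and [D] quantum isomorphic, over the corner
   of the algebra cut out by [P D C]. Every F-cograph is reduced to F by passing
   to the components of the graph or of its complement, and complementation
   changes none of the notions involved, so that each axiom only has to be
   lifted from the components of a graph to the graph.
   (QI) By induction [P D C] is nonzero only if [D] and [C] are isomorphic, and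
   summing [P] over an isomorphism class shows that both graphs have the same
   number of components in that class.
   (QA) If [Qu(D)] is trivial and [u] is a magic matrix from [D] to [C] over a
   nonzero algebra, then [\sum_y u x y (x) u x' y] satisfies the relations of
   [Qu(D)], hence vanishes for [x != x']; so in every column of [u] only one
   entry is nonzero, and [C], [D] are isomorphic. If [Aut(G)] is trivial, the
   components are pairwise not isomorphic, so [P] is the identity.
   (SA) [G] has no quantum symmetry if and only if the entries of every magic
   unitary commuting with the adjacency matrix commute with each other;
   [C(Qu(G))] is then the algebra of functions on [Aut(G)]. If two entries do
   not commute, then either they belong to one component, which is handled by
   induction, or moving components around gives two automorphisms with disjoint
   supports, or they are blocks [P D C] of at most three isomorphic components,
   which is excluded as the entries of a 3 by 3 magic unitary commute. Conversely,
   automorphisms [f], [g] with disjoint supports and noncommuting projections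
   [p], [q] give the magic unitary [(p + (1 - p) f) (q + (1 - q) g)]. *)

Require Import Defs.
From HB Require Import structures.
From mathcomp Require Import all_boot all_order all_algebra all_fingroup.
From mathcomp Require Import generic_quotient complex boolp classical_sets.
From mathcomp Require Import functions reals lra.

Set Implicit Arguments.
Unset Strict Implicit.
Unset Printing Implicit Defensive.

Import Order.TTheory GRing.Theory Num.Theory.

Local Open Scope ring_scope.
Local Open Scope quotient_scope.

Local Notation normc := ComplexField.Normc.normc.
(* The library's [schmidt] is Gram-Schmidt orthogonalization. *)
Local Notation schmidt := Defs.schmidt.

(** * Projections in C*-algebras *)

Section StarAlgebraTheory.
Variables (C : numClosedFieldType) (A : starAlgType C).
Implicit Types (x y : A).

Lemma star0 : star (0 : A) = 0.
Proof. by rewrite -(scale0r 0) starZ rmorph0 !scale0r. Qed.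

Lemma star1 : star (1 : A) = 1.
Proof. by rewrite -[star 1]mulr1 -{2}(starK 1) -starM mulr1 starK. Qed.

Lemma starN x : star (- x) = - star x.
Proof. by rewrite -scaleN1r starZ rmorphN rmorph1 scaleN1r. Qed.

Lemma starB x y : star (x - y) = star x - star y.
Proof. by rewrite starD starN. Qed.

Lemma star_sum (I : Type) (r : seq I) (P : pred I) (F : I -> A) :
  star (\sum_(i <- r | P i) F i) = \sum_(i <- r | P i) star (F i).
Proof. exact: (big_morph star (@starD _ A) star0). Qed.

Lemma projectionC (p : A) : is_projection p -> is_projection (1 - p).
Proof.
case=> ps pp; split; first by rewrite starB ps star1.
by rewrite mulrBl mul1r mulrBr mulr1 pp subrr subr0.
Qed.

End StarAlgebraTheory.

Section CStarNorm.
Variables (R : realType) (A : cstarAlgType R).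
Implicit Types (x y k : A).

Lemma normcN1 : normc (-1 : R[i]) = 1.
Proof. by rewrite normcN ComplexField.Normc.normc1. Qed.

Lemma normc_conj (a : R[i]) : normc (Num.conj a) = normc a.
Proof. by case: a => a b /=; rewrite sqrrN. Qed.

Lemma normc_real (a : R) : normc a%:C%C = `|a|.
Proof. by rewrite /= expr0n addr0 sqrtr_sqr. Qed.

Lemma cnorm0 : cnorm (0 : A) = 0.
Proof. by rewrite -(scale0r 0) cnormZ ComplexField.Normc.normc0 mul0r. Qed.

Lemma cnormN x : cnorm (- x) = cnorm x.
Proof. by rewrite -scaleN1r cnormZ normcN1 mul1r. Qed.

Lemma cnorm_ge0 x : 0 <= cnorm x.
Proof. by have := cnormD x (- x); rewrite subrr cnorm0 cnormN; lra. Qed.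

Lemma cnormB x y : cnorm (x - y) <= cnorm x + cnorm y.
Proof. by rewrite -(cnormN y); apply: cnormD. Qed.

Lemma cnorm_sum (I : Type) (r : seq I) (P : pred I) (F : I -> A) :
  cnorm (\sum_(i <- r | P i) F i) <= \sum_(i <- r | P i) cnorm (F i).
Proof.
elim/big_rec2: _ => [|i a b _ le_ba]; first by rewrite cnorm0.
by apply: le_trans (cnormD _ _) _; rewrite lerD2l.
Qed.

(** The C*-identity reads [cnorm p = cnorm p ^+ 2], so the norm is 0 or 1. *)
Lemma cnorm_proj_le1 (p : A) : is_projection p -> cnorm p <= 1.
Proof.
case=> ps pp; have := cnorm_starM p; rewrite ps pp expr2.
have [->|p0] := eqVneq (cnorm p) 0; first by rewrite ler01.
by rewrite -{1}(mulr1 (cnorm p)) => /(mulfI p0) <-.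
Qed.

(* The square of [e + k] averaged with that of [e + 'i k] is [e + (1 + 'i) k],
   so the hypothesis is stable under [k |-> 2 k], which forces [k = 0]. *)
Lemma cnorm_sym_eq0 (e k : A) : is_projection e -> e * k = k -> k * e = k ->
  star k = k -> cnorm (e + k) <= 1 -> cnorm (e - k) <= 1 -> k = 0.
Proof.
move=> [es ee] ek ke ks hp hm.
have sq h a : e * h = h -> h * e = h ->
    (e + a *: h) * (e + a *: h) = e + (2 * a) *: h + a ^+ 2 *: (h * h).
  move=> eh he; rewrite mulrDl !mulrDr ee -!scalerAl -!scalerAr eh he !addrA scalerA expr2.
  by rewrite -(addrA e) -scalerDl mulr_natl.
have le1 x y : cnorm x <= 1 -> cnorm y <= 1 -> cnorm (x * y) <= 1.
  move=> hx hy; apply: le_trans (cnormM _ _) _.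
  by apply: mulr_ile1 => //; apply: cnorm_ge0.
have half x y : cnorm x <= 1 -> cnorm y <= 1 -> cnorm (2^-1 *: (x + y)) <= 1.
  move=> hx hy; rewrite cnormZ.
  have -> : 2^-1 = (2^-1 : R)%:C%C :> R[i] by rewrite fmorphV rmorph_nat.
  rewrite normc_real ger0_norm ?invr_ge0 ?ler0n //.
  by have := cnormD x y; lra.
(* All rotations of [h] by powers of ['i] are kept, as each averaging step combines two consecutive
   ones. *)
pose ok (h : A) := forall n, cnorm (e + ('i ^+ n : R[i]) *: h) <= 1.
have okk : ok k.
  have i2 : ('i * 'i : R[i]) = -1 by rewrite -expr2 sqrCi.
  have hp2 : cnorm (e + k * k) <= 1.
    have := half _ _ (le1 _ _ hp hp) (le1 _ _ hm hm).
    have -> // : 2^-1 *: ((e + k) * (e + k) + (e - k) * (e - k)) = e + k * k.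
    have := sq k 1 ek ke; rewrite scale1r => ->; have := sq k (-1) ek ke; rewrite scaleN1r => ->.
    rewrite addrACA (addrACA e) mulr1 mulrN1 scaleNr subrr addr0 expr1n sqrrN expr1n scale1r.
    by rewrite -!mulr2n -mulrnDl -(scaler_nat 2 (e + k * k)) scalerA mulVf ?pnatr_eq0 // scale1r.
  (* As [k] is self-adjoint and [b] imaginary, [star (e + b *: k) * (e + b *: k) = e + k * k], which
     [hp2] bounds as the mean of the squares of [e + k] and [e - k]. *)
  have hi b : b = 'i \/ b = - 'i -> cnorm (e + (b : R[i]) *: k) <= 1.
    move=> hb; rewrite -(@ler_pXn2r _ 2) ?nnegrE ?cnorm_ge0 ?ler01 // expr1n.
    have ci : Num.conj ('i : R[i]) = - 'i by exact: conjCi.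
    have bb : Num.conj b = - b by case: hb => ->; [exact: ci | rewrite rmorphN /= ci].
    have b2 : b * b = -1 by case: hb => ->; rewrite ?mulrNN.
    rewrite -cnorm_starM starD starZ es ks.
    rewrite bb.
    rewrite mulrDl !mulrDr ee -!scalerAl -!scalerAr ek ke scalerA mulNr b2 opprK scale1r.
    by rewrite scaleNr addrA addrK.
  elim/ltn_ind => -[|[|[|[|n]]]] IH.
  - by rewrite expr0 scale1r.
  - by rewrite expr1; apply: hi; left.
  - by rewrite expr2 i2 scaleN1r.
  - by rewrite exprS expr2 i2 mulrN1; apply: hi; right.
  - have -> : ('i ^+ n.+4 : R[i]) = 'i ^+ n.
      by rewrite -addn4 exprD (exprM _ 2 2) [X in X ^+ 2]expr2 i2 sqrrN expr1n mulr1.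
    by apply: IH; rewrite -(addn4 n) -addSnnS leq_addr.
have ok2 h : e * h = h -> h * e = h -> ok h -> ok ((1 + 'i) *: h).
  move=> eh he okh n.
  have := half _ _ (le1 _ _ (okh n) (okh n)) (le1 _ _ (okh n.+1) (okh n.+1)).
  have -> // : 2^-1 *: ((e + 'i ^+ n *: h) * (e + 'i ^+ n *: h)
      + (e + 'i ^+ n.+1 *: h) * (e + 'i ^+ n.+1 *: h)) = e + 'i ^+ n *: ((1 + 'i) *: h).
  rewrite !sq // (exprS 'i n) exprMn sqrCi mulN1r scaleNr addrACA subrr addr0 addrACA -mulr2n -scalerDl.
  rewrite -mulrDr scalerDr -(scaler_nat 2 e) !scalerA mulrA mulVf ?pnatr_eq0 // scale1r mul1r.
  by rewrite mulrDr mulr1 [_ * 'i]mulrC.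
have okn m : ok ((1 + 'i) ^+ m *: k).
  elim: m => [|m IH]; first by rewrite scale1r.
  by rewrite exprS -scalerA; apply: ok2 IH; rewrite -?scalerAl -?scalerAr ?ek ?ke.
(* [(1 + 'i) ^+ 2] has modulus 2, so [m * 2] steps multiply the norm of [k] by [2 ^+ m], while that
   norm stays at most 2. *)
have bd m : 2 ^+ m * cnorm k <= 2.
  have := okn (m * 2)%N 0%N; rewrite expr0 scale1r => h1.
  have n2 : normc ((1 + 'i) ^+ 2 : R[i]) = 2.
    rewrite sqrrD sqrCi expr1n addrAC subrr add0r mul1r -mulr_natl.
    rewrite ComplexField.Normc.normcM.
    have -> : normc ('i : R[i]) = 1 by apply: complexI; change (`|'i : R[i]| = 1); exact: normCi.
    have -> : (2 : R[i]) = (2 : R)%:C%C by rewrite rmorph_nat.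
    by rewrite mulr1 normc_real ger0_norm.
  have h2 : cnorm ((1 + 'i) ^+ (m * 2) *: k) = 2 ^+ m * cnorm k.
    rewrite cnormZ mulnC exprM; congr (_ * _).
    elim: m {h1} => [|m IH]; first by rewrite !expr0 ComplexField.Normc.normc1.
    by rewrite (exprS (_ ^+ 2)) (exprS 2) ComplexField.Normc.normcM IH n2.
  rewrite -h2 -[X in cnorm X](addKr e) addrC.
  by apply: le_trans (cnormB _ _) _; have := cnorm_proj_le1 (conj es ee); lra.
apply: cnorm0_eq0; apply/eqP; apply/negPn/negP => k0.
have kp : 0 < cnorm k by rewrite lt_neqAle eq_sym k0 cnorm_ge0.
have := archi_boundP (divr_ge0 (ler0n R 2) (cnorm_ge0 k)).
set n := Num.bound _ => hn.
have := bd n; apply/negP; rewrite -ltNge -ltr_pdivrMr //.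
apply: lt_le_trans hn _; rewrite -natrX ler_nat; exact/ltnW/ltn_expl.
Qed.

(** Compress to [h l = p i * p l * p i]. These sum to 0 over [l != i], and each [p i - h l] has norm
    at most 1. With [n] indices other than [i], both [n p i + h j] and [n p i - h j] are then sums
    of [n] elements of norm at most 1, so [cnorm_sym_eq0] applies to [h j / n]. The C*-identity
    turns [h j = 0] into [p j * p i = 0]. *)
Lemma projection_sum_orth (I : finType) (p : I -> A) :
  (forall i, is_projection (p i)) -> \sum_i p i = 1 ->
  forall i j, i != j -> p i * p j = 0.
Proof.
move=> pp p1 i j ij.
have [ps pi] : is_projection (p i) by [].
pose h l := p i * p l * p i.
have hs l : star (h l) = h l.
  by rewrite /h !starM ps (proj1 (pp l)) mulrA.
have eh l : p i * h l = h l by rewrite /h !mulrA pi.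
have he l : h l * p i = h l by rewrite /h -!mulrA pi.
have h0 : \sum_(l | l != i) h l = 0.
  apply: (addrI (h i)); rewrite -[LHS](bigD1 i (P := xpredT)) //.
  by rewrite addr0 /h -mulr_suml -mulr_sumr p1 mulr1 !pi.
have hle l : cnorm (p i - h l) <= 1.
  have -> : p i - h l = p i * (1 - p l) * p i by rewrite mulrBr mulr1 mulrBl pi.
  have ip := projectionC (pp l).
  have h1 := cnorm_proj_le1 (pp i); have h2 := cnorm_proj_le1 ip.
  apply: le_trans (cnormM _ _) _; apply: mulr_ile1; rewrite ?cnorm_ge0 //.
  by apply: le_trans (cnormM _ _) _; apply: mulr_ile1; rewrite ?cnorm_ge0.
pose n := #|[pred l | l != i]|.
have n0 : (0 < n)%N by apply/card_gt0P; exists j; rewrite inE eq_sym.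
have nR : (n%:R : R[i]) = (n%:R : R)%:C%C by rewrite rmorph_nat.
have nn : normc (n%:R^-1 : R[i]) = n%:R^-1.
  by rewrite ComplexField.Normc.normcV nR normc_real ger0_norm ?ler0n.
have nz : (n%:R : R[i]) != 0 by rewrite pnatr_eq0 -lt0n.
have nz' : (n%:R : R) != 0 by rewrite pnatr_eq0 -lt0n.
have avg x : cnorm (n%:R *: p i + x) <= n%:R -> cnorm (p i + n%:R^-1 *: x) <= 1.
  move=> hx; have -> : p i + n%:R^-1 *: x = n%:R^-1 *: (n%:R *: p i + x).
    by rewrite scalerDr scalerA mulVf // scale1r.
  by rewrite cnormZ nn mulrC ler_pdivrMr ?ltr0n // mul1r.
have sumn : \sum_(l | l != i) p i = n%:R *: p i.
  by rewrite sumr_const scaler_nat.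
have k0 : n%:R^-1 *: h j = 0.
  apply: (@cnorm_sym_eq0 (p i)) => //.
  - by rewrite -scalerAr eh.
  - by rewrite -scalerAl he.
  - by rewrite starZ hs rmorphV ?unitfE // rmorph_nat.
  - apply: avg.
    (* By [h0], [h j] is minus the sum of the remaining [h l]. *)
    have -> : n%:R *: p i + h j = p i + \sum_(l | (l != i) && (l != j)) (p i - h l).
      have ji : j != i by rewrite eq_sym.
      rewrite sumrB -sumn [X in X + h j](bigD1 j) //= -!addrA; congr (_ + (_ + _)).
      by apply/eqP; rewrite -addr_eq0 -(bigD1 j (P := fun l => l != i)) //= h0.
    apply: le_trans (cnormD _ _) _.
    apply: (@le_trans _ _ (1 + \sum_(l | (l != i) && (l != j)) 1)).
      apply: lerD; first exact: cnorm_proj_le1.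
      by apply: le_trans (cnorm_sum _ _ _) _; apply: ler_sum.
    have ji : j != i by rewrite eq_sym.
    by rewrite -(bigD1 j (P := fun l => l != i)) //= sumr_const.
  - rewrite -scalerN; apply: avg.
    have -> : n%:R *: p i - h j = \sum_(l | l != i) (if l == j then p i - h j else p i).
      have ji : j != i by rewrite eq_sym.
      rewrite -sumn (bigD1 j) // [in RHS](bigD1 j) //= eqxx addrAC; congr (_ + _).
      by apply: eq_bigr => l /andP[_ /negPf->].
    apply: le_trans (cnorm_sum _ _ _) _.
    apply: (@le_trans _ _ (\sum_(l | l != i) 1)); last by rewrite sumr_const.
    apply: ler_sum => l _; case: ifP => // _; exact: cnorm_proj_le1.
move/eqP: k0; rewrite scaler_eq0 invr_eq0 (negPf nz) /= => /eqP hj0.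
have : cnorm (p j * p i) ^+ 2 = 0.
  by rewrite -cnorm_starM starM ps (proj1 (pp j)) mulrA -(mulrA (p i)) (proj2 (pp j)) -/(h j) hj0 cnorm0.
move/eqP; rewrite expf_eq0 /= => /eqP/cnorm0_eq0 pji.
by rewrite -[LHS]starK starM (proj1 (pp j)) ps pji star0.
Qed.

End CStarNorm.

(** * Subalgebras and matrix algebras *)

Definition cnorm_limit (R : realType) (A : cstarAlgType R) (u : nat -> A) (l : A) :=
  forall e : R, 0 < e -> exists N, forall n, (N <= n)%N -> cnorm (u n - l) < e.

Lemma cnorm_limit_unique (R : realType) (A : cstarAlgType R) (u : nat -> A) (l l' : A) :
  cnorm_limit u l -> cnorm_limit u l' -> l = l'.
Proof.
move=> ul ul'; apply/eqP; rewrite -subr_eq0; apply/eqP/cnorm0_eq0.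
apply/eqP/negPn/negP => n0.
have np : 0 < cnorm (l - l') by rewrite lt_neqAle eq_sym n0 cnorm_ge0.
have e2 : 0 < cnorm (l - l') / 2 by rewrite divr_gt0.
have [N hN] := ul _ e2; have [M hM] := ul' _ e2.
have := hN _ (leq_maxl N M); have := hM _ (leq_maxr N M).
set n := maxn N M; have := cnormB (u n - l') (u n - l).
have -> : u n - l' - (u n - l) = l - l' by rewrite opprB addrC addrA subrK.
by lra.
Qed.

(* A closed *-subalgebra with a unit of its own, such as a corner [p A p]. *)
Record sub_cstar (R : realType) (A : cstarAlgType R) := SubCStar {
  sc_mem : A -> Prop;
  sc_one : A;
  sc_one_mem : sc_mem sc_one;
  sc_one_neq0 : sc_one != 0;
  sc_mul1 : forall x, sc_mem x -> sc_one * x = x;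
  sc_star : forall x, sc_mem x -> sc_mem (star x);
  sc_lin : forall (a : R[i]) x y, sc_mem x -> sc_mem y -> sc_mem (a *: x + y);
  sc_mul : forall x y, sc_mem x -> sc_mem y -> sc_mem (x * y);
  sc_lim : forall u l, (forall n, sc_mem (u n)) -> cnorm_limit u l -> sc_mem l
}.

Section SubCStar.
Variables (R : realType) (A : cstarAlgType R) (S : sub_cstar A).

Definition sc_type := {x : A | `[< sc_mem S x >]}.
HB.instance Definition _ := SubChoice.on sc_type.

Lemma sc_inj : injective (val : sc_type -> A). Proof. exact: val_inj. Qed.

Lemma scP (x : sc_type) : sc_mem S (val x). Proof. by case: x => x /= /asboolP. Qed.

Definition sc_in x (Sx : sc_mem S x) : sc_type := exist _ x (asboolT Sx).

Lemma sc_mem0 : sc_mem S 0.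
Proof. by have := sc_lin (-1) (sc_one_mem S) (sc_one_mem S); rewrite scaleN1r addNr. Qed.

Lemma sc_memD x y : sc_mem S x -> sc_mem S y -> sc_mem S (x + y).
Proof. by move=> Sx Sy; have := sc_lin 1 Sx Sy; rewrite scale1r. Qed.

Lemma sc_memZ (a : R[i]) x : sc_mem S x -> sc_mem S (a *: x).
Proof. by move=> Sx; have := sc_lin a Sx sc_mem0; rewrite addr0. Qed.

Lemma sc_memN x : sc_mem S x -> sc_mem S (- x).
Proof. by rewrite -scaleN1r; apply: sc_memZ. Qed.

Definition sc_add (x y : sc_type) := sc_in (sc_memD (scP x) (scP y)).
Definition sc_opp (x : sc_type) := sc_in (sc_memN (scP x)).

Lemma sc_addA : associative sc_add.
Proof. by move=> x y z; apply/sc_inj/addrA. Qed.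
Lemma sc_addC : commutative sc_add.
Proof. by move=> x y; apply/sc_inj/addrC. Qed.
Lemma sc_add0 : left_id (sc_in sc_mem0) sc_add.
Proof. by move=> x; apply/sc_inj/add0r. Qed.
Lemma sc_addN : left_inverse (sc_in sc_mem0) sc_opp sc_add.
Proof. by move=> x; apply/sc_inj/addNr. Qed.

HB.instance Definition _ := GRing.isZmodule.Build sc_type
  sc_addA sc_addC sc_add0 sc_addN.

Definition sc_mulS (x y : sc_type) := sc_in (sc_mul (scP x) (scP y)).

Lemma sc_mulA : associative sc_mulS.
Proof. by move=> x y z; apply/sc_inj/mulrA. Qed.
Lemma sc_mul1l : left_id (sc_in (sc_one_mem S)) sc_mulS.
Proof. by move=> x; apply/sc_inj/sc_mul1/scP. Qed.
(** The left unit law at [star (sc_one S)] gives [sc_one S * star (sc_one S) = star (sc_one S)],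
    whose left side is self-adjoint. The right unit law then follows from the left one by taking
    adjoints. *)
Lemma sc_starS_one : star (sc_one S) = sc_one S.
Proof.
have s1 := sc_mul1 (sc_star (sc_one_mem S)).
by have := congr1 (@star _ _) s1; rewrite starM starK s1.
Qed.
Lemma sc_mul1r : right_id (sc_in (sc_one_mem S)) sc_mulS.
Proof.
move=> x; apply/sc_inj => /=; have := sc_mul1 (sc_star (scP x)).
by move/(congr1 (@star _ _)); rewrite starM starK sc_starS_one.
Qed.
Lemma sc_mulDl : left_distributive sc_mulS +%R.
Proof. by move=> x y z; apply/sc_inj/mulrDl. Qed.
Lemma sc_mulDr : right_distributive sc_mulS +%R.
Proof. by move=> x y z; apply/sc_inj/mulrDr. Qed.
Lemma sc_one0 : sc_in (sc_one_mem S) != 0.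
Proof. by rewrite -(inj_eq sc_inj); apply: sc_one_neq0. Qed.

HB.instance Definition _ := GRing.Zmodule_isNzRing.Build sc_type
  sc_mulA sc_mul1l sc_mul1r sc_mulDl sc_mulDr sc_one0.

Definition sc_scale (a : R[i]) (x : sc_type) := sc_in (sc_memZ a (scP x)).

Lemma sc_scaleA a b v : sc_scale a (sc_scale b v) = sc_scale (a * b) v.
Proof. exact/sc_inj/scalerA. Qed.
Lemma sc_scale1 : left_id 1 sc_scale.
Proof. by move=> x; apply/sc_inj/scale1r. Qed.
Lemma sc_scaleDr : right_distributive sc_scale +%R.
Proof. by move=> a x y; apply/sc_inj/scalerDr. Qed.
Lemma sc_scaleDl v : {morph sc_scale^~ v : a b / a + b}.
Proof. by move=> a b; apply/sc_inj/scalerDl. Qed.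

HB.instance Definition _ := GRing.Zmodule_isLmodule.Build R[i] sc_type
  sc_scaleA sc_scale1 sc_scaleDr sc_scaleDl.

Lemma sc_scaleAl (a : R[i]) (x y : sc_type) : a *: (x * y) = a *: x * y.
Proof. exact/sc_inj/scalerAl. Qed.
HB.instance Definition _ := GRing.Lmodule_isLalgebra.Build R[i] sc_type sc_scaleAl.
Lemma sc_scaleAr (a : R[i]) (x y : sc_type) : a *: (x * y) = x * (a *: y).
Proof. exact/sc_inj/scalerAr. Qed.
HB.instance Definition _ := GRing.Lalgebra_isAlgebra.Build R[i] sc_type sc_scaleAr.

Definition sc_starS (x : sc_type) := sc_in (sc_star (scP x)).

Lemma sc_starK : involutive sc_starS.
Proof. by move=> x; apply/sc_inj/starK. Qed.
Lemma sc_starD : {morph sc_starS : x y / x + y}.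
Proof. by move=> x y; apply/sc_inj/starD. Qed.
Lemma sc_starM x y : sc_starS (x * y) = sc_starS y * sc_starS x.
Proof. exact/sc_inj/starM. Qed.
Lemma sc_starZ (a : R[i]) x : sc_starS (a *: x) = Num.conj a *: sc_starS x.
Proof. exact/sc_inj/starZ. Qed.

HB.instance Definition _ := isStarAlgebra.Build R[i] sc_type
  sc_starK sc_starD sc_starM sc_starZ.

Definition sc_norm (x : sc_type) : R := cnorm (val x).

Lemma sc_normD x y : sc_norm (x + y) <= sc_norm x + sc_norm y.
Proof. exact: cnormD. Qed.
Lemma sc_normZ (a : R[i]) x : sc_norm (a *: x) = normc a * sc_norm x.
Proof. exact: cnormZ. Qed.
Lemma sc_norm0_eq0 x : sc_norm x = 0 -> x = 0.
Proof. by move/cnorm0_eq0 => x0; apply/sc_inj. Qed.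
Lemma sc_normM x y : sc_norm (x * y) <= sc_norm x * sc_norm y.
Proof. exact: cnormM. Qed.
Lemma sc_norm_starM x : sc_norm (star x * x) = sc_norm x ^+ 2.
Proof. exact: cnorm_starM. Qed.
Lemma sc_norm_complete (u : nat -> sc_type) :
  (forall e : R, 0 < e -> exists N, forall m n, (N <= m)%N -> (N <= n)%N ->
     sc_norm (u m - u n) < e) ->
  exists l : sc_type, forall e : R, 0 < e -> exists N, forall n, (N <= n)%N ->
     sc_norm (u n - l) < e.
Proof.
move/(@cnorm_complete _ A (fun n => val (u n))) => [l ul].
have Sl : sc_mem S l by apply: (sc_lim _ ul) => n; apply: scP.
by exists (sc_in Sl).
Qed.

HB.instance Definition _ := isCStarAlgebra.Build R sc_type
  sc_normD sc_normZ sc_norm0_eq0 sc_normM sc_norm_starM sc_norm_complete.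

End SubCStar.

Section Corner.
Variables (R : realType) (A : cstarAlgType R) (p : A).
Hypotheses (pp : is_projection p) (p0 : p != 0).

Definition corner_mem (x : A) := p * x = x /\ x * p = x.

Lemma corner_one_mem : corner_mem p.
Proof. by split; apply: (proj2 pp). Qed.

Lemma corner_star x : corner_mem x -> corner_mem (star x).
Proof.
have [ps _] := pp.
by move=> [px xp]; split; rewrite -[in LHS]ps -starM ?px ?xp.
Qed.

Lemma corner_lin (a : R[i]) x y : corner_mem x -> corner_mem y -> corner_mem (a *: x + y).
Proof.
move=> [px xp] [py yp].
by split; rewrite ?mulrDr ?mulrDl -?scalerAr -?scalerAl ?px ?xp ?py ?yp.
Qed.

Lemma corner_mul x y : corner_mem x -> corner_mem y -> corner_mem (x * y).
Proof. by move=> [px xp] [py yp]; split; rewrite ?mulrA ?px // -mulrA yp. Qed.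

(** Multiplication by [p] does not increase norms, so [p * u n] converges to [p * l] as well as [l],
    and limits are unique. *)
Lemma corner_lim u l : (forall n, corner_mem (u n)) -> cnorm_limit u l -> corner_mem l.
Proof.
move=> Su ul; have p1 := cnorm_proj_le1 pp.
split; apply: (@cnorm_limit_unique _ _ u) => // e e0; have [N hN] := ul _ e0; exists N => n /hN;
  apply: le_lt_trans; have [pu up] := Su n.
- rewrite -{1}pu -mulrBr; apply: le_trans (cnormM _ _) _.
  by apply: ler_piMl; rewrite ?cnorm_ge0.
- rewrite -{1}up -mulrBl; apply: le_trans (cnormM _ _) _.
  by apply: ler_piMr; rewrite ?cnorm_ge0.
Qed.

Definition corner : sub_cstar A := SubCStar corner_one_mem p0
  (fun x => @proj1 _ _) corner_star corner_lin corner_mul corner_lim.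

End Corner.

(** * Completeness of the real and complex numbers *)

Section Completeness.
Variable R : realType.

Lemma real_complete (u : nat -> R) :
  (forall e : R, 0 < e -> exists N, forall m n, (N <= m)%N -> (N <= n)%N ->
     `|u m - u n| < e) ->
  exists l : R, forall e : R, 0 < e -> exists N, forall n, (N <= n)%N -> `|u n - l| < e.
Proof.
move=> uC.
(* The limit is the supremum of the eventual lower bounds of the sequence. *)
pose S := [set x : R | exists N, forall n, (N <= n)%N -> x <= u n]%classic.
have Sub e N : 0 < e -> (forall m n, (N <= m)%N -> (N <= n)%N -> `|u m - u n| < e) ->
    S (u N - e) /\ ubound S (u N + e).
  move=> e0 hN; split.
    by exists N => n Nn; have := hN n N Nn (leqnn N); rewrite ltr_norml => /andP[]; lra.
  move=> x [M hM]; have := hM _ (leq_maxl M N).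
  by have := hN _ N (leq_maxr M N) (leqnn N); rewrite ltr_norml => /andP[]; lra.
have hS : has_sup S.
  have [N hN] := uC _ ltr01; have [h1 h2] := Sub _ _ ltr01 hN.
  by split; [exists (u N - 1) | exists (u N + 1)].
exists (sup S) => e e0; have e2 : 0 < e / 2 by rewrite divr_gt0.
have [N hN] := uC _ e2; have [h1 h2] := Sub _ _ e2 hN; exists N => n Nn.
have l1 := sup_upper_bound hS h1.
have l2 : sup S <= u N + e / 2 by apply: ge_sup => //; case: hS.
by have := hN n N Nn (leqnn N); rewrite !ltr_norml => /andP[]; lra.
Qed.

Lemma normc_ge0 (a : R[i]) : 0 <= normc a.
Proof. by case: a => a b /=; apply: sqrtr_ge0. Qed.

Lemma normc_Re (a : R[i]) : `|complex.Re a| <= normc a.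
Proof. by rewrite -lecR; apply: normc_ge_Re. Qed.

Lemma normc_Im (a : R[i]) : `|complex.Im a| <= normc a.
Proof.
case: a => a b /=; rewrite -sqrtr_sqr ler_wsqrtr // lerDr; exact: sqr_ge0.
Qed.

Lemma normc_le_ReIm (a : R[i]) : normc a <= `|complex.Re a| + `|complex.Im a|.
Proof.
case: a => a b /=; rewrite -[leRHS]ger0_norm ?addr_ge0 // -sqrtr_sqr ler_wsqrtr //.
rewrite sqrrD !real_normK ?num_real // lerD2r lerDl mulrn_wge0 //.
exact: mulr_ge0.
Qed.

Lemma complex_complete (u : nat -> R[i]) :
  (forall e : R, 0 < e -> exists N, forall m n, (N <= m)%N -> (N <= n)%N ->
     normc (u m - u n) < e) ->
  exists l : R[i], forall e : R, 0 < e -> exists N, forall n, (N <= n)%N ->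
    normc (u n - l) < e.
Proof.
move=> uC.
have [a|a ha] := @real_complete (fun n => complex.Re (u n)).
  move=> /uC[N hN]; exists N => m n Nm Nn; apply: le_lt_trans (hN m n Nm Nn).
  by rewrite -raddfB; apply: normc_Re.
have [b|b hb] := @real_complete (fun n => complex.Im (u n)).
  move=> /uC[N hN]; exists N => m n Nm Nn; apply: le_lt_trans (hN m n Nm Nn).
  by rewrite -raddfB; apply: normc_Im.
exists (Complex a b) => e e0; have e2 : 0 < e / 2 by rewrite divr_gt0.
have [N hN] := ha _ e2; have [M hM] := hb _ e2; exists (maxn N M) => n.
rewrite geq_max => /andP[/hN h1 /hM h2]; apply: le_lt_trans (normc_le_ReIm _) _.
by case: (u n) h1 h2 => x y /=; lra.
Qed.

End Completeness.

(** * Complex matrices with the operator norm *)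

Section MatrixCStar.
Variables (R : realType) (n : nat).
Local Notation C := R[i].
Local Notation M := 'M[C]_n.+1.
Local Notation V := 'cV[C]_n.+1.
Implicit Types (A B : M) (v w : V).

Definition adjmx (p q : nat) (A : 'M[C]_(p, q)) : 'M[C]_(q, p) :=
  map_mx (Num.conj : C -> C) A^T.

Lemma adjmxK p q : cancel (@adjmx p q) (@adjmx q p).
Proof. by move=> A; apply/matrixP => i j; rewrite !mxE conjCK. Qed.

Lemma adjmxM p q r (A : 'M[C]_(p, q)) (B : 'M[C]_(q, r)) :
  adjmx (A *m B) = adjmx B *m adjmx A.
Proof. by rewrite /adjmx trmx_mul map_mxM. Qed.

Lemma adjmxD p q (A B : 'M[C]_(p, q)) : adjmx (A + B) = adjmx A + adjmx B.
Proof. by apply/matrixP => i j; rewrite !mxE rmorphD. Qed.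

Lemma adjmxZ p q (a : C) (A : 'M[C]_(p, q)) : adjmx (a *: A) = Num.conj a *: adjmx A.
Proof. by apply/matrixP => i j; rewrite !mxE rmorphM. Qed.

HB.instance Definition _ := isStarAlgebra.Build C M
  (@adjmxK _ _) (@adjmxD _ _) (@adjmxM _ _ _) (@adjmxZ _ _).

Definition sqnorm v : R := \sum_i normc (v i 0) ^+ 2.
Definition form A w v : C := (adjmx w *m A *m v) 0 0.

Lemma formE A w v : form A w v = \sum_j (\sum_i Num.conj (w i 0) * A i j) * v j 0.
Proof.
rewrite /form mxE; apply: eq_bigr => j _; rewrite mxE; congr (_ * _).
by apply: eq_bigr => i _; rewrite !mxE.
Qed.

Lemma sqnorm_ge0 v : 0 <= sqnorm v.
Proof. by apply: sumr_ge0 => i _; apply: sqr_ge0. Qed.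

Lemma form_sq A v : form (adjmx A *m A) v v = (sqnorm (A *m v))%:C%C.
Proof.
have -> : form (adjmx A *m A) v v = (adjmx (A *m v) *m (A *m v)) 0 0.
  by rewrite /form adjmxM !mulmxA.
rewrite mxE /sqnorm rmorph_sum; apply: eq_bigr => i _.
by rewrite !mxE rmorphXn mulrC -normCK.
Qed.

Lemma form_star A w v : form (adjmx A) w v = Num.conj (form A v w).
Proof.
rewrite /form.
have -> : adjmx w *m adjmx A *m v = adjmx (adjmx v *m A *m w).
  by rewrite !adjmxM adjmxK mulmxA.
by rewrite [LHS]mxE [X in Num.conj X]mxE.
Qed.

Lemma normc_sum (I : Type) (r : seq I) (P : pred I) (F : I -> C) :
  normc (\sum_(i <- r | P i) F i) <= \sum_(i <- r | P i) normc (F i).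
Proof.
elim/big_rec2: _ => [|i a b _ le_ba]; first by rewrite ComplexField.Normc.normc0.
by apply: le_trans (le_normcD _ _) _; rewrite lerD2l.
Qed.

Lemma coord_le1 v i : sqnorm v <= 1 -> normc (v i 0) <= 1.
Proof.
move=> v1; rewrite -(@ler_pXn2r _ 2) ?nnegrE ?normc_ge0 // expr1n.
apply: le_trans v1; rewrite /sqnorm (bigD1 i) //= lerDl.
by apply: sumr_ge0 => j _; apply: sqr_ge0.
Qed.

(** A crude bound, which makes [form_set] bounded above and lets entrywise convergence imply
    convergence in norm. *)
Definition mxsum A : R := \sum_j \sum_i normc (A i j).

Lemma form_le_sum A w v : sqnorm w <= 1 -> sqnorm v <= 1 -> normc (form A w v) <= mxsum A.
Proof.
move=> w1 v1; rewrite formE; apply: le_trans (normc_sum _ _ _) _.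
apply: ler_sum => j _; rewrite ComplexField.Normc.normcM.
apply: (@le_trans _ _ (normc (\sum_i Num.conj (w i 0) * A i j))).
  by rewrite ler_piMr ?normc_ge0 // coord_le1.
apply: le_trans (normc_sum _ _ _) _; apply: ler_sum => i _.
by rewrite ComplexField.Normc.normcM normc_conj ler_piMl ?normc_ge0 ?coord_le1.
Qed.

Definition form_set A := [set r : R | exists w v,
  [/\ sqnorm w <= 1, sqnorm v <= 1 & r = normc (form A w v)]]%classic.

(** The operator norm, written with the sesquilinear form rather than with [A *m v], so that
    invariance under adjoints is immediate. *)
Definition opnorm A : R := sup (form_set A).

Lemma sqnorm0 : sqnorm 0 = 0.
Proof. by apply: big1 => i _; rewrite mxE ComplexField.Normc.normc0 expr0n. Qed.

Lemma form_set_neq0 A : (form_set A !=set0)%classic.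
Proof. by exists (normc (form A 0 0)); exists 0, 0; rewrite sqnorm0 ler01. Qed.

Lemma form_le A w v : sqnorm w <= 1 -> sqnorm v <= 1 -> normc (form A w v) <= opnorm A.
Proof.
move=> w1 v1; apply: sup_upper_bound; last by exists w, v.
split; first exact: form_set_neq0.
by exists (mxsum A) => _ [w' [v' [h1 h2 ->]]]; apply: form_le_sum.
Qed.

Lemma opnorm_le A (c : R) :
  (forall w v, sqnorm w <= 1 -> sqnorm v <= 1 -> normc (form A w v) <= c) -> opnorm A <= c.
Proof.
by move=> h; apply: ge_sup (form_set_neq0 A) _ => _ [w [v [w1 v1 ->]]]; apply: h.
Qed.

Lemma opnorm_ge0 A : 0 <= opnorm A.
Proof.
by apply: le_trans (normc_ge0 (form A 0 0)) _; apply: form_le; rewrite sqnorm0 ler01.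
Qed.

Lemma opnorm_le_sum A : opnorm A <= mxsum A.
Proof. by apply: opnorm_le => w v; apply: form_le_sum. Qed.

Lemma sqnorm_delta i : sqnorm (delta_mx i 0) = 1.
Proof.
rewrite /sqnorm (bigD1 i) //= mxE !eqxx ComplexField.Normc.normc1 expr1n big1 ?addr0 // => j.
by move/negPf; rewrite mxE => ->; rewrite ComplexField.Normc.normc0 expr0n.
Qed.

Lemma form_delta A i j : form A (delta_mx i 0) (delta_mx j 0) = A i j.
Proof.
rewrite /form -colE mxE.
have -> : adjmx (delta_mx i 0 : V) = delta_mx 0 i.
  by apply/matrixP => a b; rewrite !mxE andbC rmorph_nat.
by rewrite -rowE mxE.
Qed.

Lemma entry_le A i j : normc (A i j) <= opnorm A.
Proof. by rewrite -form_delta; apply: form_le; rewrite sqnorm_delta. Qed.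

Lemma formD A B w v : form (A + B) w v = form A w v + form B w v.
Proof. by rewrite /form mulmxDr mulmxDl mxE. Qed.

Lemma formZ (a : C) A w v : form (a *: A) w v = a * form A w v.
Proof. by rewrite /form -scalemxAr -scalemxAl mxE. Qed.

Lemma opnormD A B : opnorm (A + B) <= opnorm A + opnorm B.
Proof.
apply: opnorm_le => w v w1 v1; rewrite formD.
by apply: le_trans (le_normcD _ _) _; apply: lerD; apply: form_le.
Qed.

Lemma opnormZ_le (a : C) A : opnorm (a *: A) <= normc a * opnorm A.
Proof.
apply: opnorm_le => w v w1 v1; rewrite formZ ComplexField.Normc.normcM.
by apply: ler_wpM2l; [exact: normc_ge0 | exact: form_le].
Qed.

Lemma opnormZ (a : C) A : opnorm (a *: A) = normc a * opnorm A.
Proof.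
apply/le_anti; rewrite opnormZ_le /=.
have [->|a0] := eqVneq a 0.
  by rewrite ComplexField.Normc.normc0 mul0r opnorm_ge0.
have na : 0 < normc a.
  rewrite lt_neqAle normc_ge0 andbT eq_sym; apply: contra_neq a0.
  exact: ComplexField.Normc.eq0_normc.
have := opnormZ_le a^-1 (a *: A).
by rewrite scalerA mulVf // scale1r ComplexField.Normc.normcV mulrC ler_pdivlMr // mulrC.
Qed.

Lemma opnorm0_eq0 A : opnorm A = 0 -> A = 0.
Proof.
move=> A0; apply/matrixP => i j; rewrite mxE; apply: ComplexField.Normc.eq0_normc.
by apply/le_anti; rewrite normc_ge0 andbT -A0 entry_le.
Qed.

Lemma sqnormZ (a : R) v : sqnorm (a%:C%C *: v) = a ^+ 2 * sqnorm v.
Proof.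
rewrite /sqnorm mulr_sumr; apply: eq_bigr => i _.
by rewrite mxE ComplexField.Normc.normcM normc_real exprMn real_normK ?num_real.
Qed.

Lemma normalize v : exists v', sqnorm v' <= 1 /\ v = (Num.sqrt (sqnorm v))%:C%C *: v'.
Proof.
have [v0|v0] := eqVneq (sqnorm v) 0.
  exists 0; rewrite sqnorm0 ler01 scaler0; split=> //; apply/matrixP => i j.
  move/eqP: v0; rewrite psumr_eq0 => [|k _]; last exact: sqr_ge0.
  move/allP/(_ i (mem_index_enum i)); rewrite expf_eq0 /= => /eqP.
  by rewrite (ord1 j) mxE => /ComplexField.Normc.eq0_normc.
exists ((Num.sqrt (sqnorm v))^-1%:C%C *: v).
have s0 : Num.sqrt (sqnorm v) != 0.
  by rewrite sqrtr_eq0 -ltNge lt_neqAle eq_sym v0 sqnorm_ge0.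
rewrite sqnormZ exprVn sqr_sqrtr ?sqnorm_ge0 // mulVf //; split=> //.
by rewrite scalerA -rmorphM mulfV // scale1r.
Qed.

Lemma form_bound A w v : sqnorm w <= 1 ->
  normc (form A w v) <= opnorm A * Num.sqrt (sqnorm v).
Proof.
move=> w1; have [v' [v1 e]] := normalize v.
have -> : form A w v = (Num.sqrt (sqnorm v))%:C%C * form A w v'.
  by rewrite {1}e /form -scalemxAr mxE.
rewrite ComplexField.Normc.normcM normc_real ger0_norm ?sqrtr_ge0 // mulrC.
by apply: ler_wpM2r; [exact: sqrtr_ge0 | exact: form_le].
Qed.

Lemma opnorm_star A : opnorm (adjmx A) = opnorm A.
Proof.
have le B : opnorm (adjmx B) <= opnorm B.
  apply: opnorm_le => w v w1 v1; rewrite form_star normc_conj.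
  exact: form_le.
apply/le_anti/andP; split; [exact: le|rewrite -{1}(adjmxK A); exact: le].
Qed.

(** The square of [s] is the value of the form of [adjmx A] at [v] and [A *m v], hence at most
    [opnorm A * s]; divide by [s]. *)
Lemma sqnorm_mul_le A v : sqnorm v <= 1 -> Num.sqrt (sqnorm (A *m v)) <= opnorm A.
Proof.
move=> v1; set s := Num.sqrt _.
have [-> | s0] := eqVneq s 0; first exact: opnorm_ge0.
have sp : 0 < s by rewrite lt_neqAle eq_sym s0 sqrtr_ge0.
rewrite -(ler_pM2r sp).
have := form_bound (adjmx A) (A *m v) v1.
rewrite opnorm_star.
have -> : form (adjmx A) v (A *m v) = form (adjmx A *m A) v v by rewrite /form !mulmxA.
rewrite form_sq normc_real ger0_norm ?sqnorm_ge0 //.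
by rewrite -/s -[X in X <= _ -> _]sqr_sqrtr ?sqnorm_ge0 // -/s expr2.
Qed.

Lemma opnormM A B : opnorm (A *m B) <= opnorm A * opnorm B.
Proof.
apply: opnorm_le => w v w1 v1.
have -> : form (A *m B) w v = form A w (B *m v) by rewrite /form !mulmxA.
apply: le_trans (form_bound _ _ w1) _.
by apply: ler_wpM2l; [exact: opnorm_ge0 | exact: sqnorm_mul_le].
Qed.

(** Cauchy-Schwarz, from [2 s a b <= s ^+ 2 a ^+ 2 + b ^+ 2] summed over the coordinates and divided
    by [2 s]. *)
Lemma form_cauchy A w v : sqnorm w <= 1 -> normc (form A w v) <= Num.sqrt (sqnorm (A *m v)).
Proof.
move=> w1; set x := A *m v; set s := Num.sqrt _.
have h : normc (form A w v) <= \sum_i normc (w i 0) * normc (x i 0).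
  rewrite /form -mulmxA mxE; apply: le_trans (normc_sum _ _ _) _.
  by apply: ler_sum => i _; rewrite ComplexField.Normc.normcM !mxE normc_conj.
apply: le_trans h _.
have [s0|s0] := eqVneq s 0.
  have x0 : forall i, normc (x i 0) = 0.
    move=> i; move/eqP: s0; rewrite sqrtr_eq0 => x0.
    have : sqnorm x == 0 by rewrite eq_le x0 sqnorm_ge0.
    rewrite psumr_eq0 => [|k _]; last exact: sqr_ge0.
    by move/allP/(_ i (mem_index_enum i)); rewrite expf_eq0 /= => /eqP.
  by rewrite big1 ?s0 // => i _; rewrite x0 mulr0.
have sp : 0 < s by rewrite lt_neqAle eq_sym s0 sqrtr_ge0.
have ss : s ^+ 2 = sqnorm x by rewrite sqr_sqrtr ?sqnorm_ge0.
have am : \sum_i (2 * s) * (normc (w i 0) * normc (x i 0)) <= s ^+ 2 * sqnorm w + sqnorm x.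
  rewrite /sqnorm mulr_sumr -big_split /=; apply: ler_sum => i _.
  set a := normc (w i 0); set b := normc (x i 0).
  by have := sqr_ge0 (s * a - b); rewrite -subr_ge0; lra.
rewrite -(ler_pM2l (mulr_gt0 (ltr0n R 2) sp)) mulr_sumr; apply: le_trans am _.
have : s ^+ 2 * sqnorm w <= s ^+ 2 by rewrite ler_piMr ?sqr_ge0.
by rewrite -ss; lra.
Qed.

Lemma opnorm_starM A : opnorm (adjmx A *m A) = opnorm A ^+ 2.
Proof.
apply/le_anti/andP; split; first by rewrite expr2 -{1}(opnorm_star A) opnormM.
have sp : 0 <= opnorm (adjmx A *m A) by exact: opnorm_ge0.
rewrite -[leRHS]sqr_sqrtr // ler_pXn2r ?nnegrE ?opnorm_ge0 ?sqrtr_ge0 //.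
apply: opnorm_le => w v w1 v1; apply: le_trans (form_cauchy _ _ w1) _.
rewrite ler_wsqrtr //; have := form_le (adjmx A *m A) v1 v1.
by rewrite form_sq normc_real ger0_norm ?sqnorm_ge0.
Qed.

Lemma opnorm_complete (u : nat -> M) :
  (forall e : R, 0 < e -> exists N, forall k m, (N <= k)%N -> (N <= m)%N ->
     opnorm (u k - u m) < e) ->
  exists l : M, forall e : R, 0 < e -> exists N, forall k, (N <= k)%N ->
     opnorm (u k - l) < e.
Proof.
move=> uC.
have /choice[l hl] : forall ij : 'I_n.+1 * 'I_n.+1, exists l : C,
    forall e : R, 0 < e -> exists N, forall k, (N <= k)%N -> normc (u k ij.1 ij.2 - l) < e.
  move=> [i j] /=; apply: complex_complete => e /uC[N hN]; exists N => k m Nk Nm.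
  by apply: le_lt_trans (hN k m Nk Nm); have := entry_le (u k - u m) i j; rewrite !mxE.
exists (\matrix_(i, j) l (i, j)) => e e0.
(* [d] is the number of entries. The further division by 2 keeps the final inequality strict after
   summation. *)
pose d : R := n.+1%:R * n.+1%:R.
have d0 : 0 < d by rewrite mulr_gt0 ?ltr0n.
have /choice[N hN] : forall ij : 'I_n.+1 * 'I_n.+1, exists N, forall k,
    (N <= k)%N -> normc (u k ij.1 ij.2 - l ij) < e / d / 2.
  by move=> ij; apply: hl; rewrite !divr_gt0.
exists (\max_ij N ij) => k Nk.
apply: le_lt_trans (opnorm_le_sum _) _.
apply: (@le_lt_trans _ _ (\sum_(j < n.+1) \sum_(i < n.+1) e / d / 2)).
  apply: ler_sum => j _; apply: ler_sum => i _; rewrite !mxE; apply/ltW/(hN (i, j)).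
  by apply: leq_trans Nk; apply: (leq_bigmax (i, j)).
have -> : \sum_(j < n.+1) \sum_(i < n.+1) e / d / 2 = e / 2.
  under eq_bigr do rewrite sumr_const card_ord.
  rewrite sumr_const card_ord -mulrnA -[LHS]mulr_natl natrM -/d mulrA mulrCA.
  by rewrite mulfV ?gt_eqF // mulr1.
by rewrite gtr_pMr // invf_lt1 // ltr1n.
Qed.

HB.instance Definition _ := isCStarAlgebra.Build R M
  opnormD opnormZ opnorm0_eq0 opnormM opnorm_starM opnorm_complete.

End MatrixCStar.

(** The size is [n.+1]: [n = 0] gives the scalars, over which permutation matrices are magic, and
    [n = 1] contains noncommuting projections. *)
Definition mx_cstar (R : realType) (n : nat) : cstarAlgType R := 'M[R[i]]_n.+1.

(** * The relations of the quantum automorphism group *)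

Section QuantumMatrix.
Variables (C : numClosedFieldType) (A : algType C).

(* A magic matrix over a corner of [A] with unit [e], intertwining the
   adjacency relations of [H] and [G]. *)
Definition qmx (e : A) (H G : sgraph) (u : H -> G -> A) : Prop :=
  [/\ forall x y, u x y * u x y = u x y,
      forall x, \sum_y u x y = e,
      forall y, \sum_x u x y = e
    & forall x x' y y', ((x == x') != (y == y')) || (adj x x' != adj y y') ->
        u x y * u x' y' = 0].

Section Theory.
Variables (e : A) (H G : sgraph) (u : H -> G -> A).
Hypothesis qu : qmx e u.

Lemma qmx_rowP x y y' : u x y * u x y' = if y == y' then u x y else 0.
Proof.
case: qu => idem _ _ orth; case: eqP => [<-|/eqP yy']; first exact: idem.
by apply: orth; rewrite eqxx (negPf yy').
Qed.

Lemma qmx_colP x x' y : u x y * u x' y = if x == x' then u x y else 0.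
Proof.
case: qu => idem _ _ orth; case: eqP => [<-|/eqP xx']; first exact: idem.
by apply: orth; rewrite eqxx (negPf xx').
Qed.

Lemma qmx_mul1l x y : e * u x y = u x y.
Proof.
have [_ r _ _] := qu; rewrite -(r x) mulr_suml (bigD1 y) //= qmx_rowP eqxx big1 ?addr0 //.
by move=> y' /negPf y'y; rewrite qmx_rowP y'y.
Qed.

Lemma qmx_mul1r x y : u x y * e = u x y.
Proof.
have [_ _ c _] := qu; rewrite -(c y) mulr_sumr (bigD1 x) //= qmx_colP eqxx big1 ?addr0 //.
by move=> x' /negPf x'x; rewrite qmx_colP eq_sym x'x.
Qed.

Lemma qmx_unit_idem : e * e = e.
Proof.
case/card_gt0P: (vert_gt0 H) => x _; have [_ r _ _] := qu.
by rewrite -{2}(r x) mulr_sumr -[RHS](r x); apply: eq_bigr => y _; apply: qmx_mul1l.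
Qed.

(** Inserting a column sum on the left and a row sum on the right, both sides become sums of
    [u x z * u w y], weighted by [adj z y] and by [adj x w]; where the weights differ the product
    vanishes. *)
Lemma qmx_intertwine x y :
  \sum_z u x z * adjm A z y = \sum_z adjm A x z * u z y.
Proof.
have [_ r c orth] := qu.
have L : \sum_z u x z * adjm A z y = \sum_z \sum_w (adj z y)%:R * (u x z * u w y).
  apply: eq_bigr => z _; rewrite -mulr_sumr -mulr_sumr c qmx_mul1r.
  exact: (commr_nat (u x z) (adj z y)).
have L' : \sum_w adjm A x w * u w y = \sum_w \sum_z (adj x w)%:R * (u x z * u w y).
  apply: eq_bigr => w _; rewrite -mulr_sumr -mulr_suml r qmx_mul1l //.
rewrite L L' exchange_big; apply: eq_bigr => w _; apply: eq_bigr => z _.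
have [<- //|ne] := eqVneq (adj x w) (adj z y).
by rewrite orth ?mulr0 // ne orbT.
Qed.

Lemma qmx_compl : @qmx e (gcompl H) (gcompl G) u.
Proof.
have [idem r c orth] := qu; split=> // x x' y y' h; apply: orth.
apply: contraTT h; rewrite negb_or !negbK => /andP[/eqP e1 /eqP e2].
by rewrite /adj /= /compl_adj /= e1 e2 !eqxx.
Qed.

End Theory.

(** Multiplying the intertwining relation by [u x y] on the left and [u x' y'] on the right leaves
    one term on each side: [u x y * u x' y'] weighted by [adj y y'] and by [adj x x']. *)
Lemma qmx_intro (e : A) (H G : sgraph) (u : H -> G -> A) :
  (forall x y, u x y * u x y = u x y) ->
  (forall x, \sum_y u x y = e) -> (forall y, \sum_x u x y = e) ->
  (forall x y y', y != y' -> u x y * u x y' = 0) ->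
  (forall x x' y, x != x' -> u x y * u x' y = 0) ->
  (forall x y, \sum_z u x z * adjm A z y = \sum_z adjm A x z * u z y) ->
  qmx e u.
Proof.
move=> idem r c orow ocol tw; split=> // x x' y y' /orP[|ne].
  case: (eqVneq x x') => [<-|nx]; case: (eqVneq y y') => [<-|ny] //= _;
    first [exact: orow | exact: ocol].
have := congr1 (fun a => u x y * a * u x' y') (tw x y').
rewrite /= !mulr_sumr !mulr_suml (bigD1 y) //= big1 => [|z zy]; last first.
  by rewrite mulrA orow ?mul0r // eq_sym.
rewrite [in RHS](bigD1 x') //= big1 => [|z zx]; last first.
  by rewrite -!mulrA ocol // !mulr0.
rewrite !addr0 mulrA idem /adjm -!mulrA idem !mulr_natl !(mulrnAr, mulr_natl).
case: (adj x x') ne; case: (adj y y') => //= _; rewrite ?mulr1n ?mulr0n //.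
Qed.

End QuantumMatrix.

(** * Homomorphisms out of [O(Qu(G))] *)

Section Evaluation.
Variables (C : numClosedFieldType) (A : algType C) (G : sgraph) (u : G -> G -> A).
Hypothesis qu : qmx 1 u.

(* The flag records whether the adjoint of the term is being evaluated, so
   that [A] needs no involution. *)
Fixpoint qu_eval (b : bool) (t : qu_term C G) : A :=
  match t with
  | QGen x y => u x y
  | QCst a => (if b then Num.conj a else a)%:A
  | QAdd s t => qu_eval b s + qu_eval b t
  | QMul s t => if b then qu_eval b t * qu_eval b s else qu_eval b s * qu_eval b t
  | QStar t => qu_eval (~~ b) t
  end.

Lemma qu_eval_sum b (f : G -> qu_term C G) :
  qu_eval b (\big[@QAdd C G/QCst G 0]_(x : G) f x) = \sum_x qu_eval b (f x).
Proof.
apply: (big_morph (qu_eval b)) => //=.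
by case: b; rewrite ?rmorph0 scale0r.
Qed.

Lemma qu_eval_rel b s t : qu_rel s t -> qu_eval b s = qu_eval b t.
Proof.
have [idem r c orth] := qu.
have cst (a : bool) (n : nat) : (if a then Num.conj (n%:R : C) else n%:R)%:A = n%:R :> A.
  by case: a; rewrite ?rmorph_nat scaler_nat.
case=> /=.
- by [].
- by move=> x y; case: b.
- by move=> x; rewrite qu_eval_sum /= (cst b 1%N).
- by move=> x; rewrite qu_eval_sum /= (cst b 1%N).
- move=> x y z yz; rewrite (cst b 0%N).
  by case: b; rewrite (qmx_rowP qu) ?(negPf yz) // eq_sym (negPf yz).
- move=> x y z yz; rewrite (cst b 0%N).
  by case: b; rewrite (qmx_colP qu) ?(negPf yz) // eq_sym (negPf yz).
- move=> x y; rewrite !qu_eval_sum /=.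
  under eq_bigr do rewrite cst.
  under [RHS]eq_bigr do rewrite cst.
  have comm (n : nat) (a : A) : n%:R * a = a * n%:R by rewrite commr_nat.
  have tw := qmx_intertwine qu x y; case: b => //.
  under eq_bigr do rewrite comm; under [RHS]eq_bigr do rewrite -comm.
  exact: tw.
Qed.

Lemma qu_eval_cong s t : qu_cong s t -> forall b, qu_eval b s = qu_eval b t.
Proof.
elim=> //=.
- by move=> s1 t1 st b; apply: qu_eval_rel.
- by move=> s1 t1 w _ IH1 _ IH2 b; rewrite IH1.
- by move=> s1 s2 t1 t2 _ IH1 _ IH2 b; rewrite IH1 IH2.
- by move=> s1 s2 t1 t2 _ IH1 _ IH2 b; rewrite IH1 IH2.
- by move=> *; rewrite addrA.
- by move=> *; rewrite addrC.
- by move=> t1 b; case: b; rewrite ?rmorph0 scale0r add0r.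
- move=> t1 b; case: b; rewrite ?rmorph0 ?rmorphN ?rmorph1 scale0r scaleN1r.
    by rewrite mulrN1 addNr.
  by rewrite mulN1r addNr.
- by move=> s1 t1 w b; case: b; rewrite mulrA.
- by move=> t1 b; case: b; rewrite ?rmorph1 scale1r ?mul1r ?mulr1.
- by move=> s1 t1 w b; case: b; rewrite ?mulrDl ?mulrDr.
- by move=> s1 t1 w b; case: b; rewrite ?mulrDl ?mulrDr.
- by move=> a a' b; case: b; rewrite ?rmorphD scalerDl.
- by move=> a a' b; case: b; rewrite -scalerAl mul1r scalerA ?rmorphM // mulrC.
- by move=> a t1 b; case: b; rewrite -scalerAl -scalerAr mul1r mulr1.
- by move=> t1 b; rewrite negbK.
- by move=> s1 t1 b; case: b.
- by move=> a b; case: b; rewrite /= ?conjCK.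
Qed.

Definition oqu_eval (q : OQu C G) : A := qu_eval false (repr q).

Lemma oqu_evalE t : oqu_eval (\pi t) = qu_eval false t.
Proof. exact: (qu_eval_cong (cong_repr t)). Qed.

Lemma oqu_evalD : {morph oqu_eval : p q / p + q}.
Proof.
by elim/quotW=> s; elim/quotW=> t; rewrite -(Defs.pi_addr s t) !oqu_evalE.
Qed.

Lemma oqu_evalM : {morph oqu_eval : p q / p * q}.
Proof.
by elim/quotW=> s; elim/quotW=> t; rewrite -(Defs.pi_mulr s t) !oqu_evalE.
Qed.

Lemma oqu_eval_cst a : oqu_eval (oqu_cst G a) = a%:A.
Proof. exact: oqu_evalE. Qed.

Lemma oqu_eval1 : oqu_eval 1 = 1.
Proof. by rewrite [LHS]oqu_eval_cst scale1r. Qed.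

Lemma oqu_evalZ a q : oqu_eval (a *: q) = a *: oqu_eval q.
Proof.
by rewrite -[a *: q]/(oqu_cst G a * q) oqu_evalM oqu_eval_cst -scalerAl mul1r.
Qed.

Lemma oqu_eval_gen x y : oqu_eval (oqu_gen C x y) = u x y.
Proof. exact: oqu_evalE. Qed.

Lemma oqu_evalB : {morph oqu_eval : p q / p - q}.
Proof. by move=> p q; rewrite oqu_evalD -scaleN1r oqu_evalZ scaleN1r. Qed.

HB.instance Definition _ := GRing.isZmodMorphism.Build (OQu C G) A oqu_eval oqu_evalB.
HB.instance Definition _ := GRing.isMonoidMorphism.Build (OQu C G) A oqu_eval
  (oqu_eval1, oqu_evalM).
HB.instance Definition _ := GRing.isScalable.Build C (OQu C G) A *:%R oqu_eval oqu_evalZ.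

Lemma oqu_hom : exists phi : {lrmorphism OQu C G -> A}, phi =1 oqu_eval.
Proof. by exists oqu_eval. Qed.

End Evaluation.

Section Generators.
Variables (C : numClosedFieldType) (G : sgraph).
Local Notation gen := (@oqu_gen C G).

Lemma oqu_cstE (a : C) : oqu_cst G a = a%:A.
Proof. by rewrite -[RHS]/(oqu_cst G a * 1) mulr1. Qed.

Lemma pi_qsum (f : G -> qu_term C G) :
  \pi_(OQu C G) (\big[@QAdd C G/QCst G 0]_(x : G) f x) = \sum_x (\pi_(OQu C G) (f x) : OQu C G).
Proof. by apply: (big_morph (fun t => \pi_(OQu C G) t)) => // s t; apply: Defs.pi_addr. Qed.

Lemma oqu_gen_qmx : qmx 1 gen.
Proof.
apply: qmx_intro.
- by move=> x y; rewrite -[_ * _]Defs.pi_mulr; apply/OQuP/qc_rel/qu_idem.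
- by move=> x; rewrite -[LHS]pi_qsum; apply/OQuP/qc_rel/qu_row.
- by move=> x; rewrite -[LHS]pi_qsum; apply/OQuP/qc_rel/qu_col.
- by move=> x y z yz; rewrite -[_ * _]Defs.pi_mulr; apply/OQuP/qc_rel/qu_row_orth.
- by move=> x y z yz; rewrite -[_ * _]Defs.pi_mulr; apply/OQuP/qc_rel/qu_col_orth.
- move=> x y; have /OQuP := qc_rel (qu_adj C x y); rewrite !pi_qsum.
  under eq_bigr do rewrite Defs.pi_mulr -[X in _ * X]/(oqu_cst G _) oqu_cstE scaler_nat.
  by under [RHS]eq_bigr do rewrite Defs.pi_mulr -[X in X * _]/(oqu_cst G _) oqu_cstE scaler_nat.
Qed.

Lemma oqu_gen_star x y : star (gen x y) = gen x y.
Proof. by rewrite -[LHS]Defs.pi_star; apply/OQuP/qc_rel/qu_star. Qed.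

Lemma oqu_hom_eq (A : starAlgType C) (phi psi : {lrmorphism OQu C G -> A}) :
  star_preserving phi -> star_preserving psi ->
  (forall x y, phi (gen x y) = psi (gen x y)) -> phi =1 psi.
Proof.
move=> sphi spsi h; elim/quotW; elim=> [x y|a|s IHs t IHt|s IHs t IHt|t IHt].
- exact: h.
- by rewrite -[\pi _]/(oqu_cst G a) oqu_cstE !linearZ /= !rmorph1.
- by rewrite Defs.pi_addr [LHS]rmorphD [RHS]rmorphD; congr (_ + _).
- by rewrite Defs.pi_mulr [LHS]rmorphM [RHS]rmorphM; congr (_ * _).
- by rewrite Defs.pi_star -[oqu_star _]/(star (\pi_(OQu C G) t : OQu C G)) sphi spsi; congr star.
Qed.

Lemma oqu_star_hom (A : starAlgType C) (u : G -> G -> A) :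
  qmx 1 u -> (forall x y, star (u x y) = u x y) ->
  exists2 phi : {lrmorphism OQu C G -> A},
    star_preserving phi & forall x y, phi (gen x y) = u x y.
Proof.
move=> qu us; have [phi phiE] := oqu_hom qu.
exists phi => [|x y]; last by rewrite phiE (oqu_eval_gen qu).
move=> q; rewrite !phiE [LHS](oqu_evalE qu) /oqu_eval /=.
(* The induction needs both flags: the adjoint of the value under [b] is the value under [~~ b]. *)
rewrite -[true]/(~~ false); elim: (repr q) false => [x y|a|s IHs t IHt|s IHs t IHt|t IHt] b /=.
- by rewrite us.
- by rewrite starZ star1; case: b; rewrite ?conjCK.
- by rewrite starD -IHs -IHt.
- by case: b; rewrite starM -IHs -IHt.
- by rewrite IHt.
Qed.

End Generators.

(** * Trivial quantum automorphism groups *)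

Section Trivial.
Variables (R : realType) (G : sgraph).

(** If the unit map is onto, the counit computes the scalar to which a generator is equal;
    conversely, scalar generators make every term a scalar. *)
Lemma qu_trivialP :
  qu_trivial R G <-> forall x y : G, oqu_gen R[i] x y = (x == y)%:R.
Proof.
split=> [[f fK Kf] x y|gens].
  have := Kf (oqu_gen R[i] x y); set c := f _ => hc; rewrite -hc.
  suff -> : c = (x == y)%:R by rewrite scaler_nat.
  by move: hc; rewrite -oqu_cstE => /OQuP/qu_counit_cong.
have surj : forall q : OQu R[i] G, exists c : R[i], q = c%:A.
  elim/quotW; elim=> [x y|a|s [a Ha] t [b Hb]|s [a Ha] t [b Hb]|t [a Ha]].
  - by exists (x == y)%:R; rewrite scaler_nat -gens.
  - by exists a; rewrite -oqu_cstE.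
  - by exists (a + b); rewrite Defs.pi_addr Ha Hb scalerDl.
  - by exists (a * b); rewrite Defs.pi_mulr Ha Hb -scalerAl mul1r scalerA.
  - by exists (Num.conj a); rewrite Defs.pi_star Ha -[LHS]/(star _) starZ star1.
have /choice[f hf] := surj.
have inj : injective (fun c : R[i] => c%:A : OQu R[i] G).
  move=> a b /eqP; rewrite -subr_eq0 -scalerBl scaler_eq0 oner_eq0 orbF subr_eq0.
  by move/eqP.
by exists f => [c|q]; [apply: inj; rewrite -hf | rewrite -hf].
Qed.

Lemma qu_trivial_qmx (A : algType R[i]) (e : A) (u : G -> G -> A) :
  qu_trivial R G -> qmx e u -> forall x y, u x y = if x == y then e else 0.
Proof.
move=> /qu_trivialP gens qu x y.
have ee := qmx_unit_idem qu; have [idem r c orth] := qu.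
(* The complementary idempotent [1 - e] on the diagonal makes the matrix unital over [A], so that it
   defines a homomorphism on [O(Qu(G))]. *)
pose v a b := u a b + if a == b then 1 - e else 0.
have el a b : (1 - e) * u a b = 0 by rewrite mulrBl mul1r (qmx_mul1l qu) subrr.
have er a b : u a b * (1 - e) = 0 by rewrite mulrBr mulr1 (qmx_mul1r qu) subrr.
have e1 : (1 - e) * (1 - e) = 1 - e by rewrite mulrBl mul1r mulrBr mulr1 ee subrr subr0.
have sumd a : \sum_b (if a == b then 1 - e else 0 : A) = 1 - e.
  by rewrite -big_mkcond (big_pred1 a) // => b; rewrite /= eq_sym.
have qv : qmx 1 v.
  split.
  - move=> a b; rewrite /v mulrDl !mulrDr idem; case: ifP => _.
      by rewrite er el e1 addr0 add0r.
    by rewrite !(mulr0, mul0r, addr0).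
  - by move=> a; rewrite big_split /= r sumd addrC subrK.
  - move=> a; rewrite big_split /= c.
    by under [X in _ + X]eq_bigr do rewrite eq_sym; rewrite sumd addrC subrK.
  - move=> a a' b b' h; rewrite /v mulrDl !mulrDr orth // add0r.
    case: (eqVneq a b) h => [<-|_] h; case: (eqVneq a' b') h => [<-|_] h;
      rewrite ?el ?er ?(mulr0, mul0r, addr0) //.
    by move: h; rewrite !eqxx.
have [phi hphi] := oqu_hom qv.
have := hphi (oqu_gen R[i] x y); rewrite (oqu_eval_gen qv) gens rmorph_nat /v.
case: (eqVneq x y) => [_|_] /esym; last by rewrite addr0.
by move/(canRL (addrK _)) ->; rewrite opprB addrC subrK.
Qed.

End Trivial.

(** The generators for [G] also satisfy the relations for its complement. *)
Lemma qu_trivial_compl (R : realType) (G : sgraph) : qu_trivial R (gcompl G) -> qu_trivial R G.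
Proof.
move=> tr; apply/qu_trivialP => x y.
have := @qu_trivial_qmx R (gcompl G) (OQu R[i] G) 1 (@oqu_gen R[i] G).
by move=> ->; [case: (x == y) | | exact/qmx_compl/oqu_gen_qmx].
Qed.

(** * Tensor squares *)

Section Functional.
Variables (K : fieldType) (V : lmodType K).

(* The kernel is a maximal subspace not containing [a]. *)
Lemma exists_functional (a : V) : a != 0 ->
  exists f : V -> K, scalar f /\ f a = 1.
Proof.
move=> a0.
pose P (W : set V) := (forall c u v, W u -> W v -> W (c *: u + v)) /\ ~ W a.
have [F FP Ftot|W [[Wlin Wa] Wmax]] := @Zorn_bigcup V P.
  split; last by case=> W FW Wa; have [_ []] := FP W FW.
  move=> c u v [X FX Xu] [Y FY Yv].
  have [XY|YX] := Ftot _ _ FX FY.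
    by exists Y => //; have [+ _] := FP Y FY; apply=> //; apply: XY.
  by exists X => //; have [+ _] := FP X FX; apply=> //; apply: YX.
have [w Ww] : exists w, W w.
  apply: contrapT => noW; apply: (Wmax [set 0]%classic).
    by split=> [/= x Wx|sub]; [case: noW; exists x | case: noW; exists 0; apply: sub].
  split=> [c u v -> ->|/eqP]; first by rewrite /= scaler0 addr0.
  exact/negP.
have W0 : W 0 by have := Wlin (-1) w w Ww Ww; rewrite scaleN1r addNr.
have WZ c u : W u -> W (c *: u) by move=> Wu; have := Wlin c u 0 Wu W0; rewrite addr0.
(* By maximality [W] and [a] span the space: otherwise adjoining [x] to [W] would give a larger
   subspace still avoiding [a]. *)
have dec x : exists c, W (x - c *: a).
  apply: contrapT => no.
  have Wx : ~ W x by move=> Wx; apply: no; exists 0; rewrite scale0r subr0.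
  pose B := [set y | exists c, W (y - c *: x)]%classic.
  apply: (Wmax B).
    split=> [y Wy|sub]; first by exists 0; rewrite scale0r subr0.
    by apply/Wx/sub; exists 1; rewrite scale1r subrr.
  split=> [c u v [cu Wu] [cv Wv]|[c Wc]].
    exists (c * cu + cv); have := Wlin c _ _ Wu Wv.
    by rewrite scalerBr scalerA addrACA -opprD -scalerDl.
  have [c0|c0] := eqVneq c 0; first by apply: Wa; move: Wc; rewrite c0 scale0r subr0.
  apply: no; exists c^-1; have := WZ (- c^-1) _ Wc.
  by rewrite scalerBr !scaleNr scalerA mulVf // scale1r opprK addrC.
have /choice[f fP] := dec.
have uniq x c : W (x - c *: a) -> f x = c.
  move=> h; have := Wlin (-1) _ _ h (fP x).
  rewrite scaleN1r opprB addrA subrK -scalerBl => h2.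
  apply/esym/eqP; rewrite -subr_eq0; apply/negPn/negP => ne; apply: Wa.
  by have := WZ (c - f x)^-1 _ h2; rewrite scalerA mulVf // scale1r.
exists f; split; last by apply: uniq; rewrite scale1r subrr.
move=> c u v; apply: uniq; have := Wlin c _ _ (fP u) (fP v).
by rewrite scalerBr scalerA addrACA -opprD -scalerDl.
Qed.

End Functional.

Section LinearEndomorphisms.
Variables (K : comNzRingType) (V : lmodType K) (v0 : V) (v0_neq0 : v0 != 0).

Definition lin_pred : pred (V -> V) := fun f => `[< linear f >].

Lemma lin_pred_submod : submod_closed lin_pred.
Proof.
split=> [|a f g /asboolP lf /asboolP lg]; apply/asboolP => c u v.
  by rewrite scaler0 addr0.
rewrite !fctE /= lf lg !scalerDr !scalerA [a * c]mulrC.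
by rewrite addrACA.
Qed.

HB.instance Definition _ := GRing.isSubmodClosed.Build K (V -> V) lin_pred lin_pred_submod.

(** The argument records that the space is nonzero, from which the ring structure gets [1 != 0]. *)
Definition lendo (_ : v0 != 0) := {f : V -> V | f \in lin_pred}.
Local Notation E := (lendo v0_neq0).
HB.instance Definition _ := SubChoice.on E.
HB.instance Definition _ := [SubChoice_isSubLmodule of E by <:].

Lemma lendoP (f : E) : linear (val f). Proof. by case: f => f /= /asboolP. Qed.

Definition mk_lendo f (lf : linear f) : E := exist _ f (asboolT lf).

Lemma id_linear : linear (@id V). Proof. by []. Qed.
Lemma comp_linear (f g : V -> V) : linear f -> linear g -> linear (f \o g).
Proof. by move=> lf lg a u v; rewrite /= lg lf. Qed.

Definition lendo_mul (f g : E) := mk_lendo (comp_linear (lendoP f) (lendoP g)).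

Lemma lendo_mulA : associative lendo_mul.
Proof. by move=> f g h; apply: val_inj. Qed.
Lemma lendo_mul1l : left_id (mk_lendo id_linear) lendo_mul.
Proof. by move=> f; apply: val_inj. Qed.
Lemma lendo_mul1r : right_id (mk_lendo id_linear) lendo_mul.
Proof. by move=> f; apply: val_inj. Qed.
Lemma lendo_mulDl : left_distributive lendo_mul +%R.
Proof. by move=> f g h; apply: val_inj. Qed.
Lemma lendo_mulDr : right_distributive lendo_mul +%R.
Proof.
move=> f g h; apply: val_inj; apply/funext => v /=.
by rewrite !fctE /= -[val g v]scale1r lendoP !scale1r.
Qed.
Lemma lendo_1neq0 : mk_lendo id_linear != 0.
Proof.
apply: contra v0_neq0 => /eqP/(congr1 (fun f : E => val f v0)) /= ->.
by [].
Qed.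

HB.instance Definition _ := GRing.Zmodule_isNzRing.Build E
  lendo_mulA lendo_mul1l lendo_mul1r lendo_mulDl lendo_mulDr lendo_1neq0.

Lemma lendo_scaleAl (a : K) (f g : E) : a *: (f * g) = a *: f * g.
Proof. exact: val_inj. Qed.
HB.instance Definition _ := GRing.Lmodule_isLalgebra.Build K E lendo_scaleAl.
Lemma lendo_scaleAr (a : K) (f g : E) : a *: (f * g) = f * (a *: g).
Proof.
apply: val_inj; apply/funext => v /=; rewrite !fctE /=.
have h0 : val f 0 = 0.
  by have := lendoP f (-1) 0 0; rewrite scaler0 addr0 scaleN1r addNr.
by have := lendoP f a (val g v) 0; rewrite !addr0 h0 addr0.
Qed.
HB.instance Definition _ := GRing.Lalgebra_isAlgebra.Build K E lendo_scaleAr.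

End LinearEndomorphisms.

Section TensorSquare.
Variables (K : fieldType) (A : algType K).

Definition bilin_pred : pred (A -> A -> K^o) := fun phi =>
  `[< (forall t, linear (phi^~ t)) /\ (forall s, linear (phi s)) >].

Lemma bilin_submod : submod_closed bilin_pred.
Proof.
split=> [|a f g /asboolP[f1 f2] /asboolP[g1 g2]]; apply/asboolP.
  by split=> x c u v; rewrite scaler0 addr0.
split=> x c u v; rewrite !fctE /= ?f1 ?g1 ?f2 ?g2 !scalerDr !scalerA [a * c]mulrC;
  by rewrite addrACA.
Qed.

HB.instance Definition _ :=
  GRing.isSubmodClosed.Build K (A -> A -> K^o) bilin_pred bilin_submod.

Definition bilin := {phi : A -> A -> K^o | phi \in bilin_pred}.
HB.instance Definition _ := SubChoice.on bilin.
HB.instance Definition _ := [SubChoice_isSubLmodule of bilin by <:].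

Definition mk_bilin (phi : A -> A -> K^o) (h : phi \in bilin_pred) : bilin :=
  exist (fun phi => phi \in bilin_pred) phi h.

Lemma bilinP (phi : bilin) :
  (forall t, linear ((val phi)^~ t)) /\ (forall s, linear (val phi s)).
Proof. by case: phi => phi /= /asboolP. Qed.

Lemma translate_bilin (a b : A) (phi : bilin) :
  (fun s t => val phi (s * a) (t * b)) \in bilin_pred.
Proof.
have [l r] := bilinP phi; apply/asboolP.
by split=> x c u v; rewrite mulrDl -scalerAl ?l ?r.
Qed.

Definition translate (a b : A) (phi : bilin) : bilin := mk_bilin (translate_bilin a b phi).

Lemma translate_linear a b : linear (translate a b).
Proof. by move=> c phi psi; apply: val_inj. Qed.

Lemma product_bilin (f g : A -> K) : scalar f -> scalar g ->
  (fun s t => f s * g t : K^o) \in bilin_pred.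
Proof.
move=> lf lg; apply/asboolP; split=> x c u v.
  by rewrite lf mulrDl -mulrA.
by rewrite lg mulrDr mulrCA.
Qed.

(* [a (x) b] acts on bilinear forms by translation of both arguments. *)
Lemma tensor_square : exists (E : algType K) (tens : A -> A -> E),
  [/\ forall b, linear (tens^~ b), forall a, linear (tens a),
      forall a b a' b', tens a b * tens a' b' = tens (a * a') (b * b')
    & forall a b, tens a b = 0 -> a = 0 \/ b = 0].
Proof.
(* A functional with value 1 at the unit gives a nonzero bilinear form, so the space acted on is
   nonzero. *)
have [f [lf f1]] := exists_functional (oner_neq0 A).
pose v0 : bilin := mk_bilin (product_bilin lf lf).
have v0_neq0 : v0 != 0.
  apply/eqP => /(congr1 (fun phi : bilin => val phi 1 1)) /=.
  by rewrite f1 mulr1 => /eqP; rewrite oner_eq0.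
pose tens a b : lendo v0_neq0 := mk_lendo v0_neq0 (translate_linear a b).
exists (lendo v0_neq0), tens; split.
- move=> b c u v; apply/val_inj/funext => phi; apply/val_inj/funext => s; apply/funext => t.
  by rewrite /= mulrDr -scalerAr (bilinP phi).1.
- move=> a c u v; apply/val_inj/funext => phi; apply/val_inj/funext => s; apply/funext => t.
  by rewrite /= mulrDr -scalerAr (bilinP phi).2.
- move=> a b a' b'; apply/val_inj/funext => phi; apply/val_inj/funext => s.
  by apply/funext => t /=; rewrite !mulrA.
- move=> a b ab0; have [a0|a0] := eqVneq a 0; first by left.
  right; apply/eqP/negPn/negP => b0.
  (* The product of functionals equal to 1 at [a] and at [b], once translated by [a] and [b], has
     value 1 at the pair of units. *)
  have [g [lg g1]] := exists_functional a0; have [h [lh h1]] := exists_functional b0.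
  have := congr1 (fun F : lendo v0_neq0 =>
    val (val F (mk_bilin (product_bilin lg lh))) 1 1) ab0.
  by rewrite /= !mul1r g1 h1 mulr1 => /eqP; rewrite oner_eq0.
Qed.

End TensorSquare.

(** * Magic matrices between two graphs *)

Section Cardinality.
Variables (C : numClosedFieldType) (A : algType C) (e : A) (D G : sgraph) (u : D -> G -> A).
Hypotheses (e0 : e != 0) (qu : qmx e u).

Lemma natr_alg_inj (m n : nat) : m%:R *: e = n%:R *: e -> m = n.
Proof.
move/eqP; rewrite -subr_eq0 -scalerBl scaler_eq0 (negPf e0) orbF subr_eq0.
by rewrite eqr_nat => /eqP.
Qed.

(** The sum of all entries is computed by rows and by columns. *)
Lemma qmx_card : #|D| = #|G|.
Proof.
have [idem r c orth] := qu; apply: natr_alg_inj.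
have <- : \sum_x \sum_y u x y = #|D|%:R *: e.
  by under eq_bigr do rewrite r; rewrite sumr_const scaler_nat.
rewrite exchange_big /=.
by under eq_bigr do rewrite c; rewrite sumr_const scaler_nat.
Qed.

End Cardinality.

Section TrivialPair.
Variables (R : realType) (A : algType R[i]) (e : A) (D G : sgraph) (u : D -> G -> A).
Hypotheses (trD : qu_trivial R D) (e0 : e != 0) (qu : qmx e u).

(* [w x x' = \sum_y u x y (x) u x' y] satisfies the relations of [Qu(D)] in
   a tensor square of [A], hence is diagonal. *)
Lemma qu_trivial_cols x x' z : x != x' -> u x z = 0 \/ u x' z = 0.
Proof.
move=> xx'.
have [E [tens [tl tr tM t0]]] := tensor_square A.
have sl b (I : finType) (F : I -> A) : tens (\sum_i F i) b = \sum_i tens (F i) b.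
  apply: (big_morph (tens^~ b)) => [p q|].
    by have := tl b 1 p q; rewrite !scale1r.
  by have := tl b (-1) 0 0; rewrite scaler0 addr0 scaleN1r addNr.
have sr a (I : finType) (F : I -> A) : tens a (\sum_i F i) = \sum_i tens a (F i).
  apply: (big_morph (tens a)) => [p q|].
    by have := tr a 1 p q; rewrite !scale1r.
  by have := tr a (-1) 0 0; rewrite scaler0 addr0 scaleN1r addNr.
have tz1 b : tens 0 b = 0.
  by have := tl b (-1) 0 0; rewrite scaler0 addr0 scaleN1r addNr.
have tz2 a : tens a 0 = 0.
  by have := tr a (-1) 0 0; rewrite scaler0 addr0 scaleN1r addNr.
have [idem r c orth] := qu.
pose w (a b : D) := \sum_y tens (u a y) (u b y).
have wM a b a' b' : w a b * w a' b' = \sum_y \sum_z tens (u a y * u a' z) (u b y * u b' z).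
  rewrite /w mulr_suml; apply: eq_bigr => y _; rewrite mulr_sumr.
  by apply: eq_bigr => t _; rewrite tM.
have qw : qmx (tens e e) w.
  split.
  - move=> a b; rewrite wM; apply: eq_bigr => y _; rewrite (bigD1 y) //= !idem.
    by rewrite big1 ?addr0 // => t /negPf ty; rewrite (qmx_rowP qu) eq_sym ty tz1.
  - move=> a; rewrite /w exchange_big /=.
    by under eq_bigr do rewrite -sr c; rewrite -sl r.
  - move=> b; rewrite /w exchange_big /=.
    by under eq_bigr do rewrite -sl c; rewrite -sr r.
  - move=> a a' b b' h; rewrite wM; apply: big1 => y _; apply: big1 => t _.
    (* Either the first tensor factor vanishes, or [y] and [t] are related as [a] and [a'] are,
       hence not as [b] and [b'], and the second factor vanishes. *)
    have [|ok1] := boolP (((a == a') != (y == t)) || (adj a a' != adj y t)).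
      by move/orth->; rewrite tz1.
    rewrite [X in tens _ X]orth ?tz2 //.
    move: ok1; rewrite negb_or !negbK => /andP[/eqP <- /eqP <-].
    by rewrite [(b == b') == _]eq_sym [adj b b' == _]eq_sym.
have := qu_trivial_qmx trD qw x x'; rewrite (negPf xx') => w0.
(* Multiplication by this tensor isolates the summand at [z]. *)
have := congr1 (fun q => tens (u x z) (u x' z) * q) w0; rewrite mulr0 /w mulr_sumr.
rewrite (bigD1 z) //= tM !idem big1 ?addr0 => [|y /negPf yz].
  exact: t0.
by rewrite tM (qmx_rowP qu) eq_sym yz tz1.
Qed.

(** Each column of [u] has a single nonzero entry, which therefore equals [e]; its row is the image
    of the column. Two such entries have the nonzero product [e * e], so the vanishing relations
    force injectivity and preservation of adjacency. *)
Lemma qu_trivial_iso : graph_iso G D.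
Proof.
have [idem r c orth] := qu.
have ex z : exists x, u x z != 0.
  apply/existsP; apply: contraT => /existsPn no; case/negP: e0; apply/eqP.
  by rewrite -(c z); apply: big1 => x _; apply/eqP; have := no x; rewrite negbK.
have /choice[f fP] := ex.
have ue z : u (f z) z = e.
  rewrite -(c z) (bigD1 (f z)) //= big1 ?addr0 // => x xf.
  by case: (qu_trivial_cols z xf) => // h; case/eqP: (fP z).
have ee : e * e != 0 by rewrite (qmx_unit_idem qu).
have f_inj : injective f.
  move=> y z fyz; apply/eqP/negPn/negP => yz; case/eqP: ee.
  by rewrite -{1}(ue y) -(ue z) fyz (qmx_rowP qu) (negPf yz).
exists f; first by apply: inj_card_bij => //; rewrite (qmx_card e0 qu).
move=> y z; apply/eqP; apply: contraNT ee => ne; apply/eqP.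
by rewrite -{1}(ue y) -(ue z) orth // ne orbT.
Qed.

End TrivialPair.

(** * Components and decompositions of graphs *)

Lemma graph_iso_refl G : graph_iso G G.
Proof. by exists id => //; exists id. Qed.

Lemma graph_iso_sym G H : graph_iso G H -> graph_iso H G.
Proof.
case=> f [g fK gK] fadj; exists g; first by exists f.
by move=> x y; rewrite -fadj !gK.
Qed.

Lemma graph_iso_trans G H K : graph_iso G H -> graph_iso H K -> graph_iso G K.
Proof.
case=> f fb fadj [g gb gadj]; exists (g \o f); first exact: bij_comp.
by move=> x y; rewrite /= gadj fadj.
Qed.

Lemma graph_iso_compl G H : graph_iso G H -> graph_iso (gcompl G) (gcompl H).
Proof.
case=> f fb fadj; exists f => // x y.
by rewrite /= /compl_adj /= fadj (bij_eq fb).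
Qed.

Lemma graph_iso_of_compl G H : graph_iso (gcompl G) (gcompl H) -> graph_iso G H.
Proof.
case=> f fb fadj; exists f => // x y; have := fadj x y.
rewrite /= /compl_adj /= (bij_eq fb); case: eqVneq => [->|_ /= /negb_inj //].
by rewrite !adj_irrefl.
Qed.

Lemma gcomplK G : graph_iso (gcompl (gcompl G)) G.
Proof.
exists id; first by exists id.
move=> x y; rewrite /= /compl_adj /= negb_and negbK.
by case: eqVneq => [->|_ /=]; rewrite ?adj_irrefl ?negbK.
Qed.

Definition comp_in (G : sgraph) (x y : G) (xy : connect (@adj G) x y) : component x :=
  exist (fun y => connect (@adj G) x y) y xy.

Section Connectivity.
Variable G : sgraph.
Local Notation conn := (connect (@adj G)).

Lemma connC (x y : G) : conn x y = conn y x.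
Proof. exact: (sym_connect_sym (@adj_sym G)). Qed.

Lemma same_conn (x y : G) : conn x y -> conn x =1 conn y.
Proof. by move=> xy z; exact: (same_connect (sym_connect_sym (@adj_sym G)) xy z). Qed.

Lemma adj_conn (x y : G) : adj x y -> conn x y.
Proof. exact: connect1. Qed.

Lemma conn_ind (P : G -> G -> Prop) :
  (forall x, P x x) -> (forall x y z, adj x y -> P y z -> P x z) ->
  forall x y, conn x y -> P x y.
Proof.
move=> P0 Pstep x y /connectP[p]; elim: p x => [|z p IH] x /=; first by move=> _ ->.
by move=> /andP[xz zp] yE; apply: Pstep xz _; apply: IH.
Qed.

Lemma component_conn (x y : G) : conn x y -> graph_iso (component x) (component y).
Proof.
move=> xy.
have h (z : component x) : conn y (val z) by rewrite -(same_conn xy) (valP z).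
have h' (z : component y) : conn x (val z) by rewrite (same_conn xy) (valP z).
exists (fun z => comp_in (h z)) => //.
by exists (fun z => comp_in (h' z)) => z; apply: val_inj.
Qed.

Lemma connected_component (x : G) : (forall y, conn x y) -> graph_iso (component x) G.
Proof.
move=> cx; exists val => //.
by exists (fun y => comp_in (cx y)) => // z; apply: val_inj.
Qed.

End Connectivity.

Lemma conn_iso (G H : sgraph) (f : G -> H) (x y : G) :
  bijective f -> (forall x y, adj (f x) (f y) = adj x y) ->
  connect (@adj H) (f x) (f y) = connect (@adj G) x y.
Proof.
move=> [g fK gK] fadj; apply/idP/idP.
  rewrite -{2}(fK x) -{2}(fK y); move: (f x) (f y); apply: conn_ind => // a b c ab.
  by apply: connect_trans; apply: adj_conn; rewrite -fadj !gK.
move: x y; apply: conn_ind => // a b c ab.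
by apply: connect_trans; apply: adj_conn; rewrite fadj.
Qed.

Lemma component_iso (G H : sgraph) (f : G -> H) (x : G) :
  bijective f -> (forall x y, adj (f x) (f y) = adj x y) ->
  graph_iso (component x) (component (f x)).
Proof.
move=> fb fadj; case: (fb) => g fK gK.
have h (z : component x) : connect (@adj H) (f x) (f (val z)).
  by rewrite conn_iso // (valP z).
have h' (z : component (f x)) : connect (@adj G) x (g (val z)).
  by rewrite -(conn_iso _ _ fb fadj) gK (valP z).
exists (fun z => comp_in (h z)); last by move=> y z; apply: fadj.
by exists (fun z => comp_in (h' z)) => z; apply: val_inj; rewrite /= ?fK ?gK.
Qed.

(** If [G] is disconnected, vertices of different components are adjacent in the complement, and two
    vertices of one component are joined there through a vertex outside it. *)
Lemma connected_or_compl (G : sgraph) :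
  (forall x y : G, connect (@adj G) x y) \/
  (forall x y : G, connect (@adj (gcompl G)) x y).
Proof.
have [h|nh] := pselect (forall x y : G, connect (@adj G) x y); [by left|right].
have cadj (x y : G) : ~~ connect (@adj G) x y -> connect (@adj (gcompl G)) x y.
  move=> nxy; apply: adj_conn; rewrite /= /compl_adj /=.
  apply/andP; split; apply: contraNN nxy; first by move=> /eqP ->.
  exact: adj_conn.
have [a [b nab]] : exists a b : G, ~~ connect (@adj G) a b.
  apply: contrapT => no; apply: nh => x y; apply: contrapT => /negP nxy.
  by apply: no; exists x, y.
move=> x y; have [xy|] := boolP (connect (@adj G) x y); last exact: cadj.
have [z nxz] : exists z, ~~ connect (@adj G) x z.
  have [xa|] := boolP (connect (@adj G) x a); last by exists a.
  by exists b; rewrite (same_conn xa).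
apply: (connect_trans (cadj _ _ nxz)); apply: cadj.
by rewrite connC -(same_conn xy).
Qed.

Section DisjointUnionComponents.
Variables (I : finType) (G : I -> sgraph) (I_gt0 : (0 < #|I|)%N).
Local Notation D := (dunion G I_gt0).
Local Notation inj i x := (Tagged (fun i => G i) x : D).

Lemma dunion_conn (u v : D) : connect (@adj D) u v ->
  forall i (x : G i), u = Tagged (fun i => vert (G i)) x ->
    exists2 y : G i, v = Tagged (fun i => vert (G i)) y & connect (@adj (G i)) x y.
Proof.
move: u v; apply: conn_ind => [u i x ->|u v w uv IH i x uE]; first by exists x.
move: uv; rewrite uE; case: v IH => j y IH; rewrite /= /dunion_adj /= => /andP[/eqP /= ij].
case: j / ij y IH => y IH; rewrite tagged_asE /= => xy.
have [z wz yz] := IH i y erefl; exists z => //.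
by apply: connect_trans yz; apply: adj_conn.
Qed.

Lemma dunion_conn_Tagged i (x y : G i) :
  connect (@adj D) (Tagged (fun i => vert (G i)) x) (Tagged (fun i => vert (G i)) y)
    = connect (@adj (G i)) x y.
Proof.
apply/idP/idP => [/dunion_conn/(_ i x erefl)[z /eqP]|].
  by rewrite eq_Tagged /= => /eqP ->.
move: x y; apply: conn_ind => // x y z xy; apply: connect_trans; apply: adj_conn.
by rewrite /= /dunion_adj /= eqxx tagged_asE.
Qed.

Lemma dunion_component (u : D) :
  exists i (x : G i), graph_iso (component x) (component u).
Proof.
case: u => i x; exists i, x.
have h (z : component x) :
    connect (@adj D) (Tagged (fun i => vert (G i)) x) (Tagged (fun i => vert (G i)) (val z)).
  by rewrite dunion_conn_Tagged (valP z).
pose f (z : component x) : component (existT (fun i => vert (G i)) i x : D) :=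
  comp_in (h z).
exists f; last first.
  by move=> y z; rewrite /= /comp_adj /= /dunion_adj /= eqxx tagged_asE.
(* The inverse is found by search; the default is never reached, since every vertex of the target
   component lies in the image of [f]. *)
apply: (Bijective (g := fun v =>
  odflt (comp_in (connect0 _ x)) [pick z | f z == v])) => [z|v].
  case: pickP => [z' /eqP/(congr1 val)/eqP|/(_ z)]; last by rewrite eqxx.
  by rewrite /= eq_Tagged /= => /eqP/val_inj.
have [y vy xy] := dunion_conn (valP v) erefl.
case: pickP => [z /eqP //|/(_ (comp_in xy))/eqP[]].
exact: val_inj.
Qed.

End DisjointUnionComponents.

(* Every graph of [co F] reduces to [F] by passing to the components of the
   graph or of its complement. *)
Inductive dec (F : sgraph -> Prop) : sgraph -> Prop :=
| dec_base G : F G -> dec F G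
| dec_comp (G : sgraph) : (forall x : G, dec F (component x)) -> dec F G
| dec_cocomp (G : sgraph) : (forall x : gcompl G, dec F (component x)) -> dec F G.

Section Decomposition.
Variable F : graph_class.
Hypothesis F_compl : forall G : sgraph, F G -> F (gcompl G).
Hypothesis F_component : forall (G : sgraph) (x : G), F G -> F (component x).

Lemma dec_iso G H : graph_iso G H -> dec F G -> dec F H.
Proof.
move=> + dG; elim: dG H => {G}[G FG|G _ IH|G _ IH] H GH.
- exact/dec_base/(in_class_iso GH).
- apply: dec_comp => y; case: GH => f fb fadj; case: (fb) => g fK gK.
  by rewrite -(gK y); apply: (IH (g y)); apply: component_iso.
- apply: dec_cocomp => y; case: (graph_iso_compl GH) => f fb fadj.
  case: (fb) => g fK gK.
  by rewrite -(gK y); apply: (IH (g y)); apply: component_iso.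
Qed.

(** This makes decomposability stable under complement. Either [G] or its complement is connected,
    and a connected graph is its own component. So either the induction hypothesis applies to that
    component, or the missing family consists of one graph whose decomposition is at hand, up to
    double complement. *)
Lemma dec_component_both G : dec F G ->
  (forall x : G, dec F (component x)) /\ (forall x : gcompl G, dec F (component x)).
Proof.
elim=> {G}[G FG|G dc IH|G dc IH]; split=> //.
- by move=> x; apply/dec_base/F_component.
- by move=> x; apply/dec_base/F_component/F_compl.
- have [cG|cG] := connected_or_compl G => x.
    have /graph_iso_compl Kx := connected_component (cG x).
    have [_ d] := IH x; case: (graph_iso_sym Kx) => f fb fadj.
    by apply: dec_iso (d (f x)); apply/graph_iso_sym/component_iso.
  apply: (dec_iso (graph_iso_sym (@connected_component (gcompl G) x (cG x)))).
  apply: dec_cocomp => y; have [z zb zadj] := gcomplK G.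
  by apply: dec_iso (dc (z y)); apply/graph_iso_sym/component_iso.
- have [cG|cG] := connected_or_compl G => x; last first.
    have Kx := @connected_component (gcompl G) x (cG x).
    have [_ d] := IH x.
    case: (graph_iso_trans (graph_iso_sym (gcomplK G)) (graph_iso_compl (graph_iso_sym Kx))).
    move=> f fb fadj.
    by apply: dec_iso (d (f x)); apply/graph_iso_sym/component_iso.
  apply: (dec_iso (graph_iso_sym (connected_component (cG x)))).
  exact: dec_cocomp.
Qed.

Lemma dec_compl G : dec F G -> dec F (gcompl G).
Proof. by move=> /dec_component_both[_ d]; apply: dec_comp. Qed.

Lemma co_dec G : in_co F G -> dec F G.
Proof.
elim=> {G}[G FG|I G I_gt0 _ IH|G _|G H GH _].
- exact: dec_base.
- apply: dec_comp => u; have [i [x xu]] := dunion_component u.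
  by apply: dec_iso xu _; have [d _] := dec_component_both (IH i).
- exact: dec_compl.
- exact: dec_iso.
Qed.

End Decomposition.

(** * Blocks of magic matrices *)

Lemma qmx_tr (C : numClosedFieldType) (A : algType C) (e : A) (H G : sgraph)
    (u : H -> G -> A) : qmx e u -> qmx e (fun y x => u x y).
Proof.
move=> [idem r c orth]; split=> // y y' x x' h; apply: orth.
by rewrite eq_sym [adj x x' == _]eq_sym.
Qed.

Section RowBlock.
Variables (C : numClosedFieldType) (A : algType C) (e : A) (H G : sgraph).
Variable u : H -> G -> A.
Hypothesis qu : qmx e u.
Local Notation conn := (connect (@adj _)).

(** The idempotent [P D C] for the components [D] of [x] and [C] of [y], represented by vertices;
    independence of [x] within [D] is [block_connl]. *)
Definition block x y := \sum_(y' | conn y y') u x y'.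

Lemma block_mul_row x y y' :
  block x y * u x y' = if conn y y' then u x y' else 0.
Proof.
rewrite /block mulr_suml; case: ifP => [yy'|nyy'].
  rewrite (bigD1 y') //= (qmx_rowP qu) eqxx big1 ?addr0 // => z /andP[_ /negPf zy].
  by rewrite (qmx_rowP qu) zy.
by apply: big1 => z yz; rewrite (qmx_rowP qu); case: eqP yz => // ->; rewrite nyy'.
Qed.

Lemma block_mul_row' x y y' :
  u x y' * block x y = if conn y y' then u x y' else 0.
Proof.
rewrite /block mulr_sumr; case: ifP => [yy'|nyy'].
  rewrite (bigD1 y') //= (qmx_rowP qu) eqxx big1 ?addr0 // => z /andP[_ /negPf zy].
  by rewrite (qmx_rowP qu) eq_sym zy.
by apply: big1 => z yz; rewrite (qmx_rowP qu); case: eqP yz => // <-; rewrite nyy'.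
Qed.

Lemma block_connr x y y' : conn y y' -> block x y = block x y'.
Proof. by move=> yy'; apply: eq_bigl => z; rewrite (same_conn yy'). Qed.

Lemma block_idem x y : block x y * block x y = block x y.
Proof.
by rewrite {2}/block mulr_sumr; apply: eq_bigr => z yz; rewrite block_mul_row yz.
Qed.

Lemma block_orth x y y' : ~~ conn y y' -> block x y * block x y' = 0.
Proof.
move=> nyy'; rewrite {2}/block mulr_sumr; apply: big1 => z yz.
by rewrite block_mul_row ifN // connC -(same_conn yz) connC.
Qed.

(** Along an edge from [x] to [x'] both sides equal [block x y * block x' y]: if [u x z * u x' w] is
    nonzero then [z] is adjacent to [w], so both lie in the same component. *)
Lemma block_connl x x' y : conn x x' -> block x y = block x' y.
Proof.
move: x x'; apply: conn_ind => // x x' x'' xx' <-.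
have [_ r _ orth] := qu.
transitivity (block x y * block x' y); rewrite /block.
  rewrite mulr_suml; apply: eq_bigr => z yz.
  rewrite -{1}(qmx_mul1r qu) -(r x') !mulr_sumr [RHS]big_mkcond /=.
  apply: eq_bigr => w _; case: ifP => // yw; rewrite orth // xx'.
  apply/orP; right; apply: contraFN yw => /eqP zw.
  by apply: connect_trans yz (adj_conn _); rewrite -zw.
rewrite mulr_sumr; apply: eq_bigr => z yz.
rewrite -[RHS](qmx_mul1l qu) -(r x) !mulr_suml big_mkcond /=.
apply: eq_bigr => w _; case: ifP => // yw; rewrite orth // xx'.
apply/orP; right; apply: contraFN yw => /eqP zw.
by apply: connect_trans yz (adj_conn _); rewrite adj_sym -zw.
Qed.

Lemma block_sum x : \sum_(y | fingraph.roots (@adj G) y) block x y = e.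
Proof.
have [_ r _ _] := qu; rewrite -(r x).
rewrite [RHS](partition_big (fingraph.root (@adj G)) (fingraph.roots (@adj G))) /=; last first.
  by move=> y _; apply/roots_root/sym_connect_sym/adj_sym.
apply: eq_bigr => y /eqP ry; apply: eq_bigl => z.
by rewrite -(root_connect (sym_connect_sym (@adj_sym G))) ry eq_sym.
Qed.

End RowBlock.

Section Block.
Variables (C : numClosedFieldType) (A : algType C) (e : A) (H G : sgraph).
Variable u : H -> G -> A.
Hypothesis qu : qmx e u.
Local Notation conn := (connect (@adj _)).
Let qut := qmx_tr qu.

Lemma natr_eq0_scale (n : nat) (a : A) : (0 < n)%N -> n%:R *: a = 0 -> a = 0.
Proof.
by move=> n0 /eqP; rewrite scaler_eq0 pnatr_eq0 eqn0Ngt n0 => /eqP.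
Qed.

(* Summing the block in two ways gives [a P = b Q] for idempotents [P], [Q] and
   positive integers [a], [b]. *)
Lemma block_tr x y : block u x y = block (fun y x => u x y) y x.
Proof.
set P := block u x y; set Q := block _ y x.
pose a := #|[pred x' | conn x x']|; pose b := #|[pred y' | conn y y']|.
have a0 : (0 < a)%N by apply/card_gt0P; exists x; rewrite inE connect0.
have b0 : (0 < b)%N by apply/card_gt0P; exists y; rewrite inE connect0.
have ab : a%:R *: P = b%:R *: Q.
  transitivity (\sum_(x' | conn x x') \sum_(y' | conn y y') u x' y').
    rewrite scaler_nat -sumr_const; apply: eq_bigr => x' xx'.
    by rewrite /P (block_connl qu y xx').
  rewrite exchange_big scaler_nat -sumr_const; apply: eq_bigr => y' yy'.
  by rewrite /Q (block_connl qut x yy').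
have PP : P * P = P by apply: (block_idem qu).
have QQ : Q * Q = Q by apply: (block_idem qut).
(* Squaring gives [a ^ 2 P = b ^ 2 Q], while [a P = b Q] gives [a ^ 2 P = a b Q]; cancel [b]. *)
have aQ : a%:R *: Q = b%:R *: Q.
  have : (a%:R *: P) * (a%:R *: P) = (b%:R *: Q) * (b%:R *: Q) by rewrite ab.
  rewrite -!scalerAl -!scalerAr PP QQ ab !scalerA [a%:R * _]mulrC -!scalerA.
  move/eqP; rewrite -subr_eq0 -scalerBr => /eqP/(natr_eq0_scale b0)/eqP.
  by rewrite subr_eq0 => /eqP.
have := ab; rewrite -aQ => /eqP; rewrite -subr_eq0 -scalerBr => /eqP.
by move/(natr_eq0_scale a0)/eqP; rewrite subr_eq0 => /eqP.
Qed.

Lemma sum_component (K : sgraph) (x : K) (F : K -> A) :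
  \sum_(z : component x) F (val z) = \sum_(z | conn x z) F z.
Proof.
rewrite [RHS](reindex_omap val (insub : K -> option (component x))) /=.
  by apply: eq_bigl => z; rewrite (valP z) valK eqxx.
by move=> z xz; rewrite insubT.
Qed.

(** The unit is the block itself: the row sums equal it by [block_connl], the column sums by
    [block_tr]. *)
Lemma block_qmx x y :
  qmx (block u x y) (fun (a : component x) (b : component y) => u (val a) (val b)).
Proof.
have [idem r c orth] := qu; split=> // [a|b|a a' b b' h].
- by rewrite sum_component (block_connl qu y (valP a)).
- rewrite (sum_component x (fun z => u z (val b))) block_tr.
  by rewrite (block_connl qut x (valP b)).
- by apply: orth.
Qed.

End Block.

(** * Graph isomorphisms from a matching of components *)

Lemma fiber_injection (I J : finType) (T : eqType) (P : pred I) (Q : pred J)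
    (f : I -> T) (g : J -> T) (j0 : J) :
  (forall t, #|[pred i | P i && (f i == t)]| = #|[pred j | Q j && (g j == t)]|) ->
  exists h : I -> J, {in P &, injective h} /\ forall i, P i -> Q (h i) /\ g (h i) = f i.
Proof.
move=> fg.
pose FI t := enum [pred i | P i && (f i == t)].
pose FJ t := enum [pred j | Q j && (g j == t)].
have sFJ t : size (FJ t) = size (FI t) by rewrite /FI /FJ -!cardE fg.
have FIP i : P i -> i \in FI (f i) by move=> Pi; rewrite mem_enum inE Pi eqxx.
(* An element of a fibre of [f] goes to the element at the same position in the fibre of [g]. The
   sizes agree, so the default [j0] is not reached when [P i] holds. *)
pose h i := nth j0 (FJ (f i)) (index i (FI (f i))).
have lt i : P i -> (index i (FI (f i)) < size (FJ (f i)))%N.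
  by move=> Pi; rewrite sFJ index_mem FIP.
have hP i : P i -> Q (h i) /\ g (h i) = f i.
  by move=> Pi; have := mem_nth j0 (lt i Pi); rewrite mem_enum inE => /andP[? /eqP].
exists h; split=> // i i' Pi Pi' hh.
have fi : f i = f i' by rewrite -(proj2 (hP i Pi)) -(proj2 (hP i' Pi')) hh.
have := lt i Pi; have := lt i' Pi'; move: hh; rewrite /h fi => hh l' l.
move/eqP: hh; rewrite nth_uniq ?enum_uniq // => /eqP ii.
have := FIP i Pi; rewrite fi => mi.
by rewrite -(nth_index i mi) ii nth_index // FIP.
Qed.

(** One isomorphism is chosen for each root, and every vertex is moved by that of its root. Equal
    cardinalities reduce bijectivity to injectivity. *)
Lemma iso_of_components (H G : sgraph) (s : H -> G) : #|H| = #|G| ->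
  let R := fingraph.roots (@adj H) in
  {in R &, injective s} ->
  (forall r, R r -> fingraph.roots (@adj G) (s r)) ->
  (forall r, R r -> graph_iso (component r) (component (s r))) -> graph_iso H G.
Proof.
move=> cardHG R s_inj s_roots s_iso.
have symH := sym_connect_sym (@adj_sym H); have symG := sym_connect_sym (@adj_sym G).
have ex r : exists g : H -> G, R r ->
    [/\ forall z, connect (@adj H) r z -> connect (@adj G) (s r) (g z),
        forall z w, connect (@adj H) r z -> connect (@adj H) r w -> g z = g w -> z = w
      & forall z w, connect (@adj H) r z -> connect (@adj H) r w -> adj (g z) (g w) = adj z w].
  have [Rr|] := boolP (R r); last by exists s.
  have [f /bij_inj f_inj fadj] := s_iso r Rr.
  pose g (z : H) : G := if insub z : option (component r) is Some z' then val (f z') else s r.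
  have gE z (rz : connect (@adj H) r z) : g z = val (f (comp_in rz)).
    by rewrite /g insubT.
  exists g => _; split=> [z rz|z w rz rw|z w rz rw]; rewrite !gE.
  - exact: (valP (f (comp_in rz))).
  - by move/val_inj/f_inj/(congr1 val).
  - exact: fadj.
have /choice[g gP] := ex.
pose rt := fingraph.root (@adj H).
have Rrt z : R (rt z) by apply: roots_root.
have crt z : connect (@adj H) (rt z) z by rewrite symH connect_root.
pose f z := g (rt z) z.
(* [f] maps the component of [z] into that of [s (rt z)], and [s] sends distinct roots to distinct
   roots. *)
have f_root z w : connect (@adj G) (f z) (f w) -> rt z = rt w.
  move=> zw; have [/(_ z (crt z)) cz _ _] := gP _ (Rrt z).
  have [/(_ w (crt w)) cw _ _] := gP _ (Rrt w).
  apply: s_inj; rewrite ?inE; try exact: Rrt.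
  have /eqP <- := s_roots _ (Rrt z); have /eqP <- := s_roots _ (Rrt w).
  apply/(fingraph.rootP symG); apply: connect_trans cz _; apply: connect_trans zw _.
  by rewrite symG.
have f_inj : injective f.
  move=> z w fzw; have e : rt z = rt w by apply: f_root; rewrite fzw connect0.
  have [_ inj _] := gP _ (Rrt z); apply: (inj z w (crt z)); first by rewrite e crt.
  by move: fzw; rewrite /f -e.
exists f; first by apply: inj_card_bij => //; rewrite cardHG.
move=> z w; have [e|ne] := eqVneq (rt z) (rt w).
  have [_ _ ad] := gP _ (Rrt z); rewrite /f -e; apply: (ad z w (crt z)).
  by rewrite e crt.
transitivity false; first apply: contra_neqF ne => /adj_conn; first exact: f_root.
apply/esym/negbTE; apply: contra_neqN ne => /adj_conn zw.
exact/(fingraph.rootP symH).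
Qed.

(* Labelling every component by its isomorphism class among the components of
   [H], both graphs have equally many components with a given label. *)
Lemma iso_of_blocks (C : numClosedFieldType) (A : algType C) (e : A) (H G : sgraph)
    (u : H -> G -> A) : e != 0 -> qmx e u ->
  (forall x y, block u x y != 0 -> graph_iso (component x) (component y)) ->
  graph_iso H G.
Proof.
move=> e0 qu isoP.
pose RH := fingraph.roots (@adj H); pose RG := fingraph.roots (@adj G).
(* An isomorphism class is encoded by the vertices of [H] whose component belongs to it; classes
   absent from [H] all get the empty set. *)
pose lab (K : sgraph) : {set H} := [set z : H | `[< graph_iso K (component z) >]].
have labP (K L : sgraph) : graph_iso K L -> lab K = lab L.
  move=> KL; apply/setP => z; rewrite !inE; apply/asboolP/asboolP.
    by apply: graph_iso_trans; apply: graph_iso_sym.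
  exact: graph_iso_trans.
pose LH x := lab (component (x : H)); pose LG y := lab (component (y : G)).
have cardL t : #|[pred x | RH x && (LH x == t)]| = #|[pred y | RG y && (LG y == t)]|.
  apply: (natr_alg_inj e0); rewrite !scaler_nat -!sumr_const.
  (* Blocks between different labels vanish, so this double sum of blocks counts the roots of label
     [t] in [H] when summed by rows, and in [G] when summed by columns. *)
  transitivity (\sum_(x | RH x && (LH x == t)) \sum_(y | RG y && (LG y == t)) block u x y).
    apply: eq_bigr => x /andP[_ /eqP xt]; rewrite -(block_sum qu x).
    rewrite big_mkcondr; apply: eq_bigr => y _; case: ifP => // yt.
    by apply: contraFeq yt => /isoP/labP; rewrite -/(LH x) xt -/(LG y) eq_sym => ->.
  rewrite exchange_big; apply: eq_bigr => y /andP[_ /eqP yt].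
  rewrite -(block_sum (qmx_tr qu) y) [RHS](bigID (fun x => LH x == t)) /= [X in _ + X]big1.
    by rewrite addr0; apply: eq_bigr => x _; rewrite (block_tr qu).
  move=> x /andP[_ xt]; rewrite -(block_tr qu); apply: contraNeq xt.
  by move=> /isoP/labP; rewrite -/(LH x) -/(LG y) yt => ->.
case/card_gt0P: (vert_gt0 G) => y0 _.
have [s [s_inj sP]] := fiber_injection y0 cardL.
apply: (iso_of_components (s := s)) => // [|r /sP[]//|r Rr].
  exact: (qmx_card e0 qu).
have [_ Lr] := sP r Rr.
(* As [r] belongs to its own label, it belongs to that of [s r], which gives the isomorphism. *)
have : r \in LH r by rewrite inE; apply/asboolP/graph_iso_refl.
by rewrite -Lr inE => /asboolP; apply: graph_iso_sym.
Qed.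

(** * Quantum isomorphism and the axiom (QI) *)

Section QuantumIso.
Variable R : realType.

(** Orthogonality within rows and columns is automatic for projections of a C*-algebra that sum to
    1. *)
Lemma magic_unitary_qmx (A : cstarAlgType R) (G H : sgraph) (U : H -> G -> A) :
  magic_unitary U ->
  (forall x y, \sum_z U x z * adjm A z y = \sum_z adjm A x z * U z y) ->
  qmx 1 U.
Proof.
move=> [_ pU r c] tw; apply: qmx_intro => // [x y|x y y' yy'|x x' y xx'].
- by have [] := pU x y.
- exact: (projection_sum_orth (fun y => pU x y) (r x)).
- exact: (@projection_sum_orth _ _ _ (U^~ y)).
Qed.

Lemma quantum_iso_qmx (A : cstarAlgType R) (G H : sgraph) (U : H -> G -> A) :
  qmx 1 U -> (forall x y, star (U x y) = U x y) -> quantum_iso R G H.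
Proof.
move=> qU sU; exists A, U; split=> [|x y]; last exact: (qmx_intertwine qU).
have [idem r c _] := qU; split=> //.
exact: (qmx_card (oner_neq0 A) qU).
Qed.

Lemma quantum_isoP (G H : sgraph) : quantum_iso R G H ->
  exists (A : cstarAlgType R) (U : H -> G -> A),
    qmx 1 U /\ forall x y, star (U x y) = U x y.
Proof.
move=> [A [U [mU tw]]]; exists A, U; split; first exact: magic_unitary_qmx.
by move=> x y; have [_ /(_ x y)[]] := mU.
Qed.

Lemma quantum_iso_compl (G H : sgraph) :
  quantum_iso R G H -> quantum_iso R (gcompl G) (gcompl H).
Proof.
move=> /quantum_isoP[A [U [qU sU]]].
exact: (@quantum_iso_qmx A (gcompl G) (gcompl H) U (qmx_compl qU)).
Qed.

Lemma quantum_iso_of_iso (G H : sgraph) : graph_iso G H -> quantum_iso R G H.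
Proof.
case=> f fb fadj; have f_inj := bij_inj fb; case: (fb) => g fK gK.
pose U (x : H) (y : G) : mx_cstar R 0 := (x == f y)%:R.
have UU x y x' y' : U x y * U x' y' = ((x == f y) && (x' == f y'))%:R.
  by rewrite -natrM mulnb.
apply: (quantum_iso_qmx (U := U)) => [|x y]; last first.
  by rewrite /U; case: (x == f y); rewrite ?star1 ?star0.
split.
- by move=> x y; rewrite UU andbb.
- move=> x; rewrite (bigD1 (g x)) //= /U gK eqxx big1 ?addr0 // => y /negPf yx.
  by rewrite -{1}(gK x) (inj_eq f_inj) eq_sym yx.
- by move=> y; rewrite (bigD1 (f y)) //= /U eqxx big1 ?addr0 // => x /negPf ->.
- move=> x x' y y' h; rewrite UU; case: (eqVneq x (f y)) h => [->|//].
  case: (eqVneq x' (f y')) => [->|//].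
  by rewrite fadj (inj_eq f_inj) !eqxx.
Qed.

Lemma block_projection (A : cstarAlgType R) (e : A) (G H : sgraph) (U : H -> G -> A) x y :
  qmx e U -> (forall x y, star (U x y) = U x y) -> is_projection (block U x y).
Proof.
move=> qU sU; split; last exact: (block_idem qU).
by rewrite /block star_sum; apply: eq_bigr.
Qed.

Lemma sc_val_sum (A : cstarAlgType R) (S : sub_cstar A) (I : finType) (F : I -> sc_type S) :
  val (\sum_i F i) = \sum_i val (F i).
Proof. exact: (big_morph (fun x : sc_type S => val x)). Qed.

Lemma quantum_iso_block (A : cstarAlgType R) (G H : sgraph) (U : H -> G -> A) x y :
  qmx 1 U -> (forall x y, star (U x y) = U x y) -> block U x y != 0 ->
  quantum_iso R (component y) (component x).
Proof.
move=> qU sU b0; have pb := block_projection x y qU sU.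
have qB := block_qmx qU x y.
pose S := corner pb b0.
have SV (a : component x) (b : component y) : sc_mem S (U (val a) (val b)).
  by split; [exact: (qmx_mul1l qB a b) | exact: (qmx_mul1r qB a b)].
pose V (a : component x) (b : component y) : sc_type S := sc_in (SV a b).
apply: (quantum_iso_qmx (A := sc_type S) (U := V)) => [|a b]; last first.
  by apply: sc_inj; apply: sU.
have [idem r c orth] := qB; split.
- by move=> a b; apply: sc_inj; apply: idem.
- by move=> a; apply: sc_inj; rewrite sc_val_sum; apply: r.
- by move=> b; apply: sc_inj; rewrite sc_val_sum; apply: c.
- by move=> a a' b b' h; apply: sc_inj; apply: orth.
Qed.

(** The direction of (QI) that has to be lifted; the other one, [quantum_iso_of_iso], holds for all
    graphs. *)
Definition qi_rigid (G H : sgraph) := quantum_iso R G H -> graph_iso G H.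

Lemma qi_rigid_components (G H : sgraph) :
  (forall (y : G) (x : H), qi_rigid (component y) (component x)) -> qi_rigid G H.
Proof.
move=> rig /quantum_isoP[A [U [qU sU]]]; apply: graph_iso_sym.
apply: (iso_of_blocks (oner_neq0 A) qU) => x y b0.
exact/graph_iso_sym/rig/(quantum_iso_block qU sU).
Qed.

Lemma qi_rigid_compl (G H : sgraph) : qi_rigid (gcompl G) (gcompl H) -> qi_rigid G H.
Proof. by move=> rig /quantum_iso_compl/rig/graph_iso_of_compl. Qed.

Section Class.
Variable F : graph_class.
Hypothesis F_compl : forall G : sgraph, F G -> F (gcompl G).
Hypothesis F_component : forall (G : sgraph) (x : G), F G -> F (component x).

Lemma dec_qi_rigid : axiom_QI R F ->
  forall G H, dec F G -> dec F H -> qi_rigid G H.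
Proof.
(* First [G] is in [F] and the induction is on [H]: since [F] is closed under the same descents, [G]
   follows those of [H]. The general case descends along [G], and [H] follows by
   [dec_component_both]. *)
move=> QI; have base G H : F G -> dec F H -> qi_rigid G H.
  move=> + dH; elim: dH G => {H}[H FH|H _ IH|H _ IH] G FG.
  - by have [] := QI G H FG FH.
  - by apply: qi_rigid_components => y x; apply/IH/F_component.
  - apply/qi_rigid_compl/qi_rigid_components => y x.
    exact/IH/F_component/F_compl.
move=> G H dG; elim: dG H => {G}[G FG|G dG IH|G dG IH] H dH; first exact: base.
  apply: qi_rigid_components => y x; apply: IH.
  by have [] := dec_component_both F_compl F_component dH.
apply/qi_rigid_compl/qi_rigid_components => y x; apply: IH.
by have [] := dec_component_both F_compl F_component dH.
Qed.

Lemma co_QI : axiom_QI R F -> axiom_QI R (co F).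
Proof.
move=> QI G H /(co_dec F_compl F_component) dG /(co_dec F_compl F_component) dH.
split; first exact: dec_qi_rigid.
exact: quantum_iso_of_iso.
Qed.

End Class.

End QuantumIso.

(** * Automorphisms *)

Lemma graph_autP (G : sgraph) (f : {perm G}) :
  reflect (forall x y, adj (f x) (f y) = adj x y) (f \in graph_aut G).
Proof.
rewrite inE; apply: (iffP forallP) => [h x y|h x]; last by apply/forallP => y; rewrite h.
by have /forallP/(_ y)/eqP := h x.
Qed.

Lemma graph_aut_compl (G : sgraph) : graph_aut (gcompl G) = graph_aut G.
Proof.
apply/setP => f; apply/(@graph_autP (gcompl G) f)/(@graph_autP G f) => h x y; last first.
  by rewrite /= /compl_adj /= h (inj_eq perm_inj).
have := h x y; rewrite /= /compl_adj /= (inj_eq perm_inj).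
by case: eqVneq => [->|_ /= /negb_inj //]; rewrite !adj_irrefl.
Qed.

Definition has_aut (G : sgraph) := exists2 f : {perm G}, f \in graph_aut G & f != 1%g.

Lemma no_aut (G : sgraph) : ~ has_aut G <-> graph_aut G = [set 1%g].
Proof.
split=> [no|G1 [f]]; last by rewrite G1 finset.in_set1 => ->.
apply/setP => f; rewrite finset.in_set1; apply/idP/eqP => [fG|->].
  by apply/eqP/negPn/negP => f1; apply: no; exists f.
by apply/graph_autP => x y; rewrite !perm1.
Qed.

Lemma perm_neq1 (T : finType) (f : {perm T}) : (exists x, f x != x) <-> f != 1%g.
Proof.
split=> [[x]|f1]; first by apply: contra_neq => ->; rewrite perm1.
apply: contrapT => no; case/eqP: f1; apply/permP => x; rewrite perm1.
by apply/eqP/negPn/negP => fx; apply: no; exists x.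
Qed.

Lemma has_aut_iso (G H : sgraph) : graph_iso G H -> has_aut G -> has_aut H.
Proof.
move=> [f [g fK gK] fadj] [p /graph_autP pa /perm_neq1[x px]].
have F_inj : injective (f \o p \o g).
  exact: inj_comp (inj_comp (can_inj fK) perm_inj) (can_inj gK).
exists (perm F_inj).
  by apply/graph_autP => y z; rewrite !permE /= fadj pa -fadj !gK.
by apply/perm_neq1; exists (f x); rewrite permE /= fK (can_eq fK).
Qed.

Section LocalAutomorphisms.
Variable G : sgraph.
Local Notation conn := (connect (@adj G)).

Lemma aut_of_local (F : G -> G) : injective F ->
  (forall z w, conn z w -> adj (F z) (F w) = adj z w) ->
  (forall z w, conn (F z) (F w) -> conn z w) ->
  exists2 f : {perm G}, f \in graph_aut G & f =1 F.
Proof.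
move=> F_inj Fadj Fconn; exists (perm F_inj); last by move=> x; rewrite permE.
apply/graph_autP => z w; rewrite !permE.
have [/Fadj //|nzw] := boolP (conn z w).
have -> : adj z w = false by apply: contraNF nzw; apply: adj_conn.
by apply: contraNF nzw => /adj_conn/Fconn.
Qed.

Lemma component_aut (x : G) (f : {perm component x}) : f \in graph_aut (component x) ->
  exists2 F : {perm G}, F \in graph_aut G &
    (forall z, F (val z) = val (f z)) /\ (forall z, ~~ conn x z -> F z = z).
Proof.
move=> /graph_autP fadj.
pose F (z : G) : G := if insub z : option (component x) is Some u then val (f u) else z.
have Fin z : F (val z) = val (f z) by rewrite /F valK.
have Fout z : ~~ conn x z -> F z = z by move=> nxz; rewrite /F insubN.
have Fconn z : conn z (F z).
  have [xz|/Fout -> //] := boolP (conn x z).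
  rewrite -[z]/(val (comp_in xz)) Fin /= -(same_conn xz); exact: (valP (f _)).
have [| | |h hG hF] := @aut_of_local F.
- move=> z w Fzw.
  have zw : conn z w.
    by apply: connect_trans (Fconn z) _; rewrite Fzw connC.
  have [xz|nxz] := boolP (conn x z).
    have xw := connect_trans xz zw; move: Fzw.
    rewrite -[z]/(val (comp_in xz)) -[w]/(val (comp_in xw)) !Fin.
    by move/val_inj/perm_inj->.
  rewrite -(Fout z nxz) Fzw Fout // connC -(same_conn zw) connC //.
- move=> z w zw; have [xz|nxz] := boolP (conn x z).
    have xw := connect_trans xz zw.
    rewrite -[z]/(val (comp_in xz)) -[w]/(val (comp_in xw)) !Fin.
    exact: fadj.
  by rewrite !Fout // connC -(same_conn zw) connC.
- move=> z w FzFw; apply: connect_trans (Fconn z) _.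
  by apply: connect_trans FzFw _; rewrite connC.
by exists h => //; split=> z; rewrite hF; [apply: Fin | apply: Fout].
Qed.

Lemma component_has_aut (x : G) : has_aut (component x) ->
  exists F : {perm G}, [/\ F \in graph_aut G, F != 1%g & forall z, F z != z -> conn x z].
Proof.
move=> [f fG /perm_neq1[z fz]]; have [F FG [Fin Fout]] := component_aut fG.
exists F; split=> //; first by apply/perm_neq1; exists (val z); rewrite Fin.
by move=> w; apply: contraNT => /Fout ->.
Qed.

Lemma component_swap (x y : G) : graph_iso (component x) (component y) -> ~~ conn x y ->
  exists F : {perm G},
    [/\ F \in graph_aut G, F != 1%g & forall z, F z != z -> conn x z || conn y z].
Proof.
move=> [f [g fK gK] fadj] nxy.
pose F (z : G) : G :=
  if insub z : option (component x) is Some u then val (f u) else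
  if insub z : option (component y) is Some v then val (g v) else z.
have Fx (u : component x) : F (val u) = val (f u) by rewrite /F valK.
have Fy (v : component y) : F (val v) = val (g v).
  rewrite /F insubN ?valK //; apply: contra nxy => xv.
  by apply: connect_trans xv _; rewrite connC (valP v).
have Fout z : ~~ conn x z -> ~~ conn y z -> F z = z by move=> h1 h2; rewrite /F !insubN.
have gadj a b : adj (g a) (g b) = adj a b by rewrite -fadj !gK.
(* [F] is its own inverse, so that preserving connectivity entails reflecting it. *)
have FK : involutive F.
  move=> z; have [xz|nxz] := boolP (conn x z).
    by rewrite -[z]/(val (comp_in xz)) Fx Fy fK.
  have [yz|nyz] := boolP (conn y z).
    by rewrite -[z]/(val (comp_in yz)) Fy Fx gK.
  by rewrite (Fout z) // (Fout z).
have Floc z w : conn z w -> adj (F z) (F w) = adj z w /\ conn (F z) (F w).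
  move=> zw; have [xz|nxz] := boolP (conn x z).
    have xw := connect_trans xz zw.
    rewrite -[z]/(val (comp_in xz)) -[w]/(val (comp_in xw)) !Fx.
    split; first exact: fadj.
    by rewrite -(same_conn (valP (f _))); exact: (valP (f _)).
  have [yz|nyz] := boolP (conn y z).
    have yw := connect_trans yz zw.
    rewrite -[z]/(val (comp_in yz)) -[w]/(val (comp_in yw)) !Fy.
    split; first exact: gadj.
    by rewrite -(same_conn (valP (g _))); exact: (valP (g _)).
  by rewrite !Fout // connC -(same_conn zw) connC.
have [| | |h hG hF] := @aut_of_local F.
- exact: inv_inj.
- by move=> z w /Floc[].
- by move=> z w /Floc[_]; rewrite !FK.
exists h; split=> //.
  apply/perm_neq1; exists x; rewrite hF.
  apply: contra nxy => /eqP Fxx.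
  have := valP (f (comp_in (connect0 _ x))); rewrite -Fx /= Fxx => yx.
  by rewrite connC.
by move=> z; rewrite hF; apply: contraNT; rewrite negb_or => /andP[h1 h2]; rewrite Fout.
Qed.

End LocalAutomorphisms.

(** * Automorphisms, trivial quantum groups and the axiom (QA) *)

Section QuTrivial.
Variable R : realType.

(** The permutation matrix of an automorphism is a magic matrix over the scalars, which triviality
    forces to be the identity. *)
Lemma qu_trivial_no_aut (G : sgraph) : qu_trivial R G -> graph_aut G = [set 1%g].
Proof.
move=> tr; apply/no_aut => [[f /graph_autP fadj /perm_neq1[x fx]]].
pose u (y z : G) : mx_cstar R 0 := (f y == z)%:R.
have qu : qmx 1 u.
  have uu a b c d : u a b * u c d = ((f a == b) && (f c == d))%:R.
    by rewrite -natrM mulnb.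
  split.
  - by move=> a b; rewrite uu andbb.
  - by move=> a; rewrite (bigD1 (f a)) //= /u eqxx big1 ?addr0 // => b; rewrite eq_sym => /negPf ->.
  - move=> b; rewrite (bigD1 (f^-1 b)%g) //= /u permKV eqxx big1 ?addr0 // => a.
    by rewrite -(inj_eq (@perm_inj _ f)) permKV => /negPf ->.
  - move=> a a' b b' h; rewrite uu.
    case: (eqVneq (f a) b) => // ab; case: (eqVneq (f a') b') => //= ab'.
    by move: h; rewrite -ab -ab' fadj (inj_eq perm_inj) !eqxx.
have := qu_trivial_qmx tr qu x x; rewrite eqxx /u (negPf fx) => /esym/eqP.
by rewrite oner_eq0.
Qed.

Definition qa_rigid (G : sgraph) := graph_aut G = [set 1%g] -> qu_trivial R G.

Lemma qa_rigid_compl (G : sgraph) : qa_rigid (gcompl G) -> qa_rigid G.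
Proof. by move=> rig G1; apply/qu_trivial_compl/rig; rewrite graph_aut_compl. Qed.

Lemma qa_rigid_components (G : sgraph) :
  (forall x : G, qa_rigid (component x)) -> qa_rigid G.
Proof.
move=> rig /no_aut G1.
have tr (x : G) : qu_trivial R (component x).
  apply/rig/no_aut => /component_has_aut[F [FG F1 _]].
  by apply: G1; exists F.
have qg := oqu_gen_qmx R[i] G.
(* A nonzero block between distinct components would make them isomorphic, and swapping them would
   be a nontrivial automorphism. *)
have out (x y : G) : ~~ connect (@adj G) x y -> oqu_gen R[i] x y = 0.
  move=> nxy; have := block_mul_row' qg x y y; rewrite connect0 => <-.
  suff -> : block (@oqu_gen R[i] G) x y = 0 by rewrite mulr0.
  apply/eqP/negPn/negP => b0.
  have := qu_trivial_iso (tr x) b0 (block_qmx qg x y).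
  move=> /graph_iso_sym/component_swap/(_ nxy)[F [FG F1 _]].
  by apply: G1; exists F.
have b1 x : block (@oqu_gen R[i] G) x x = 1.
  have [_ r _ _] := qg; rewrite -(r x) [in RHS](bigID (connect (@adj G) x)) /=.
  by rewrite [X in _ + X]big1 ?addr0 // => y /out.
apply/qu_trivialP => x y; have [xy|nxy] := boolP (connect (@adj G) x y); last first.
  by rewrite out //; case: eqP nxy => // ->; rewrite connect0.
have := qu_trivial_qmx (tr x) (block_qmx qg x x) (comp_in (connect0 _ x)) (comp_in xy).
by rewrite /= => ->; rewrite -val_eqE /= b1; case: (x == y).
Qed.

Lemma dec_qa_rigid (F : graph_class) : axiom_QA R F -> forall G, dec F G -> qa_rigid G.
Proof.
move=> QA G; elim=> {G}[G FG|G _ IH|G _ IH]; first by have [] := QA G FG.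
  exact: qa_rigid_components.
exact/qa_rigid_compl/qa_rigid_components.
Qed.

End QuTrivial.

(** * Commutative envelopes and quantum symmetry *)

Section DiagonalMatrices.
Variables (R : realType) (n : nat).
Local Notation C := R[i].
Local Notation M := (mx_cstar R n).

Definition diag_mem (a : M) := exists d : 'rV[C]_n.+1, a = diag_mx d.

Lemma diag_one_mem : diag_mem 1.
Proof. by exists (const_mx 1); rewrite diag_const_mx. Qed.

Lemma diag_star x : diag_mem x -> diag_mem (star x).
Proof.
move=> [d ->]; exists (map_mx Num.conj d).
by rewrite -map_diag_mx -[in RHS]tr_diag_mx.
Qed.

Lemma diag_lin (a : C) x y : diag_mem x -> diag_mem y -> diag_mem (a *: x + y).
Proof. by move=> [d ->] [d' ->]; exists (a *: d + d'); rewrite linearP. Qed.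

Lemma diag_mul x y : diag_mem x -> diag_mem y -> diag_mem (x * y).
Proof.
move=> [d ->] [d' ->]; exists (\row_i (d 0 i * d' 0 i)).
exact: mulmx_diag.
Qed.

(** Entries are bounded by the operator norm, so zeros off the diagonal pass to the limit. *)
Lemma diag_lim u l : (forall k, diag_mem (u k)) -> cnorm_limit u l -> diag_mem l.
Proof.
move=> Su ul; exists (\row_i l i i); apply/matrixP => i j; rewrite !mxE.
case: eqP => [<- //|/eqP ij]; rewrite mulr0n.
apply: ComplexField.Normc.eq0_normc; apply/eqP/negPn/negP => lij.
have l0 : 0 < normc (l i j) by rewrite lt_neqAle eq_sym lij normc_ge0.
have [N /(_ N (leqnn N))] := ul _ l0; apply/negP; rewrite -leNgt.
have [d ud] := Su N.
have := entry_le (u N - l) i j; rewrite mxE ud mxE (negPf ij) mulr0n add0r mxE normcN.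
by rewrite -ud.
Qed.

Definition diag_cstar : sub_cstar M :=
  SubCStar diag_one_mem (oner_neq0 _) (fun x _ => mul1r x) diag_star diag_lin
    diag_mul diag_lim.

Local Notation B := (sc_type diag_cstar).

Definition dg_mem (f : 'I_n.+1 -> C) : diag_mem (diag_mx (\row_i f i)).
Proof. by exists (\row_i f i). Qed.

Definition dg (f : 'I_n.+1 -> C) : B := sc_in (S := diag_cstar) (dg_mem f).
Definition dg_coef (b : B) (i : 'I_n.+1) : C := (val b : 'M[C]_n.+1) i i.

Lemma dg_coefK f : dg_coef (dg f) =1 f.
Proof. by move=> i; rewrite /dg_coef !mxE eqxx mulr1n. Qed.

Lemma dg_ext f g : f =1 g -> dg f = dg g.
Proof. by move=> fg; apply: sc_inj; apply/matrixP => i j; rewrite !mxE fg. Qed.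

Lemma dgK b : dg (dg_coef b) = b.
Proof.
apply: sc_inj; have [d bd] := scP b; rewrite /dg /= /dg_coef bd.
by apply/matrixP => i j; rewrite !mxE eqxx mulr1n -[sval b]/(val b) bd mxE.
Qed.

Lemma dg_coefM b c i : dg_coef (b * c) i = dg_coef b i * dg_coef c i.
Proof.
have [d bd] := scP b; have [d' cd] := scP c.
rewrite /dg_coef -[val (b * c)]/((val b : 'M_n.+1) *m (val c : 'M_n.+1)) bd cd mulmx_diag.
by rewrite !mxE !eqxx !mulr1n.
Qed.

Lemma dg_coef_lin (a : C) b c i : dg_coef (a *: b + c) i = a * dg_coef b i + dg_coef c i.
Proof. by rewrite /dg_coef /= !mxE. Qed.

Lemma dg_coef1 i : dg_coef 1 i = 1.
Proof. by rewrite /dg_coef /= !mxE eqxx. Qed.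

Lemma dg_coef_star b i : dg_coef (star b) i = Num.conj (dg_coef b i).
Proof. by rewrite /dg_coef /= !mxE. Qed.

Lemma dg_coef_inj b c : dg_coef b =1 dg_coef c -> b = c.
Proof. by move=> h; rewrite -(dgK b) -(dgK c); apply: dg_ext. Qed.

Lemma diag_commutative (b c : B) : b * c = c * b.
Proof. by apply: dg_coef_inj => i; rewrite !dg_coefM mulrC. Qed.

Lemma dg_coef0 i : dg_coef 0 i = 0.
Proof. by rewrite /dg_coef /= !mxE. Qed.

Lemma dg_coef_sum (I : Type) (r : seq I) (P : pred I) (F : I -> B) i :
  dg_coef (\sum_(k <- r | P k) F k) i = \sum_(k <- r | P k) dg_coef (F k) i.
Proof.
apply: (big_morph (dg_coef^~ i)) => [b c|]; last exact: dg_coef0.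
by have := dg_coef_lin 1 b c i; rewrite scale1r mul1r.
Qed.

Lemma dg_coef_prod (I : Type) (r : seq I) (P : pred I) (F : I -> B) i :
  dg_coef (\prod_(k <- r | P k) F k) i = \prod_(k <- r | P k) dg_coef (F k) i.
Proof.
apply: (big_morph (dg_coef^~ i)) => [b c|]; last exact: dg_coef1.
exact: dg_coefM.
Qed.

End DiagonalMatrices.

Definition commuting_qmx (R : realType) (G : sgraph) :=
  forall (A : cstarAlgType R) (u : G -> G -> A),
    qmx 1 u -> (forall x y, star (u x y) = u x y) ->
    forall x y x' y', GRing.comm (u x y) (u x' y').

Lemma star_prod_comm (C : numClosedFieldType) (A : starAlgType C) (I : Type)
    (r : seq I) (F : I -> A) :
  (forall i, star (F i) = F i) -> (forall i j, GRing.comm (F i) (F j)) ->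
  star (\prod_(i <- r) F i) = \prod_(i <- r) F i.
Proof.
move=> sF cF; elim: r => [|i r IH]; first by rewrite !big_nil star1.
by rewrite !big_cons starM IH sF; apply/esym/commr_prod => j _; apply: cF.
Qed.

(** * Magic matrices with commuting entries *)

Section CommutingMatrix.
Variables (C : numClosedFieldType) (A : algType C) (G : sgraph) (w : G -> G -> A).
Hypotheses (qw : qmx 1 w) (cw : forall x y x' y', GRing.comm (w x y) (w x' y')).

(** In the commuting case these play the role of indicator functions of the maps [f]; a nonzero one
    belongs to an automorphism by [path_prod_compat]. *)
Definition path_prod (f : G -> G) : A := \prod_x w x (f x).

Lemma comm_path_prod x y f : GRing.comm (w x y) (path_prod f).
Proof. by apply: commr_prod => z _; apply: cw. Qed.

Lemma path_prod_absorb x f : w x (f x) * path_prod f = path_prod f.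
Proof.
rewrite /path_prod; have := mem_index_enum x; elim: index_enum => // z r IH.
rewrite inE !big_cons mulrA => /orP[/eqP ->|/IH rx].
  by rewrite (qmx_rowP qw) eqxx.
by rewrite cw -mulrA rx.
Qed.

Lemma path_prod_mul x y f :
  w x y * path_prod f = if f x == y then path_prod f else 0.
Proof.
rewrite -{1}(path_prod_absorb x f) mulrA (qmx_rowP qw) eq_sym; case: eqP => [<-|_].
  exact: path_prod_absorb.
exact: mul0r.
Qed.

Lemma path_prod_idem f : path_prod f * path_prod f = path_prod f.
Proof.
rewrite {1}/path_prod; elim: index_enum => [|x r IH]; first by rewrite big_nil mul1r.
by rewrite big_cons -mulrA IH path_prod_absorb.
Qed.

Lemma path_prod_orth f g x : f x != g x -> path_prod f * path_prod g = 0.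
Proof.
move=> fg; rewrite -(path_prod_absorb x f) comm_path_prod -mulrA path_prod_mul.
by rewrite eq_sym (negPf fg) mulr0.
Qed.

Lemma path_prod_compat f x x' : path_prod f != 0 ->
  (x == x') = (f x == f x') /\ adj x x' = adj (f x) (f x').
Proof.
move=> f0; suff /orP h : ~~ (((x == x') != (f x == f x')) || (adj x x' != adj (f x) (f x'))).
  by move: h => /orP; rewrite negb_or !negbK => /andP[/eqP ? /eqP].
apply: contra f0 => h; have [_ _ _ orth] := qw.
by rewrite -(path_prod_absorb x) -(path_prod_absorb x') mulrA orth // mul0r.
Qed.

(** Expand the product over [x] of the row sums, each equal to 1. *)
Lemma path_prod_sum : \sum_(f : {ffun G -> G}) path_prod f = 1.
Proof.
have [_ r _ _] := qw; rewrite -(bigA_distr_bigA (fun x y => w x y)).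
by rewrite big1.
Qed.

End CommutingMatrix.

(** * The enveloping C*-algebra in the commuting case *)

Section Envelope.
Variables (R : realType) (G : sgraph).
Hypothesis comG : commuting_qmx R G.
Local Notation C := R[i].
Local Notation O := (OQu C G).
Local Notation gen := (@oqu_gen C G).
Local Notation n := #|graph_aut G|.-1.

(** Matrices have size [n.+1], hence the predecessor in [n]; the identity makes the automorphism
    group nonempty. *)
Lemma card_graph_aut : n.+1 = #|graph_aut G|.
Proof.
rewrite prednK //; apply/card_gt0P; exists 1%g.
by apply/graph_autP => x y; rewrite !perm1.
Qed.

Definition aut_nth (i : 'I_n.+1) : {perm G} := enum_val (cast_ord card_graph_aut i).

Lemma aut_nthP i : aut_nth i \in graph_aut G. Proof. exact: enum_valP. Qed.

Lemma aut_nth_inj : injective aut_nth.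
Proof. by move=> i j /enum_val_inj/cast_ord_inj. Qed.

Lemma aut_nth_surj f : f \in graph_aut G -> exists i, aut_nth i = f.
Proof.
move=> fG; exists (cast_ord (esym card_graph_aut) (enum_rank_in fG f)).
by rewrite /aut_nth cast_ordKV enum_rankK_in.
Qed.

Local Notation B := (sc_type (diag_cstar R n)).

Definition aut_matrix (x y : G) : B := dg (fun i => (aut_nth i x == y)%:R).

Lemma aut_matrixE x y i : dg_coef (aut_matrix x y) i = (aut_nth i x == y)%:R.
Proof. exact: dg_coefK. Qed.

Lemma aut_matrix_qmx : qmx 1 aut_matrix.
Proof.
have mE a b c d i : dg_coef (aut_matrix a b * aut_matrix c d) i
    = ((aut_nth i a == b) && (aut_nth i c == d))%:R.
  by rewrite dg_coefM !aut_matrixE -natrM mulnb.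
split.
- by move=> x y; apply: dg_coef_inj => i; rewrite mE andbb aut_matrixE.
- move=> x; apply: dg_coef_inj => i; rewrite dg_coef_sum dg_coef1 (bigD1 (aut_nth i x)) //=.
  by rewrite aut_matrixE eqxx big1 ?addr0 // => y; rewrite aut_matrixE eq_sym => /negPf ->.
- move=> y; apply: dg_coef_inj => i; rewrite dg_coef_sum dg_coef1.
  rewrite (bigD1 ((aut_nth i)^-1 y)%g) //= aut_matrixE permKV eqxx big1 ?addr0 // => x.
  by rewrite aut_matrixE -(inj_eq (@perm_inj _ (aut_nth i))) permKV => /negPf ->.
- move=> x x' y y' h; apply: dg_coef_inj => i; rewrite mE dg_coef0.
  case: (eqVneq (aut_nth i x) y) => // xy; case: (eqVneq (aut_nth i x') y') => //= xy'.
  have /graph_autP fadj := aut_nthP i.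
  by move: h; rewrite -xy -xy' fadj (inj_eq perm_inj) !eqxx.
Qed.

Lemma aut_matrix_star x y : star (aut_matrix x y) = aut_matrix x y.
Proof.
by apply: dg_coef_inj => i; rewrite dg_coef_star aut_matrixE rmorph_nat.
Qed.

Section Universal.
Variables (D : cstarAlgType R) (phi : {lrmorphism O -> D}).
Hypothesis sphi : star_preserving phi.
Local Notation w := (fun x y => phi (gen x y)).

Lemma hom_qmx : qmx 1 w.
Proof.
have [idem r c orth] := oqu_gen_qmx C G.
split=> [x y|x|y|x x' y y' h].
- by rewrite -rmorphM idem.
- by rewrite -rmorph_sum r rmorph1.
- by rewrite -rmorph_sum c rmorph1.
- by rewrite -rmorphM orth // rmorph0.
Qed.

Lemma hom_star x y : star (w x y) = w x y.
Proof. by rewrite -sphi oqu_gen_star. Qed.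

Let cw x y x' y' : GRing.comm (w x y) (w x' y') := comG hom_qmx hom_star x y x' y'.

Definition aut_proj (i : 'I_n.+1) : D := path_prod w (aut_nth i).

Lemma aut_projM i j : aut_proj i * aut_proj j = if i == j then aut_proj i else 0.
Proof.
case: (eqVneq i j) => [->|ij]; first exact: (path_prod_idem hom_qmx cw).
have [x hx] : exists x, aut_nth i x != aut_nth j x.
  apply: contrapT => no; case/eqP: ij; apply/aut_nth_inj/permP => x.
  by apply/eqP/negPn/negP => hx; apply: no; exists x.
exact: (path_prod_orth hom_qmx cw hx).
Qed.

Lemma aut_proj_star i : star (aut_proj i) = aut_proj i.
Proof. by apply: star_prod_comm => [x|x y]; [apply: hom_star | apply: cw]. Qed.

Lemma aut_proj_mul x y i : w x y * aut_proj i = if aut_nth i x == y then aut_proj i else 0.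
Proof. exact: (path_prod_mul hom_qmx cw). Qed.

(** In [path_prod_sum] only automorphisms contribute, since a nonzero path product forces its map to
    be injective and to preserve adjacency. *)
Lemma aut_proj_sum : \sum_i aut_proj i = 1.
Proof.
rewrite -(path_prod_sum hom_qmx).
transitivity (\sum_i \sum_(f : {ffun G -> G} | f == [ffun x => aut_nth i x]) path_prod w f).
  apply: eq_bigr => i _; rewrite (big_pred1 [ffun x => aut_nth i x]) //.
  by rewrite /aut_proj /path_prod; apply: eq_bigr => x _; rewrite ffunE.
rewrite (exchange_big_dep xpredT) //=; apply: eq_bigr => f _.
have [->|f0] := eqVneq (path_prod w f) 0; first by rewrite big1.
have f_inj : injective f.
  move=> x x' e; apply/eqP.
  by have [-> _] := path_prod_compat hom_qmx cw x x' f0; rewrite e.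
have [|i iE] := @aut_nth_surj (perm f_inj).
  apply/graph_autP => x x'; rewrite !permE.
  by have [_ ->] := path_prod_compat hom_qmx cw x x' f0.
rewrite (big_pred1 i) // => j /=; apply/eqP/eqP => [fj|->].
  by apply/aut_nth_inj/permP => x; rewrite iE permE fj ffunE.
by apply/ffunP => x; rewrite ffunE iE permE.
Qed.

(** The factorisation of [phi] through the functions on [Aut(G)]. *)
Definition aut_lift (b : B) : D := \sum_i dg_coef b i *: aut_proj i.

Lemma aut_liftP (a : C) : {morph aut_lift : b c / a *: b + c}.
Proof.
move=> b c; rewrite /aut_lift scaler_sumr -big_split /=; apply: eq_bigr => i _.
by rewrite dg_coef_lin scalerDl scalerA.
Qed.

Lemma aut_liftM : {morph aut_lift : b c / b * c}.
Proof.
move=> b c; rewrite /aut_lift mulr_suml; apply: eq_bigr => i _.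
rewrite mulr_sumr (bigD1 i) //= big1 => [|j /negPf ji].
  by rewrite addr0 dg_coefM -scalerAl -scalerAr aut_projM eqxx scalerA.
by rewrite -scalerAl -scalerAr aut_projM eq_sym ji !scaler0.
Qed.

Lemma aut_lift1 : aut_lift 1 = 1.
Proof. by rewrite -aut_proj_sum; apply: eq_bigr => i _; rewrite dg_coef1 scale1r. Qed.

Lemma aut_liftB : {morph aut_lift : b c / b - c}.
Proof.
move=> b c; rewrite -[- c]scaleN1r addrC aut_liftP scaleN1r addrC //.
Qed.

Lemma aut_liftZ (a : C) b : aut_lift (a *: b) = a *: aut_lift b.
Proof.
rewrite /aut_lift scaler_sumr; apply: eq_bigr => i _.
by rewrite scalerA -[a *: b]addr0 dg_coef_lin dg_coef0 addr0.
Qed.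

Lemma aut_lift_star : star_preserving aut_lift.
Proof.
move=> b; rewrite /aut_lift star_sum; apply: eq_bigr => i _.
by rewrite starZ aut_proj_star dg_coef_star.
Qed.

Lemma aut_lift_matrix x y : aut_lift (aut_matrix x y) = w x y.
Proof.
rewrite -[RHS]mulr1 -aut_proj_sum mulr_sumr; apply: eq_bigr => i _.
by rewrite aut_matrixE aut_proj_mul scaler_nat; case: eqP.
Qed.

HB.instance Definition _ := GRing.isZmodMorphism.Build B D aut_lift aut_liftB.
HB.instance Definition _ := GRing.isMonoidMorphism.Build B D aut_lift
  (aut_lift1, aut_liftM).
HB.instance Definition _ := GRing.isScalable.Build C B D *:%R aut_lift aut_liftZ.

Lemma aut_lift_hom : exists psi : {lrmorphism B -> D}, psi =1 aut_lift.
Proof. by exists aut_lift. Qed.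

End Universal.

(* [C(Qu(G))] is realised by the diagonal matrices indexed by [Aut(G)]. *)
Lemma aut_envelope : exists iota : {lrmorphism O -> B}, is_cstar_envelope iota.
Proof.
have [iota siota iE] := oqu_star_hom aut_matrix_qmx aut_matrix_star.
exists iota; split=> // D phi sphi.
have [psi psiE] := aut_lift_hom sphi.
have spsi : star_preserving psi by move=> b; rewrite !psiE; apply: aut_lift_star.
have psi_iota : psi \o iota =1 phi.
  have sc : star_preserving (psi \o iota) by move=> q; rewrite /= siota spsi.
  apply: (@oqu_hom_eq _ _ _ (psi \o iota : {lrmorphism O -> D})) => // x y.
  by rewrite /= iE psiE; apply: aut_lift_matrix.
exists psi; split=> // psi' spsi' psi'_iota b.
(* [iota] sends [m i] to the indicator of [aut_nth i], so [iota] is onto, which makes [psi]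
   unique. *)
pose m i : O := \prod_x gen x (aut_nth i x).
have bE : b = iota (\sum_i dg_coef b i *: m i).
  apply: dg_coef_inj => j; rewrite linear_sum dg_coef_sum (bigD1 j) //=.
  have mE i : dg_coef (iota (dg_coef b i *: m i)) j = dg_coef b i * (i == j)%:R.
    rewrite linearZ /= -[_ *: _]addr0 dg_coef_lin dg_coef0 addr0 rmorph_prod dg_coef_prod.
    congr (_ * _); transitivity (\prod_x (aut_nth j x == aut_nth i x)%:R : C).
      by apply: eq_bigr => x _; rewrite -aut_matrixE -iE.
    have [->|ij] := eqVneq i j; first by rewrite big1 // => x _; rewrite eqxx.
    have [x hx] : exists x, aut_nth j x != aut_nth i x.
      apply: contrapT => no; case/eqP: ij; apply/aut_nth_inj/permP => x.
      by apply/esym/eqP/negPn/negP => hx; apply: no; exists x.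
    by rewrite (bigD1 x) //= (negPf hx) mul0r.
  by rewrite mE eqxx mulr1 big1 ?addr0 // => i /negPf ij; rewrite mE ij mulr0.
by rewrite bE; have := psi'_iota (\sum_i dg_coef b i *: m i); rewrite -psi_iota.
Qed.

Lemma commuting_no_symmetry : ~ quantum_symmetry R G.
Proof.
move=> qs; have [iota env] := aut_envelope.
exact: (qs _ iota env (@diag_commutative R n)).
Qed.

End Envelope.

(** Some envelope is commutative. The homomorphism that [u] defines on [O(Qu(G))] factors through
    it, so the entries of [u] lie in a commutative image. *)
Lemma no_symmetry_commuting (R : realType) (G : sgraph) :
  ~ quantum_symmetry R G -> commuting_qmx R G.
Proof.
move=> nqs A u qu su x y x' y'.
have [B [iota [[siota env] comB]]] : exists (B : cstarAlgType R)
    (iota : {lrmorphism OQu R[i] G -> B}),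
    is_cstar_envelope iota /\ commutative (fun a b : B => a * b).
  apply: contrapT => no; apply: nqs => B iota env comB.
  by apply: no; exists B, iota.
have [phi sphi phiE] := oqu_star_hom qu su.
have [psi [_ psiE _]] := env A phi sphi.
have cB (a b : B) : a * b = b * a := comB a b.
by rewrite /GRing.comm -!phiE -!psiE /= -!(rmorphM psi) cB.
Qed.

Lemma schmidt_intro (G : sgraph) (f g : {perm G}) :
  f \in graph_aut G -> g \in graph_aut G -> f != 1%g -> g != 1%g ->
  (forall z, f z != z -> g z = z) -> schmidt G.
Proof.
move=> fG gG f1 g1 fg; exists f, g; split=> //.
apply/pred0P => z /=; rewrite !inE; apply/negP => /andP[/fg ->].
by rewrite eqxx.
Qed.

Lemma schmidt_of_compl (G : sgraph) : schmidt (gcompl G) -> schmidt G.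
Proof.
move=> [f [g [fG gG f1 g1 fg]]]; exists f, g; split=> //.
  by rewrite -graph_aut_compl.
by rewrite -graph_aut_compl.
Qed.

Lemma schmidt_component (G : sgraph) (x : G) : schmidt (component x) -> schmidt G.
Proof.
move=> [f [g [fG gG /perm_neq1[a fa] /perm_neq1[b gb] /pred0P fg]]].
have [F FG [Fin Fout]] := component_aut fG; have [K KG [Kin Kout]] := component_aut gG.
apply: (schmidt_intro FG KG).
- by apply/perm_neq1; exists (val a); rewrite Fin.
- by apply/perm_neq1; exists (val b); rewrite Kin.
move=> z; have [xz|/Fout ->] := boolP (connect (@adj G) x z); last by rewrite eqxx.
rewrite -[z]/(val (comp_in xz)) Fin Kin => fz; congr val.
by have := fg (comp_in xz); rewrite /= !inE fz /= => /negbFE/eqP.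
Qed.

(** * Noncommuting entries from Schmidt's criterion *)

Section TwoProjections.
Variable R : realType.

Definition proj_diag : mx_cstar R 1 := delta_mx 0 0.
(** The orthogonal projection onto the line spanned by the all-ones vector. *)
Definition proj_flat : mx_cstar R 1 := const_mx 2^-1.

Lemma proj_diagP : is_projection proj_diag.
Proof.
split; last by rewrite /GRing.mul /= /proj_diag mul_delta_mx.
by apply/matrixP => i j; rewrite !mxE andbC rmorph_nat.
Qed.

Lemma proj_flatP : is_projection proj_flat.
Proof.
split; apply/matrixP => i j; rewrite !mxE.
  by rewrite fmorphV rmorph_nat.
under eq_bigr do rewrite !mxE.
by rewrite sumr_const card_ord -[LHS]mulr_natl mulrA mulfV ?pnatr_eq0 // mul1r.
Qed.

Lemma two_projections_noncomm : proj_diag * proj_flat <> proj_flat * proj_diag.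
Proof.
move/matrixP/(_ 0 1); rewrite !mxE !big_ord_recl !big_ord0 !mxE /=.
rewrite !(mul1r, mul0r, mulr0, addr0) => /eqP.
by rewrite invr_eq0 pnatr_eq0.
Qed.

End TwoProjections.

Section SchmidtCriterion.
Variables (R : realType) (A : cstarAlgType R) (G : sgraph).

(* [p 1 + (1 - p) f] as a matrix over [A]. *)
Definition aut_mix (p : A) (f : {perm G}) (x y : G) : A :=
  (if x == y then p else 0) + (if f x == y then 1 - p else 0).

Section Mix.
Variables (p : A) (f : {perm G}).
Hypotheses (pp : is_projection p) (fG : f \in graph_aut G).

Lemma aut_mix_projection x y : is_projection (aut_mix p f x y).
Proof.
have qq := projectionC pp; rewrite /aut_mix.
have p0 : is_projection (0 : A) by split; rewrite ?star0 ?mulr0.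
have p1 : is_projection (1 : A) by split; rewrite ?star1 ?mulr1.
by do 2 case: ifP => _; rewrite ?addr0 ?add0r // addrC subrK.
Qed.

Lemma sum_if1 (x : G) (a : A) : \sum_y (if x == y then a else 0) = a.
Proof. by rewrite -big_mkcond (big_pred1 x) // => y; rewrite /= eq_sym. Qed.

Lemma aut_mix_row x : \sum_y aut_mix p f x y = 1.
Proof. by rewrite big_split /= !sum_if1 addrC subrK. Qed.

Lemma aut_mix_col y : \sum_x aut_mix p f x y = 1.
Proof.
rewrite big_split /=; under eq_bigr do rewrite eq_sym.
rewrite sum_if1; under eq_bigr do rewrite (canF_eq (permK f)) eq_sym.
by rewrite sum_if1 addrC subrK.
Qed.

Lemma aut_mix_tw x y :
  \sum_z aut_mix p f x z * adjm A z y = \sum_z adjm A x z * aut_mix p f z y.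
Proof.
have ifM b (a c : A) : (if b then a else 0) * c = if b then a * c else 0.
  by case: b; rewrite ?mul0r.
have Mif b (a c : A) : c * (if b then a else 0) = if b then c * a else 0.
  by case: b; rewrite ?mulr0.
have sl z0 (a : A) (F : G -> A) : \sum_z (if z0 == z then a else 0) * F z = a * F z0.
  rewrite (bigD1 z0) //= eqxx big1 ?addr0 // => z.
  by rewrite eq_sym => /negPf ->; rewrite mul0r.
have sr z0 (a : A) (F : G -> A) : \sum_z F z * (if z0 == z then a else 0) = F z0 * a.
  rewrite (bigD1 z0) //= eqxx big1 ?addr0 // => z.
  by rewrite eq_sym => /negPf ->; rewrite mulr0.
under eq_bigr do rewrite mulrDl; rewrite big_split /= !sl.
under [RHS]eq_bigr do rewrite mulrDr (canF_eq (permK f)) ![_ == y]eq_sym ![_ == (f^-1)%g y]eq_sym.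
rewrite [RHS]big_split /= !sr; have /graph_autP fadj := fG.
rewrite /adjm -{2}(permKV f y) fadj.
by congr (_ + _); rewrite commr_nat.
Qed.

Lemma aut_mix_fix x y : f x = x -> aut_mix p f x y = if x == y then 1 else 0.
Proof. by rewrite /aut_mix => ->; case: eqP => _; rewrite ?addr0 // addrC subrK. Qed.

End Mix.

Variables (p q : A) (f g : {perm G}).
Hypotheses (pp : is_projection p) (qq : is_projection q).
Hypotheses (fG : f \in graph_aut G) (gG : g \in graph_aut G).
Hypothesis fg : [disjoint graph_supp f & graph_supp g].

Lemma supp_fix x : f x != x -> g x = x.
Proof.
move=> fx; apply/eqP; have /pred0P/(_ x) := fg.
by rewrite /= !inE fx /= => /negbFE.
Qed.

(** Each row of the product is a row of one factor: if [f] moves [x] it also moves [f x], so [g]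
    fixes both, and the second factor acts as the identity on the support of row [x] of the
    first. *)
Lemma aut_mix_mul x y : \sum_z aut_mix p f x z * aut_mix q g z y =
  if f x != x then aut_mix p f x y else aut_mix q g x y.
Proof.
have [fx|fx] := eqVneq (f x) x.
  rewrite (bigD1 x) //= aut_mix_fix // eqxx mul1r big1 ?addr0 // => z /negPf zx.
  by rewrite aut_mix_fix // eq_sym zx mul0r.
have gz z : (x == z) || (f x == z) -> g z = z.
  case/orP => /eqP <-; first exact: supp_fix.
  by apply: supp_fix; rewrite (inj_eq perm_inj).
rewrite (bigD1 y) //= [X in _ + X]big1 ?addr0 => [|z zy]; last first.
  have [h|/norP[/negPf h1 /negPf h2]] := boolP ((x == z) || (f x == z)).
    by rewrite (aut_mix_fix _ _ (gz z h)) (negPf zy) mulr0.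
  by rewrite /aut_mix h1 h2 addr0 mul0r.
have [h|/norP[/negPf h1 /negPf h2]] := boolP ((x == y) || (f x == y)).
  by rewrite (aut_mix_fix _ _ (gz y h)) eqxx mulr1.
by rewrite {1 3}/aut_mix h1 h2 addr0 mul0r.
Qed.

Lemma aut_mix_mul_qmx : qmx 1 (fun x y => \sum_z aut_mix p f x z * aut_mix q g z y).
Proof.
apply: magic_unitary_qmx.
  split=> // [x y|x|y].
  - by rewrite aut_mix_mul; case: ifP => _; apply: aut_mix_projection.
  - rewrite exchange_big /=; under eq_bigr do rewrite -mulr_sumr aut_mix_row mulr1.
    exact: aut_mix_row.
  - rewrite exchange_big /=; under eq_bigr do rewrite -mulr_suml aut_mix_col mul1r.
    exact: aut_mix_col.
move=> x y; under eq_bigr do rewrite mulr_suml.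
rewrite exchange_big /=.
under eq_bigr => z _ do
  [under eq_bigr do rewrite -mulrA; rewrite -mulr_sumr (aut_mix_tw q gG) mulr_sumr].
rewrite exchange_big /=.
under eq_bigr => z _ do
  [under eq_bigr do rewrite mulrA; rewrite -mulr_suml (aut_mix_tw p fG) mulr_suml].
rewrite exchange_big /=; apply: eq_bigr => z _.
by rewrite mulr_sumr; apply: eq_bigr => z' _; rewrite mulrA.
Qed.

End SchmidtCriterion.

Lemma schmidt_not_commuting (R : realType) (G : sgraph) :
  schmidt G -> ~ commuting_qmx R G.
Proof.
move=> [f [g [fG gG /perm_neq1[a fa] /perm_neq1[b gb] fg]]] com.
have pp := proj_diagP R; have qq := proj_flatP R.
have qu := aut_mix_mul_qmx pp qq fG gG fg.
have su x y : star (\sum_z aut_mix (proj_diag R) f x z * aut_mix (proj_flat R) g z y)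
    = \sum_z aut_mix (proj_diag R) f x z * aut_mix (proj_flat R) g z y.
  by rewrite (aut_mix_mul _ _ fg); case: ifP => _; apply: (proj1 (aut_mix_projection _ _ _ _)).
apply: (@two_projections_noncomm R).
(* The diagonal entry at [a], which [f] moves, is [proj_diag]; at [b], which [g] moves, it is
   [proj_flat]. *)
have := com _ _ qu su a a b b.
rewrite !(aut_mix_mul _ _ fg) fa.
have -> : f b = b.
  by apply: (@supp_fix G g f) => //; rewrite disjoint_sym.
by rewrite /= eqxx /aut_mix (negPf fa) (negPf gb) !eqxx !addr0.
Qed.

(** For entries in different rows and columns, inserting the sum of row [i] on the right gives [q i
    j * q i' j' = q i j * q i' j' * q i j]: in a column [m] other than [j] and [j'], replacing
    [q i' j'] by 1 minus the rest of its row kills every term, as there is no fourth column. The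
    right side is self-adjoint, so the entries commute. *)
Lemma magic3_comm (C : numClosedFieldType) (A : starAlgType C) (I : finType)
    (q : I -> I -> A) : (#|I| <= 3)%N ->
  (forall i j, is_projection (q i j)) -> (forall i, \sum_j q i j = 1) ->
  (forall i j j', j != j' -> q i j * q i j' = 0) ->
  (forall i i' j, i != i' -> q i j * q i' j = 0) ->
  forall i j i' j', GRing.comm (q i j) (q i' j').
Proof.
move=> I3 pq r orow ocol i j i' j'.
have sq k l : star (q k l) = q k l by have [] := pq k l.
have [<-|ii'] := eqVneq i i'.
  have [<- //|jj'] := eqVneq j j'.
  by rewrite /GRing.comm !orow // eq_sym.
have [<-|jj'] := eqVneq j j'.
  by rewrite /GRing.comm !ocol // eq_sym.
have key : q i j * q i' j' = q i j * q i' j' * q i j.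
  rewrite -[LHS]mulr1 -(r i) mulr_sumr (bigD1 j) //= big1 ?addr0 // => m mj.
  have [->|mj'] := eqVneq m j'; first by rewrite -mulrA ocol ?mulr0 // eq_sym.
  have -> : q i' j' = 1 - \sum_(l | l != j') q i' l.
    by rewrite -(r i') (bigD1 j') //= addrK.
  rewrite mulrBr mulr1 mulrBl orow 1?eq_sym // sub0r mulr_sumr mulr_suml big1 ?oppr0 //.
  move=> l lj'; have [->|lj] := eqVneq l j; first by rewrite ocol ?mul0r.
  have [->|lm] := eqVneq l m; first by rewrite -mulrA ocol ?mulr0 // eq_sym.
  have : (4 <= #|I|)%N.
    have /card_uniqP us : uniq [:: j; j'; m; l].
      rewrite /= !inE !negb_or jj' (eq_sym j) mj (eq_sym j l) lj.
      by rewrite (eq_sym j') mj' (eq_sym j' l) lj' (eq_sym m) lm.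
    rewrite -[4%N]/(size [:: j; j'; m; l]) -us; exact: max_card.
  by move=> I4; have := leq_trans I4 I3.
have := congr1 (@star _ A) key; rewrite !starM !sq mulrA => key'.
by rewrite /GRing.comm key key'.
Qed.

(** * Lifting commutation from the components to the graph *)

Section CommutingStep.
Variables (R : realType) (G : sgraph).
Local Notation conn := (connect (@adj G)).
Hypothesis qiG : forall x y : G, qi_rigid R (component x) (component y).
Hypothesis qaG : forall x : G, qa_rigid R (component x).
Hypothesis cqG : forall x : G, ~ schmidt (component x) -> commuting_qmx R (component x).
Hypothesis nsG : ~ schmidt G.

Variables (A : cstarAlgType R) (u : G -> G -> A).
Hypotheses (qu : qmx 1 u) (su : forall x y, star (u x y) = u x y).
Local Notation iso x y := (graph_iso (component (x : G)) (component (y : G))).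

Lemma block_iso x y : block u x y != 0 -> iso x y.
Proof. by move=> b0; apply/graph_iso_sym/qiG/(quantum_iso_block qu su). Qed.

Lemma entry_block x y : u x y != 0 -> block u x y != 0.
Proof.
apply: contra_neq => b0; have := block_mul_row' qu x y y.
by rewrite connect0 b0 mulr0.
Qed.

Lemma entry_iso x y : u x y != 0 -> iso x y.
Proof. by move/entry_block/block_iso. Qed.

(** The automorphism may act inside the component of [x] or permute copies of it. Vertices movable
    in non-isomorphic components would yield disjoint supports. *)
Definition movable (x : G) := exists F : {perm G},
  [/\ F \in graph_aut G, F != 1%g & forall z, F z != z -> iso x z].

Lemma swap_movable x z : iso x z -> ~~ conn x z -> movable x.
Proof.
move=> xz nxz; have [F [FG F1 Fs]] := component_swap xz nxz.
exists F; split=> // w /Fs/orP[xw|zw]; first exact: component_conn.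
exact: graph_iso_trans xz (component_conn zw).
Qed.

Lemma aut_movable x : has_aut (component x) -> movable x.
Proof.
move=> /component_has_aut[F [FG F1 Fs]]; exists F; split=> // w /Fs.
exact: component_conn.
Qed.

Lemma movable_iso x x' : movable x -> movable x' -> iso x x'.
Proof.
move=> [F [FG F1 Fs]] [K [KG K1 Ks]]; apply: contrapT => nxx'; apply: nsG.
apply: (schmidt_intro FG KG) => // z /Fs xz; apply: contrapT => /eqP/Ks x'z.
exact/nxx'/(graph_iso_trans xz)/graph_iso_sym.
Qed.

Lemma block_diag1 x : (forall z, iso x z -> conn x z) -> block u x x = 1.
Proof.
move=> hx; have [_ r _ _] := qu; rewrite -(r x) [RHS](bigID (conn x)) /=.
rewrite [X in _ + X]big1 ?addr0 // => z; apply: contraNeq.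
by move/entry_iso/hx.
Qed.

(** The component of [x] is then the only one of its type and has no nontrivial automorphism, so its
    diagonal block is 1 and [u x y] is 0 or 1. *)
Lemma not_movable_comm x y (a : A) : ~ movable x -> GRing.comm (u x y) a.
Proof.
move=> nmx.
have hx z : iso x z -> conn x z.
  by move=> xz; apply: contrapT => /negP nxz; apply/nmx/(swap_movable xz nxz).
have [->|/entry_iso/hx xy] := eqVneq (u x y) 0.
  by rewrite /GRing.comm mul0r mulr0.
have tr : qu_trivial R (component x).
  by apply/qaG/no_aut => /aut_movable.
have := qu_trivial_qmx tr (block_qmx qu x x) (comp_in (connect0 _ x)) (comp_in xy).
rewrite /= block_diag1 // => ->; rewrite /GRing.comm.
by case: ifP => _; rewrite ?(mul1r, mulr1, mul0r, mulr0).
Qed.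

(** Transported along an isomorphism of the two components, the submatrix becomes a magic matrix on
    a graph with trivial quantum group, so its entries are 0 or the whole block. *)
Lemma rigid_entry x y : ~ has_aut (component x) -> u x y != 0 -> u x y = block u x y.
Proof.
move=> /no_aut/qaG tr uxy; have := uxy.
have [f fb fadj] := entry_iso uxy; case: (fb) => g fK gK.
have qB := block_qmx qu x y; have [idem r c orth] := qB.
pose v (a b : component x) := u (val a) (val (f b)).
have qv : qmx (block u x y) v.
  split=> [a b|a|b|a a' b b' h].
  - exact: idem.
  - rewrite -(r a) [RHS](reindex f) //; exact/onW_bij.
  - exact: c.
  - apply: orth; move: h; rewrite fadj; congr (_ || _).
    by rewrite (bij_eq fb).
have := qu_trivial_qmx tr qv (comp_in (connect0 _ x)) (g (comp_in (connect0 _ y))).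
rewrite /v gK /= => ->; case: ifP => //; by rewrite eqxx.
Qed.

(** Swapping the first two components and swapping the last two have disjoint supports. *)
Lemma four_components (r : 'I_4 -> G) : (forall i j, iso (r i) (r j)) ->
  (forall i j, conn (r i) (r j) -> i = j) -> False.
Proof.
move=> riso rconn.
have nconn i j : i != j -> ~~ conn (r i) (r j) by apply: contraNN => /rconn ->.
pose i0 : 'I_4 := inord 0; pose i1 : 'I_4 := inord 1.
pose i2 : 'I_4 := inord 2; pose i3 : 'I_4 := inord 3.
have ne (a b : nat) : (a < 4)%N -> (b < 4)%N -> a != b -> (inord a : 'I_4) != inord b.
  by move=> a4 b4; rewrite -val_eqE /= !inordK.
have [F [FG F1 Fs]] := component_swap (riso i0 i1) (nconn _ _ (ne 0 1 isT isT isT)).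
have [K [KG K1 Ks]] := component_swap (riso i2 i3) (nconn _ _ (ne 2 3 isT isT isT)).
apply: nsG; apply: (schmidt_intro FG KG) => // z /Fs Fz.
apply: contrapT => /eqP/Ks Kz.
have no a b : (a < 4)%N -> (b < 4)%N -> a != b -> conn (r (inord a)) z ->
    ~ conn (r (inord b)) z.
  move=> a4 b4 ab az bz; have := nconn _ _ (ne a b a4 b4 ab).
  by rewrite (connect_trans az) // connC.
by case/orP: Fz => Fz; case/orP: Kz; apply: (no _ _ _ _ _ Fz).
Qed.

Lemma qmx_commute x y x' y' : GRing.comm (u x y) (u x' y').
Proof.
apply: contrapT => nc.
have mx : movable x by apply: contrapT => /(not_movable_comm y (u x' y')).
have mx' : movable x'.
  by apply: contrapT => /(not_movable_comm y' (u x y))/esym.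
have xx' := movable_iso mx mx'.
have u0 : u x y != 0.
  by apply/eqP => u0; apply: nc; rewrite u0 /GRing.comm mul0r mulr0.
have u0' : u x' y' != 0.
  by apply/eqP => u0'; apply: nc; rewrite u0' /GRing.comm mul0r mulr0.
(* If the component of [x] is the only one of its type, all four vertices lie in it and its block is
   1, so commutation for components applies. *)
have [hx|/existsNP[z /not_implyP[xz /negP nxz]]] :=
    pselect (forall z, iso x z -> conn x z).
  have xy := hx _ (entry_iso u0).
  have cx' := hx _ xx'; have cy' := hx _ (graph_iso_trans xx' (entry_iso u0')).
  have nsx : ~ schmidt (component x) by move/schmidt_component.
  have qB := block_qmx qu x x; rewrite (block_diag1 hx) in qB.
  apply: nc.
  exact: (cqG nsx qB (fun a b => su _ _) (comp_in (connect0 _ x)) (comp_in xy)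
    (comp_in cx') (comp_in cy')).
(* Now [z] lies in a second copy. Nontrivial automorphisms of the two copies would have disjoint
   supports, so the copies are rigid and nonzero entries are whole blocks. *)
have nax : ~ has_aut (component x).
  move=> ax; have [F [FG F1 Fs]] := component_has_aut ax.
  have [K [KG K1 Ks]] := component_has_aut (has_aut_iso xz ax).
  apply: nsG; apply: (schmidt_intro FG KG) => // w /Fs xw.
  apply: contrapT => /eqP/Ks zw; case/negP: nxz.
  by apply: connect_trans xw _; rewrite connC.
have nax' : ~ has_aut (component x').
  by move=> ax'; apply/nax/(has_aut_iso _ ax')/graph_iso_sym.
apply: nc; rewrite (rigid_entry nax u0) (rigid_entry nax' u0').
have symG := sym_connect_sym (@adj_sym G).
(* The components isomorphic to that of [x], represented by their roots, index a magic unitary of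
   blocks of size at most 3. *)
pose P := [pred r | fingraph.roots (@adj G) r && `[< iso x r >]].
pose I : finType := {r : G | P r}.
have IP (i : I) : fingraph.roots (@adj G) (val i) /\ iso x (val i).
  by have /andP[? /asboolP] := valP i.
have Iconn (i j : I) : conn (val i) (val j) -> i = j.
  have [/eqP ri _] := IP i; have [/eqP rj _] := IP j.
  by move/(fingraph.rootP symG); rewrite ri rj => /val_inj.
have I3 : (#|I| <= 3)%N.
  rewrite leqNgt; apply/negP => I4.
  pose r (i : 'I_4) : I := enum_val (widen_ord I4 i).
  apply: (@four_components (fun i => val (r i))) => i j.
    by apply: graph_iso_trans (proj2 (IP (r j))); apply/graph_iso_sym/(proj2 (IP (r i))).
  by move/Iconn/enum_val_inj/(congr1 val) => /= /val_inj.
pose q (i j : I) := block u (val i) (val j).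
have qr (i : I) : \sum_j q i j = 1.
  rewrite -(block_sum qu (val i)) [RHS](bigID (fun y => `[< iso x y >])) /=.
  rewrite [X in _ + X]big1 => [|w /andP[_ /asboolP nw]]; last first.
    apply/eqP/negPn/negP => /block_iso iw; apply: nw.
    exact: graph_iso_trans (proj2 (IP i)) iw.
  rewrite addr0 (big_sub P (fun w => block u (val i) w)) //.
have orow (i j j' : I) : j != j' -> q i j * q i j' = 0.
  by move=> jj'; apply: (block_orth qu); apply: contraNN jj' => /Iconn ->.
have ocol (i i' j : I) : i != i' -> q i j * q i' j = 0.
  move=> ii'; rewrite /q !(block_tr qu); apply: (block_orth (qmx_tr qu)).
  by apply: contraNN ii' => /Iconn ->.
have rt w : iso x w -> exists i : I, conn w (val i).
  move=> xw; have cw : conn w (fingraph.root (@adj G) w) by apply: connect_root.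
  have Pw : P (fingraph.root (@adj G) w).
    rewrite inE roots_root //=; apply/asboolP.
    exact: graph_iso_trans xw (component_conn cw).
  by exists (exist (fun r => P r) _ Pw).
have [i xi] := rt x (graph_iso_refl _); have [i' xi'] := rt x' xx'.
have [j yj] := rt y (entry_iso u0).
have [j' yj'] := rt y' (graph_iso_trans xx' (entry_iso u0')).
rewrite (block_connl qu y xi) (block_connr u _ yj) (block_connl qu y' xi') (block_connr u _ yj').
exact: (magic3_comm I3 (fun i j => block_projection (val i) (val j) qu su) qr orow ocol).
Qed.

End CommutingStep.

Lemma commuting_compl (R : realType) (G : sgraph) :
  commuting_qmx R (gcompl G) -> commuting_qmx R G.
Proof. by move=> com A u qu; apply: (com A u (qmx_compl qu)). Qed.

(** * The axiom (SA) and the three closure statements *)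

Section Class.
Variables (R : realType) (F : graph_class).
Hypothesis F_compl : forall G : sgraph, F G -> F (gcompl G).
Hypothesis F_component : forall (G : sgraph) (x : G), F G -> F (component x).
Hypotheses (QI : axiom_QI R F) (QA : axiom_QA R F) (SA : axiom_SA R F).

Lemma dec_commuting G : dec F G -> ~ schmidt G -> commuting_qmx R G.
Proof.
have step (H : sgraph) : (forall x : H, dec F (component x)) ->
    (forall x : H, ~ schmidt (component x) -> commuting_qmx R (component x)) ->
    ~ schmidt H -> commuting_qmx R H.
  move=> dH IH nsH A u qu su; apply: qmx_commute => // x.
    by move=> y; apply: (dec_qi_rigid F_compl F_component QI).
  exact: (dec_qa_rigid QA).
elim=> {G}[G FG|G dG IH|G dG IH] ns.
- by apply: no_symmetry_commuting => /(SA FG).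
- exact: step.
- by apply/commuting_compl/step => // /schmidt_of_compl.
Qed.

End Class.

Theorem theorem5p13 (R : realType) (F : graph_class)
  (F_compl : forall G : sgraph, F G -> F (gcompl G))
  (F_component : forall (G : sgraph) (x : G), F G -> F (component x)) :
  [/\ axiom_QI R F -> axiom_QI R (co F),
      axiom_QI R F /\ axiom_QA R F -> axiom_QI R (co F) /\ axiom_QA R (co F)
    & [/\ axiom_QI R F, axiom_QA R F & axiom_SA R F] ->
      [/\ axiom_QI R (co F), axiom_QA R (co F) & axiom_SA R (co F)]].
Proof.
have QI : axiom_QI R F -> axiom_QI R (co F) by apply: co_QI.
have QA : axiom_QA R F -> axiom_QA R (co F).
  move=> QAF G /(co_dec F_compl F_component) dG.
  by split; [exact: qu_trivial_no_aut | exact: (dec_qa_rigid QAF)].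
split=> // [[/QI ? /QA ?]|[QIF QAF SAF]] //; split; [exact: QI | exact: QA |].
move=> G /(co_dec F_compl F_component) dG; split=> [qs|sch B iota env comB].
  apply: contrapT => /(dec_commuting F_compl F_component QIF QAF SAF dG) com.
  exact: (commuting_no_symmetry com qs).
(* One commutative envelope refutes quantum symmetry, and then the entries of all magic unitaries
   would commute. *)
apply: (schmidt_not_commuting sch (R := R)); apply: no_symmetry_commuting => qs.
exact: qs env comB.
Qed.
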